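(* Let $X_1,X_2,\dots$ be iid with parent random variable $X$ having finite mean $\mu$ and variance $\sigma^2$; fix $p\in(0,1)$ and an integer $r\ge1$. Assume $F_X$ is differentiable at $q_X(p)$ with $f_X(q_X(p))>0$, $\mathbb{E}[X^{2r}]<\infty$, and, if $r=1$, that the density $f_X$ exists and is positive at $\mu$ (so $F_X$ is continuous at $\mu$). Let $h_1,h_2$ be continuous real functions differentiable at $q_X(p)$ and $m(X,r)$. Write $c_r=\mathbb{E}\big[(X-\mu)^{r-1}(\operatorname{sgn}(X-\mu))^r\big]$. Then $$\sqrt n\begin{pmatrix} h_1(q_n(p))-h_1(q_X(p))\\ h_2(\hat m(X,n,r))-h_2(m(X,r))\end{pmatrix}\xrightarrow{d}\mathcal N(0,\Sigma^{(r)}),$$ with $\Sigma^{(r)}_{11}=\frac{p(1-p)}{f_X^2(q_X(p))}(h_1'(q_X(p)))^2$, $\Sigma^{(r)}_{22}=(h_2'(m(X,r)))^2\operatorname{Var}\big(|X-\mu|^r-r c_r(X-\mu)\big)$, and $$\Sigma^{(r)}_{12}=\Sigma^{(r)}_{21}=h_1'(q_X(p))h_2'(m(X,r))\frac{\tau_r(|X-\mu|,p)-r c_r\,\tau_1(p)}{f_X(q_X(p))}.$$ Consequently, if $h_1'(q_X(p))h_2'(m(X,r))\ne0$ and $\operatorname{Var}(|X-\mu|^r-rc_r(X-\mu))>0$, the correlation of the limiting law equals $$\operatorname{sgn}\!\big(h_1'(q_X(p))h_2'(m(X,r))\big)\frac{\tau_r(|X-\mu|,p)-rc_r\tau_1(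p)}{\sqrt{p(1-p)\operatorname{Var}\big(|X-\mu|^r-rc_r(X-\mu)\big)}}.$$
   Context: $F_X,f_X$ cdf and density of $X$; $q_X(p)=\inf\{x:F_X(x)\ge p\}$; $q_n(p)=X_{(\lceil np\rceil)}$; $\bar X_n=\frac1n\sum X_i$; $m(X,r)=\mathbb{E}|X-\mu|^r$; $\hat m(X,n,r)=\frac1n\sum_{i=1}^n|X_i-\bar X_n|^r$. For continuous $\eta$, $\tau_k(\eta(X),p):=(1-p)\big(\mathbb{E}[\eta^k(X)\mid X>q_X(p)]-\mathbb{E}[\eta^k(X)]\big)$ and $\tau_k(p):=\tau_k(X,p)$; $\operatorname{sgn}$ is the signum function. *)

(* Defs.v *)
From HB Require Import structures.
From mathcomp Require Import all_boot all_order all_algebra.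
From mathcomp Require Import all_classical all_reals all_analysis.

Set Implicit Arguments.
Unset Strict Implicit.
Unset Printing Implicit Defensive.

Import Order.TTheory GRing.Theory Num.Def Num.Theory.
Import numFieldTopology.Exports.

Local Open Scope classical_set_scope.
Local Open Scope ring_scope.

Section defs.
Context {d : measure_display} {T : measurableType d} {R : realType}
  (P : probability T R).

Definition mutually_independent (X : nat -> T -> R) : Prop :=
  forall (I : seq nat) (B : nat -> set R), uniq I ->
    (forall i, measurable (B i)) ->
    fine (P (\bigcap_(i in [set` I]) (X i @^-1` B i)))
      = \prod_(i <- I) fine (P (X i @^-1` B i)).

Definition iid_with_parent (X : nat -> {RV P >-> R}) (X0 : {RV P >-> R}) : Prop :=
  mutually_independent (fun i => X i) /\
  forall i (B : set R), measurable B -> P (X i @^-1` B) = P (X0 @^-1` B).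

Definition cdfR (X0 : {RV P >-> R}) (x : R) : R := fine (cdf X0 x).

Definition quantile (X0 : {RV P >-> R}) (p : R) : R :=
  inf [set x | p <= cdfR X0 x].

Definition Er (f : T -> R) : R := fine ('E_P[f])%E.

Definition mean (X0 : {RV P >-> R}) : R := Er X0.

Definition cmoment (X0 : {RV P >-> R}) (r : nat) : R :=
  Er (fun w => `|X0 w - mean X0| ^+ r).

Definition condE (Z : T -> R) (A : set T) : R :=
  Er (fun w => Z w * \1_A w) / fine (P A).

Definition tau (X0 : {RV P >-> R}) (eta : R -> R) (k : nat) (p : R) : R :=
  (1 - p) * (condE (fun w => eta (X0 w) ^+ k) [set w | quantile X0 p < X0 w]
             - Er (fun w => eta (X0 w) ^+ k)).

Definition c_coef (X0 : {RV P >-> R}) (r : nat) : R :=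
  Er (fun w => (X0 w - mean X0) ^+ r.-1 * (Num.sg (X0 w - mean X0)) ^+ r).

Definition var_term (X0 : {RV P >-> R}) (r : nat) : R :=
  fine (variance P (fun w => `|X0 w - mean X0| ^+ r
                             - r%:R * c_coef X0 r * (X0 w - mean X0))).

End defs.

Section sample.
Context {T : Type} {R : realType}.

Definition sample_mean (X : nat -> T -> R) (n : nat) (w : T) : R :=
  (n%:R)^-1 * \sum_(i < n) X i w.

Definition sample_cmoment (X : nat -> T -> R) (n r : nat) (w : T) : R :=
  (n%:R)^-1 * \sum_(i < n) `|X i w - sample_mean X n w| ^+ r.

(** k-th order statistic X_(k) (1-indexed) of the sample X 0 .. X (n-1) *)
Definition order_stat (X : nat -> T -> R) (n k : nat) (w : T) : R :=
  nth 0 (sort <=%R [seq X i w | i <- iota 0 n]) k.-1.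

Definition sample_quantile (X : nat -> T -> R) (n : nat) (p : R) (w : T) : R :=
  order_stat X n `|Num.ceil (n%:R * p)|%N w.

End sample.

Section gauss2.
Context {R : realType}.

(** E[g(A Z)] for Z = (Z1, Z2) standard Gaussian vector, A = [[a11,a12],[a21,a22]] *)
Definition gauss2_expect (a11 a12 a21 a22 : R) (g : R -> R -> R) : R :=
  fine (\int[@lebesgue_measure R]_z1 \int[@lebesgue_measure R]_z2
          ((g (a11 * z1 + a12 * z2) (a21 * z1 + a22 * z2)
             * normal_pdf 0 1 z1 * normal_pdf 0 1 z2)%:E))%E.

End gauss2.

(** Convergence in distribution of the random vectors (Y1 n, Y2 n) to the
    centered bivariate normal law N(0, [[s11, s12], [s12, s22]]), i.e. to the
    law of A Z for some A with A A^T = Sigma (all such A give the same law);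
    convergence in distribution is tested against all bounded continuous
    functions g : R^2 -> R. *)
Definition cvg_in_law_normal2 {d : measure_display} {T : measurableType d}
  {R : realType} (P : probability T R) (Y1 Y2 : nat -> T -> R)
  (s11 s12 s22 : R) : Prop :=
  exists a11 a12 a21 a22 : R,
    [/\ a11 ^+ 2 + a12 ^+ 2 = s11, a11 * a21 + a12 * a22 = s12,
        a21 ^+ 2 + a22 ^+ 2 = s22 &
    forall g : R -> R -> R,
      continuous (fun z : R * R => g z.1 z.2) ->
      (exists M : R, forall x y, `|g x y| <= M) ->
      (fun n => fine ('E_P[fun w => g (Y1 n w) (Y2 n w)])%E) @ \oo
        --> gauss2_expect a11 a12 a21 a22 g].

(* Main.v *)
(** Both coordinates are asymptotically linear. By Chebyshev applied to the
    increments of the empirical distribution function between q and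
    q + y / sqrt n, and a separation argument of Ghosh, sqrt n (q_n - q) differs
    from n^(-1/2) sum (p - 1{X_i <= q}) / f(q) by a term tending to 0 in
    probability (Bahadur). A Taylor expansion of |y - d|^r at the random shift
    d = mean X_n - mu does the same for the sample moment, the first-order term
    producing the correction - r c_r (X_i - mu); for r = 1 the kink of the
    absolute value only matters on {|X_i - mu| <= |d|}, which is negligible because
    the law of X has no atom at mu. The delta method transfers both expansions
    through h1 and h2.

    It remains to prove a bivariate central limit theorem for bounded continuous
    test functions. The expectations E cos(th + sum) satisfy a two-term recursion
    in the number of summands, which gives convergence of all trigonometric
    expectations to those of the Gaussian vector. Any bounded continuous function
    is approximated uniformly on a large square, with the same bound everywhere, by
    a Bernstein polynomial in sin (x / L) and sin (y / L); this is a trigonometric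
    polynomial, and tightness takes care of the complement of the square. *)
Require Import Defs.
From HB Require Import structures.
From mathcomp Require Import all_boot all_order all_algebra.
From mathcomp Require Import all_classical all_reals all_analysis.
From mathcomp Require Import measurable_realfun.
From mathcomp Require Import ring lra.
Set Implicit Arguments.
Unset Strict Implicit.
Unset Printing Implicit Defensive.
Import Order.TTheory GRing.Theory Num.Def Num.Theory.
Import numFieldNormedType.Exports.
Local Open Scope classical_set_scope.
Local Open Scope ring_scope.

(** * Expectations and probabilities *)

(** Everything stays real: the phase [th] in [cos (th + ...)] replaces complex exponentials, since a
    sine is a cosine with phase shifted by [pi / 2]. Independence is given for finite families of
    events, so it must be carried to functions: by staircases to bounded ones, then by truncation to
    square integrable ones. A central limit theorem for one score suffices: a combination $s a + t
    b$ of the two scores is again a function of a single observation (Cramer-Wold). Since all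
    summands have one law, dominated convergence with envelope a multiple of $a^2$ takes the place
    of a Lindeberg condition. For the quantile, $F$ is differentiable at $q$ only, so increments are
    bounded in mean square at each fixed $y$; Ghosh's argument uses finitely many $y$, hence no
    uniform control of the empirical process. For the moment, $2r$ moments make $(1 + |X - \mu|)^r$
    square integrable, and this one function dominates every term of the expansion. Bernstein
    polynomials are used because their positivity preserves the bound of the test function, so that
    the complement of the square costs at most twice that bound times a small probability. *)

Definition L1 d (T : measurableType d) (R : realType) (P : probability T R)
  (f : T -> R) : Prop := P.-integrable setT (EFin \o f).
(** Measurability is a separate clause because integrability of the square does not imply it. *)
Definition L2 d (T : measurableType d) (R : realType) (P : probability T R)
  (f : T -> R) : Prop :=
  measurable_fun setT f /\ L1 P (fun w => f w ^+ 2).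
Definition Pr d (T : measurableType d) (R : realType) (P : probability T R)
  (A : set T) : R := fine (P A).

Section expectation_calculus.
Context d (T : measurableType d) (R : realType) (P : probability T R).
Implicit Types (f g : T -> R) (A B : set T).

Lemma ErE f : Er P f = \int[P]_x f x.
Proof. by rewrite /Er unlock. Qed.

Lemma L1_mfun f : L1 P f -> measurable_fun setT f.
Proof. by move=> /integrableP[/measurable_EFinP]. Qed.

Lemma L1_le f g : measurable_fun setT f -> L1 P g ->
  (forall w, `|f w| <= g w) -> L1 P f.
Proof.
move=> mf ig fg; apply: (le_integrable _ _ _ ig) => //.
  exact/measurable_EFinP.
by move=> w _ /=; rewrite lee_fin (le_trans (fg w))// ler_norm.
Qed.

Lemma L1_bounded f (M : R) : measurable_fun setT f ->
  (forall w, `|f w| <= M) -> L1 P f.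
Proof.
move=> mf fM; apply: measurable_bounded_integrable => //.
  by rewrite [X in (X < _)%E]probability_setT ltry.
exists M; split; first exact: num_real.
by move=> x Mx w _ /=; rewrite (le_trans (fM w))// ltW.
Qed.

Lemma L1_cst (c : R) : L1 P (fun=> c).
Proof. by apply: (@L1_bounded _ `|c|) => //; exact: measurable_cst. Qed.

Lemma L1D f g : L1 P f -> L1 P g -> L1 P (fun w => f w + g w).
Proof. by move=> f1 g1; have := integrableD measurableT f1 g1. Qed.

Lemma L1Z (c : R) f : L1 P f -> L1 P (fun w => c * f w).
Proof. by move=> f1; have := integrableZl measurableT c f1. Qed.

Lemma L1N f : L1 P f -> L1 P (fun w => - f w).
Proof.
move=> /(L1Z (-1)); congr (L1 _ _); apply/funext => w.
by rewrite mulN1r.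
Qed.

Lemma L1B f g : L1 P f -> L1 P g -> L1 P (fun w => f w - g w).
Proof. by move=> f1 /L1N; exact: L1D. Qed.

Lemma L1_norm f : L1 P f -> L1 P (fun w => `|f w|).
Proof.
move=> f1; apply: (@le_integrable _ _ _ _ _ _ _ (EFin \o f)) => //.
  by apply/measurable_EFinP/measurableT_comp => //; exact: L1_mfun.
by move=> w _ /=; rewrite normr_id.
Qed.

Lemma L1_sum (I : Type) (s : seq I) (F : I -> T -> R) :
  (forall i, L1 P (F i)) -> L1 P (fun w => \sum_(i <- s) F i w).
Proof.
move=> F1; elim: s => [|i s IH].
  by under eq_fun do rewrite big_nil; exact: L1_cst.
by under eq_fun do rewrite big_cons; exact: L1D.
Qed.

Lemma Er_cst (c : R) : Er P (fun=> c) = c.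
Proof. by rewrite ErE Rintegral_cst// [X in fine X]probability_setT mulr1. Qed.

Lemma ErD f g : L1 P f -> L1 P g ->
  Er P (fun w => f w + g w) = Er P f + Er P g.
Proof. by move=> *; rewrite !ErE RintegralD. Qed.

Lemma ErB f g : L1 P f -> L1 P g ->
  Er P (fun w => f w - g w) = Er P f - Er P g.
Proof. by move=> *; rewrite !ErE RintegralB. Qed.

Lemma ErZ (c : R) f : L1 P f -> Er P (fun w => c * f w) = c * Er P f.
Proof. by move=> *; rewrite !ErE RintegralZl. Qed.

Lemma Er_sum (I : Type) (s : seq I) (F : I -> T -> R) :
  (forall i, L1 P (F i)) ->
  Er P (fun w => \sum_(i <- s) F i w) = \sum_(i <- s) Er P (F i).
Proof.
move=> F1; elim: s => [|i s IH].
  by rewrite big_nil; under eq_fun do rewrite big_nil; exact: Er_cst.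
rewrite big_cons -IH -ErD//; last exact: L1_sum.
by congr (Er _ _); apply/funext => w; rewrite big_cons.
Qed.

Lemma Er_ge0 f : (forall w, 0 <= f w) -> 0 <= Er P f.
Proof. by move=> f0; rewrite ErE Rintegral_ge0. Qed.

Lemma le_Er f g : L1 P f -> L1 P g -> (forall w, f w <= g w) ->
  Er P f <= Er P g.
Proof. by move=> *; rewrite !ErE le_Rintegral. Qed.

Lemma le_norm_Er f : L1 P f -> `|Er P f| <= Er P (fun w => `|f w|).
Proof. by move=> *; rewrite !ErE le_normr_Rintegral. Qed.

Lemma norm_Er_le f (M : R) : L1 P f -> (forall w, `|f w| <= M) ->
  `|Er P f| <= M.
Proof.
move=> f1 fM; rewrite (le_trans (le_norm_Er f1))// -[leRHS]Er_cst.
by apply: le_Er => //; [exact: L1_norm|exact: L1_cst].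
Qed.

Lemma eq_Er f g : f =1 g -> Er P f = Er P g.
Proof. by move=> /funext ->. Qed.

Lemma L2_mfun f : L2 P f -> measurable_fun setT f.
Proof. by case. Qed.

Lemma L2M f g : L2 P f -> L2 P g -> L1 P (fun w => f w * g w).
Proof.
move=> [mf f2] [mg g2]; apply: (L1_le _ (L1D f2 g2)).
  exact: measurable_funM.
move=> w; rewrite normrM -[f w ^+ 2]real_normK ?num_real//.
rewrite -[g w ^+ 2]real_normK ?num_real//.
have := sqr_ge0 (`|f w| - `|g w|).
have := mulr_ge0 (normr_ge0 (f w)) (normr_ge0 (g w)); nra.
Qed.

Lemma L2_cst (c : R) : L2 P (fun=> c).
Proof. by split; [exact: measurable_cst|exact: L1_cst]. Qed.

Lemma L2_L1 f : L2 P f -> L1 P f.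
Proof.
move=> /L2M-/(_ _ (L2_cst 1)); congr (L1 _ _).
by apply/funext => w; rewrite mulr1.
Qed.

Lemma L2_le f g : measurable_fun setT f -> L2 P g ->
  (forall w, `|f w| <= `|g w|) -> L2 P f.
Proof.
move=> mf [mg g2] fg; split=> //; apply: (L1_le _ g2).
  exact: measurable_funX.
move=> w; rewrite normrX -[leRHS]real_normK ?num_real//.
by rewrite lerXn2r ?nnegrE.
Qed.

Lemma L2D f g : L2 P f -> L2 P g -> L2 P (fun w => f w + g w).
Proof.
move=> f2 g2; split.
  by apply: measurable_funD; exact: L2_mfun.
have -> : (fun w => (f w + g w) ^+ 2) =
  (fun w => (f w ^+ 2 + 2 * (f w * g w)) + g w ^+ 2).
  by apply/funext => w; ring.
by apply: L1D; [apply: L1D; [exact: f2.2|exact/L1Z/L2M]|exact: g2.2].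
Qed.

Lemma L2Z (c : R) f : L2 P f -> L2 P (fun w => c * f w).
Proof.
move=> [mf f2]; split; first exact: measurable_funM.
by under eq_fun do rewrite exprMn; exact: L1Z.
Qed.

Lemma L2B f g : L2 P f -> L2 P g -> L2 P (fun w => f w - g w).
Proof.
move=> f2 /(L2Z (-1)) /(L2D f2); congr (L2 _ _).
by apply/funext => w; rewrite mulN1r.
Qed.

Lemma L2_sum (I : Type) (s : seq I) (F : I -> T -> R) :
  (forall i, L2 P (F i)) -> L2 P (fun w => \sum_(i <- s) F i w).
Proof.
move=> F1; elim: s => [|i s IH].
  by under eq_fun do rewrite big_nil; exact: L2_cst.
by under eq_fun do rewrite big_cons; exact: L2D.
Qed.

Lemma L2_bounded f (M : R) : measurable_fun setT f ->
  (forall w, `|f w| <= M) -> L2 P f.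
Proof.
move=> mf fM; apply: (L2_le mf (L2_cst M)) => w.
exact: le_trans (fM w) (ler_norm _).
Qed.

(** Discriminant of the nonnegative quadratic $t \mapsto E (t f - g)^2$. It later shows that the
    limiting covariance matrix is positive semidefinite. *)
Lemma Er_CauchySchwarz f g : L2 P f -> L2 P g ->
  Er P (fun w => f w * g w) ^+ 2 <=
  Er P (fun w => f w ^+ 2) * Er P (fun w => g w ^+ 2).
Proof.
move=> f2 g2.
set a := Er P (fun w => f w ^+ 2); set b := Er P (fun w => f w * g w).
set c := Er P (fun w => g w ^+ 2).
have key t : 0 <= a * t ^+ 2 - 2 * b * t + c.
  have -> : a * t ^+ 2 - 2 * b * t + c = Er P (fun w => (t * f w - g w) ^+ 2).
    have -> : (fun w => (t * f w - g w) ^+ 2) =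
      (fun w => (t ^+ 2 * f w ^+ 2 + (- (2 * t)) * (f w * g w)) + g w ^+ 2).
      by apply/funext => w; ring.
    rewrite ErD ?ErD ?ErZ//; [rewrite -/a -/b -/c; ring|exact: L2M|exact: f2.2
      |exact/L1Z/f2.2|exact/L1Z/L2M|  |exact: g2.2].
    by apply: L1D; [exact/L1Z/f2.2|exact/L1Z/L2M].
  by apply: Er_ge0 => w; exact: sqr_ge0.
have a0 : 0 <= a by apply: Er_ge0 => w; exact: sqr_ge0.
have c0 : 0 <= c by apply: Er_ge0 => w; exact: sqr_ge0.
have [a1|a1] := eqVneq a 0.
  have [->|b0] := eqVneq b 0; first by rewrite expr0n /= mulr_ge0.
  (* With [a = 0] the quadratic is affine, and at this point it takes the value $-1$. *)
  have := key ((c + 1) / (2 * b)); rewrite a1 mul0r add0r.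
  have -> : - (2 * b * ((c + 1) / (2 * b))) = - (c + 1) by field.
  lra.
have ap : 0 < a by rewrite lt_def a1.
(* The minimiser of the quadratic. *)
have := key (b / a).
have -> : a * (b / a) ^+ 2 - 2 * b * (b / a) + c = (a * c - b ^+ 2) / a by field.
by rewrite pmulr_lge0 ?invr_gt0// subr_ge0.
Qed.

Lemma le_Pr A B : measurable A -> measurable B -> A `<=` B -> Pr P A <= Pr P B.
Proof.
move=> mA mB AB; by rewrite fine_le ?fin_num_measure// le_measure// inE.
Qed.

Lemma Pr_setU A B : measurable A -> measurable B ->
  Pr P (A `|` B) <= Pr P A + Pr P B.
Proof.
move=> mA mB; rewrite -lee_fin EFinD /Pr !fineK ?fin_num_measure//.
  exact: measureU2.
exact: measurableU.
Qed.

Lemma Pr_indic A : measurable A -> Pr P A = Er P \1_A.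
Proof. by move=> mA; rewrite /Er expectation_indic. Qed.

Lemma L1_indic A : measurable A -> L1 P \1_A.
Proof.
move=> mA; apply: (@L1_bounded _ 1); first exact: measurable_indic.
by move=> w; rewrite indicE; case: (_ \in _); rewrite ?normr1 ?normr0.
Qed.

Lemma measurable_gt_norm f (e : R) : measurable_fun setT f ->
  measurable [set w | e < `|f w|].
Proof.
move=> mf; have /(_ measurableT [set true]) : measurable_fun setT (fun w => e < `|f w|).
  by apply: measurable_fun_ltr => //; exact: measurableT_comp.
by rewrite setTI; exact.
Qed.

Lemma measurable_le_fun f (e : R) : measurable_fun setT f ->
  measurable [set w | f w <= e].
Proof.
move=> mf; have /(_ measurableT [set true]) : measurable_fun setT (fun w => f w <= e).
  by apply: measurable_fun_ler => //; exact: measurableT_comp.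
by rewrite setTI; exact.
Qed.

Lemma measurable_lt_fun f (e : R) : measurable_fun setT f ->
  measurable [set w | f w < e].
Proof.
move=> mf; have /(_ measurableT [set true]) : measurable_fun setT (fun w => f w < e).
  by apply: measurable_fun_ltr => //; exact: measurableT_comp.
by rewrite setTI; exact.
Qed.

Lemma markov_Er f (e : R) : 0 < e -> L1 P f ->
  Pr P [set w | e < `|f w|] <= Er P (fun w => `|f w|) / e.
Proof.
move=> e0 f1; have mf := L1_mfun f1.
rewrite ler_pdivlMr// mulrC Pr_indic; last exact: measurable_gt_norm.
rewrite -ErZ; last exact/L1_indic/measurable_gt_norm.
apply: le_Er; [exact/L1Z/L1_indic/measurable_gt_norm|exact: L1_norm|].
move=> w; rewrite indicE; have [|] := boolP (w \in _).
  by rewrite inE /= mulr1 => /ltW.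
by rewrite mulr0.
Qed.

Lemma chebyshev_Er f (e : R) : 0 < e -> L2 P f ->
  Pr P [set w | e < `|f w|] <= Er P (fun w => f w ^+ 2) / e ^+ 2.
Proof.
move=> e0 f2; have e2 : 0 < e ^+ 2 by rewrite exprn_gt0.
rewrite (@eq_Er (fun w => f w ^+ 2) (fun w => `|f w ^+ 2|)); last first.
  by move=> w; rewrite ger0_norm ?sqr_ge0.
rewrite (_ : [set w | e < `|f w|] = [set w | e ^+ 2 < `|f w ^+ 2|]).
  exact: markov_Er f2.2.
by apply/funext => w /=; rewrite normrX ltr_pXn2r// ?nnegrE ?(ltW e0).
Qed.

Lemma cvg_Er (F : nat -> T -> R) f g : (forall n, measurable_fun setT (F n)) ->
  L1 P g -> (forall n w, `|F n w| <= g w) ->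
  (forall w, F n w @[n --> \oo] --> f w) ->
  Er P (F n) @[n --> \oo] --> Er P f.
Proof.
move=> mF g1 Fg Ff.
have cv : (\int[P]_x (F n x)%:E)%E @[n --> \oo] --> (\int[P]_x (f x)%:E)%E.
  apply: (dominated_cvg measurableT) g1 _ => //.
  - by move=> n; exact/measurable_EFinP.
  - by move=> w _; apply: cvg_EFin; [exact: nearW|exact: Ff].
  - by move=> n w _; rewrite lee_fin.
rewrite ErE /Rintegral.
under eq_fun do rewrite ErE /Rintegral.
apply: fine_cvg; rewrite fineK//.
have mf : measurable_fun setT f by exact: (measurable_fun_cvg mF).
apply: integrable_fin_num => //; apply: (L1_le mf g1) => w.
have /cvg_norm/(cvgr_to_le) := Ff w; apply=> //.
by apply: nearW => n; exact: Fg.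
Qed.

End expectation_calculus.

(** * Stochastic order symbols *)

(** The symbols $o_P(1)$ and, below, $O_P(1)$. Measurability is built in so that the events in the
    calculus are always measurable. *)
Definition oP d (T : measurableType d) (R : realType) (P : probability T R)
  (Z : nat -> T -> R) : Prop :=
  (forall n, measurable_fun setT (Z n)) /\
  forall e dl : R, 0 < e -> 0 < dl ->
    \forall n \near \oo, Pr P [set w | e < `|Z n w|] <= dl.
Definition OP d (T : measurableType d) (R : realType) (P : probability T R)
  (Z : nat -> T -> R) : Prop :=
  (forall n, measurable_fun setT (Z n)) /\
  forall dl : R, 0 < dl -> exists2 L, 0 < L &
    \forall n \near \oo, Pr P [set w | L < `|Z n w|] <= dl.

Section stochastic_order.
Context d (T : measurableType d) (R : realType) (P : probability T R).
Implicit Types (Z W : nat -> T -> R).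

(** The union bound behind the rules for sums and products: outside two rare events both inputs are
    controlled, hence so is the output. *)
Lemma Pr_norm_setU (f g h : T -> R) (a b c : R) :
  measurable_fun setT f -> measurable_fun setT g -> measurable_fun setT h ->
  (forall w, `|f w| <= a -> `|g w| <= b -> `|h w| <= c) ->
  Pr P [set w | c < `|h w|] <=
  Pr P [set w | a < `|f w|] + Pr P [set w | b < `|g w|].
Proof.
move=> mf mg mh fgh.
have m1 := measurable_gt_norm a mf; have m2 := measurable_gt_norm b mg.
apply: le_trans (Pr_setU _ m1 m2).
apply: le_Pr; [exact: measurable_gt_norm|exact: measurableU|].
move=> w /= ch; have [fa|] := leP `|f w| a; last by left.
have [gb|] := leP `|g w| b; last by right.
by move: (fgh w fa gb); rewrite leNgt ch.
Qed.

Lemma oP_ext Z W : (forall n w, Z n w = W n w) -> oP P Z -> oP P W.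
Proof.
by move=> ZW; have -> : Z = W by apply/funext => n; apply/funext => w.
Qed.

Lemma OP_ext Z W : (forall n w, Z n w = W n w) -> OP P Z -> OP P W.
Proof.
by move=> ZW; have -> : Z = W by apply/funext => n; apply/funext => w.
Qed.

Lemma oPD Z W : oP P Z -> oP P W -> oP P (fun n w => Z n w + W n w).
Proof.
move=> [mZ Z0] [mW W0].
have mZW n : measurable_fun setT (fun w => Z n w + W n w).
  exact: measurable_funD.
split=> // e dl e0 dl0.
have e2 : 0 < e / 2 by rewrite divr_gt0.
have d2 : 0 < dl / 2 by rewrite divr_gt0.
have {}Z0 := Z0 _ _ e2 d2; have {}W0 := W0 _ _ e2 d2.
near=> n; rewrite [leRHS](splitr dl).
apply: (@le_trans _ _ (Pr P [set w | e / 2 < `|Z n w|] +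
                       Pr P [set w | e / 2 < `|W n w|])).
  apply: Pr_norm_setU => // w Ze We.
  by rewrite (le_trans (ler_normD _ _))// [leRHS](splitr e) lerD.
by apply: lerD; near: n.
Unshelve. all: end_near. Qed.

Lemma oP_OP Z : oP P Z -> OP P Z.
Proof. by move=> [mZ Z0]; split=> // dl dl0; exists 1 => //; exact: Z0. Qed.

Lemma OPD Z W : OP P Z -> OP P W -> OP P (fun n w => Z n w + W n w).
Proof.
move=> [mZ Z0] [mW W0].
have mZW n : measurable_fun setT (fun w => Z n w + W n w).
  exact: measurable_funD.
split=> // dl dl0; have d2 : 0 < dl / 2 by rewrite divr_gt0.
have [L L0 {}Z0] := Z0 _ d2; have [M M0 {}W0] := W0 _ d2.
exists (L + M); first by rewrite addr_gt0.
near=> n; rewrite [leRHS](splitr dl).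
apply: (@le_trans _ _ (Pr P [set w | L < `|Z n w|] +
                       Pr P [set w | M < `|W n w|])).
  apply: Pr_norm_setU => // w Ze We.
  by rewrite (le_trans (ler_normD _ _))// lerD.
by apply: lerD; near: n.
Unshelve. all: end_near. Qed.

Lemma oPM Z W : oP P Z -> OP P W -> oP P (fun n w => Z n w * W n w).
Proof.
move=> [mZ Z0] [mW W0].
have mZW n : measurable_fun setT (fun w => Z n w * W n w).
  exact: measurable_funM.
split=> // e dl e0 dl0; have d2 : 0 < dl / 2 by rewrite divr_gt0.
have [M M0 {}W0] := W0 _ d2.
have eM : 0 < e / M by rewrite divr_gt0.
have {}Z0 := Z0 _ _ eM d2.
near=> n; rewrite [leRHS](splitr dl).
apply: (@le_trans _ _ (Pr P [set w | e / M < `|Z n w|] +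
                       Pr P [set w | M < `|W n w|])).
  apply: Pr_norm_setU => // w Ze We.
  by rewrite normrM -[leRHS](divfK (lt0r_neq0 M0)) ler_pM.
by apply: lerD; near: n.
Unshelve. all: end_near. Qed.

Lemma OP_bounded_seq (u : nat -> R) (M : R) : (forall n, `|u n| <= M) ->
  OP P (fun n _ => u n).
Proof.
move=> uM; split=> // dl dl0; exists (1 + `|M|); first by rewrite ltr_pwDl.
apply: nearW => n; rewrite (_ : mkset _ = set0).
  by rewrite /Pr measure0 /= ltW.
apply/seteqP; split=> // w /=; rewrite ltNge => /negP; apply.
by rewrite (le_trans (uM n))// (le_trans (ler_norm _))// lerDr.
Qed.

Lemma oPZ (c : R) Z : oP P Z -> oP P (fun n w => c * Z n w).
Proof.
move=> Z0; apply: (oP_ext (Z := fun n w => Z n w * c)).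
  by move=> n w; rewrite mulrC.
by apply: oPM => //; exact: (@OP_bounded_seq _ `|c|).
Qed.

Lemma oPN Z : oP P Z -> oP P (fun n w => - Z n w).
Proof. by move/(oPZ (-1)); apply: oP_ext => n w; rewrite mulN1r. Qed.

Lemma oPB Z W : oP P Z -> oP P W -> oP P (fun n w => Z n w - W n w).
Proof. by move=> Z0 /oPN; exact: oPD. Qed.

Lemma oP_cvg (u : nat -> R) : u n @[n --> \oo] --> 0 -> oP P (fun n _ => u n).
Proof.
move=> /cvgr0Pnorm_le u0; split=> // e dl e0 dl0; have {}u0 := u0 _ e0.
near=> n; rewrite (_ : mkset _ = set0).
  by rewrite /Pr measure0 /= ltW.
apply/seteqP; split=> // w /=; rewrite ltNge => /negP; apply.
by near: n.
Unshelve. all: end_near. Qed.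

Lemma oP_Er_sqr Z : (forall n, L2 P (Z n)) ->
  Er P (fun w => Z n w ^+ 2) @[n --> \oo] --> 0 -> oP P Z.
Proof.
move=> Z1 Z0; split=> [n|e dl e0 dl0]; first by case: (Z1 n).
have ed : 0 < e ^+ 2 * dl by rewrite mulr_gt0// exprn_gt0.
move/cvgr0Pnorm_le : Z0 => /(_ _ ed) Z0.
near=> n; rewrite (le_trans (chebyshev_Er e0 (Z1 n)))// ler_pdivrMr ?exprn_gt0//.
by rewrite mulrC (le_trans (ler_norm _))//; near: n.
Unshelve. all: end_near. Qed.

Lemma OP_Er_sqr Z (C : R) : (forall n, L2 P (Z n)) ->
  (forall n, Er P (fun w => Z n w ^+ 2) <= C) -> OP P Z.
Proof.
move=> Z1 ZC; split=> [n|dl dl0]; first by case: (Z1 n).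
have C1 : 0 < `|C| + 1 by rewrite ltr_wpDl.
have L0 : 0 < Num.sqrt ((`|C| + 1) / dl) by rewrite sqrtr_gt0 divr_gt0.
exists (Num.sqrt ((`|C| + 1) / dl)) => //.
apply: nearW => n; rewrite (le_trans (chebyshev_Er L0 (Z1 n)))//.
rewrite ler_pdivrMr ?exprn_gt0// sqr_sqrtr; last by rewrite ltW// divr_gt0.
rewrite mulrC divfK ?lt0r_neq0//.
by rewrite (le_trans (ZC n))// (le_trans (ler_norm _))// lerDl.
Qed.

(** Division-free form of differentiability, valid also at [y = z]. It serves both the delta method
    and the expansion of the distribution function at the quantile. *)
Lemma derivable_approx (h : R -> R) (z e : R) : derivable h z 1 -> 0 < e ->
  exists2 dl, 0 < dl & forall y, `|y - z| <= dl ->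
    `|h y - h z - derive1 h z * (y - z)| <= e * `|y - z|.
Proof.
move=> dh e0.
have : (k^-1 *: (h (k + z) - h z)) @[k --> 0^'] --> derive1 h z.
  suff : cvg ((k^-1 *: (h (k + z) - h z)) @[k --> 0^']) by [].
  have -> : (fun k => k^-1 *: (h (k + z) - h z)) =
     (fun k => k^-1 *: ((h \o shift z) (k *: 1) - h z)).
    by apply/funext => k; rewrite /= /shift scaler1.
  exact: dh.
move=> /cvgrPdist_le /(_ _ e0).
move=> -[/= dl dl0 H].
exists (dl / 2) => [|y yz]; first by rewrite divr_gt0.
have [->|yz0] := eqVneq y z; first by rewrite !subrr mulr0 subr0 normr0 mulr0.
have yz1 : y - z != 0 by rewrite subr_eq0.
have := H (y - z); rewrite /ball_ /= sub0r normrN subrK => /(_ _ yz1) H1.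

have e1 : h y - h z - h^`()%classic z * (y - z) =
  - (h^`()%classic z - (y - z)^-1 *: (h y - h z)) * (y - z).
  by rewrite /GRing.scale /=; field.
rewrite e1 normrM normrN ler_wpM2r// H1// (le_lt_trans yz)//.
by rewrite ltr_pdivrMr// ltr_pMr// ltr1n.
Qed.

Lemma near_sqrt_ge (L : R) : \forall n \near \oo, L <= Num.sqrt (n%:R : R).
Proof.
near=> n; rewrite (le_trans (ler_norm L))//.
rewrite -(ger0_norm (normr_ge0 L)) -sqrtr_sqr ler_wsqrtr//.
by near: n; exact: nbhs_infty_ger.
Unshelve. all: end_near. Qed.

(** On the event where $\sqrt n |Z_n - z| \le L$, the point $Z_n$ enters any neighbourhood of $z$
    for large $n$, so a derivative at the single point [z] is enough. Continuity of [h] makes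
    [h (Z n w)] measurable. *)
Lemma delta_method (h : R -> R) (z : R) Z : continuous h -> derivable h z 1 ->
  (forall n, measurable_fun setT (Z n)) ->
  OP P (fun n w => Num.sqrt n%:R * (Z n w - z)) ->
  oP P (fun n w => Num.sqrt n%:R * (h (Z n w) - h z) -
                   derive1 h z * (Num.sqrt n%:R * (Z n w - z))).
Proof.
move=> ch dh mZ [mZ' ZO].
have mhZ n : measurable_fun setT (fun w => h (Z n w)).
  by apply: measurableT_comp => //; exact: continuous_measurable_fun.
have mD n : measurable_fun setT (fun w => Num.sqrt n%:R * (h (Z n w) - h z) -
                   derive1 h z * (Num.sqrt n%:R * (Z n w - z))).
  apply: measurable_funB; last exact: measurable_funM.
  by apply: measurable_funM => //; exact: measurable_funB.
split=> // e dl e0 dl0.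
have [L L0 {}ZO] := ZO _ dl0.
(* Slope tolerance [e / L]: the remainder is at most $\sqrt n\,(e/L)\,|Z_n - z| \le e$ on the good
   event. *)
have eL : 0 < e / L by rewrite divr_gt0.
have [a a0 ha] := derivable_approx dh eL.
near=> n.
apply: (@le_trans _ _ (Pr P [set w | L < `|Num.sqrt n%:R * (Z n w - z)|]));
  last by near: n.
apply: le_Pr; [exact: measurable_gt_norm|exact: measurable_gt_norm|].
move=> w /=; rewrite !ltNge => /negP eh; apply/negP => ZL; apply: eh.
have n0 : 0 < Num.sqrt (n%:R : R).
  by apply: (@lt_le_trans _ _ 1) => //; near: n; exact: near_sqrt_ge.
rewrite mulrCA -mulrBr normrM.
have nL : L / a <= Num.sqrt (n%:R : R) by near: n; exact: near_sqrt_ge.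
move: ZL; rewrite normrM (ger0_norm (ltW n0)) => ZL.
have Za : `|Z n w - z| <= a.
  rewrite -(ler_pM2l n0) (le_trans ZL)// -ler_pdivrMr//.
apply: (@le_trans _ _ (Num.sqrt n%:R * (e / L * `|Z n w - z|))).
  by rewrite ler_wpM2l ?ha// ltW.
by rewrite mulrCA mulrAC ler_pdivrMr// ler_wpM2l// ltW.
Unshelve. all: end_near. Qed.

End stochastic_order.

(** * Independence *)

Section staircase.
Context (R : realType).
Implicit Type y : R.

Lemma sum_steps_ge y K : K%:R <= y ->
  \sum_(j < K) ((j.+1%:R <= y)%R)%:R = K%:R :> R.
Proof.
elim: K => [|K IH] Ky; first by rewrite big_ord0.
rewrite big_ord_recr /= Ky IH ?natr1//.
by rewrite (le_trans _ Ky)// ler_nat.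
Qed.

(** The sum counts the positive integers up to [y], so it is the integer part of [y]. *)
Lemma sum_steps_lt y K : 0 <= y -> y < K%:R ->
  y - 1 <= \sum_(j < K) ((j.+1%:R <= y)%R)%:R <= y.
Proof.
move=> y0; elim: K => [|K IH] yK; first by rewrite ltNge y0 in yK.
rewrite big_ord_recr /= (leNgt _ y) yK addr0.
have [|Ky] := ltP y K%:R; first exact: IH.
by rewrite sum_steps_ge// Ky andbT lerBlDr natr1 ltW.
Qed.

End staircase.

Section independence.
Context d (T : measurableType d) (R : realType) (P : probability T R).

Lemma mfun_comp_indic (Y : T -> R) (B : set R) : measurable_fun setT Y ->
  measurable B -> measurable_fun setT (fun w => \1_B (Y w) : R).
Proof.
move=> mY mB; have mI : measurable_fun setT (\1_B : R -> R) by exact: measurable_indic.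
exact: measurableT_comp mI mY.
Qed.

Lemma norm_indic_le1 (S : Type) (B : set S) (y : S) : `|\1_B y : R| <= 1.
Proof. by rewrite indicE; case: (_ \in _); rewrite ?normr1 ?normr0. Qed.

(* Uniform approximation of a bounded function by the staircase
   N^-1 * sum_(j < K) 1_{N f >= j+1} extends the product rule from indicators. *)
Lemma Er_mul_bounded (H Y : T -> R) (f : R -> R) (C M : R) :
  measurable_fun setT H -> (forall w, `|H w| <= C) -> measurable_fun setT Y ->
  measurable_fun setT f -> (forall x, `|f x| <= M) ->
  (forall B, measurable B -> Er P (fun w => H w * \1_B (Y w)) =
     Er P H * Er P (fun w => \1_B (Y w))) ->
  Er P (fun w => H w * f (Y w)) = Er P H * Er P (fun w => f (Y w)).
Proof.
move=> mH HC mY.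
have LH : L1 P H by exact: L1_bounded mH HC.
(* Adding the constant [M] to [f] changes both sides of the product rule by the same amount
   [M * Er P H]. *)
wlog f0 : f M / forall x, 0 <= f x.
  move=> wl mf fM prod.
  have f0 x : 0 <= f x + M.
    by rewrite -[f x]opprK addrC subr_ge0 (le_trans (ler_norm _))// normrN.
  have := wl (fun x => f x + M) (M + `|M|) f0.
  have fY : L1 P (fun w => f (Y w)).
    by apply: (@L1_bounded _ _ _ _ _ M) => //; exact: measurableT_comp.
  have HfY : L1 P (fun w => H w * f (Y w)).
    apply: (@L1_bounded _ _ _ _ _ (C * M)).
      by apply: measurable_funM => //; exact: measurableT_comp.
    by move=> w; rewrite normrM ler_pM.
  have eL : Er P (fun w => H w * (f (Y w) + M)) =
            Er P (fun w => H w * f (Y w)) + M * Er P H.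
    by rewrite -ErZ// -ErD//; [apply: eq_Er => w; ring|exact: L1Z].
  have eR : Er P (fun w => f (Y w) + M) = Er P (fun w => f (Y w)) + M.
    by rewrite -[in RHS](Er_cst P M) -ErD//; exact: L1_cst.
  rewrite /= eL eR => e.
  apply: (addIr (M * Er P H)); rewrite e//; first by rewrite mulrDr [M * _]mulrC.
    by apply: measurable_funD => //; exact: measurable_cst.
  by move=> x; rewrite (le_trans (ler_normD _ _))// lerD.
move=> mf fM prod.
have C0 : 0 <= C by rewrite (le_trans _ (HC point)).
have M0 : 0 <= M by rewrite (le_trans _ (fM 0)).
apply/eqP; rewrite -subr_eq0 -normr_eq0; apply/eqP/le_anti; rewrite normr_ge0 andbT.
apply/ler_addgt0Pr => e e0; rewrite add0r.
(* Replacing [f] by the staircase costs at most $C/(N+1)$ on each side of the identity. [K] is then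
   taken above all values of $(N+1) f$, so that no value is cut off. *)
have [N Ne] : exists N : nat, 2 * C / e < N.+1%:R.
  by exists (Num.truncn (2 * C / e)); exact: truncnS_gt.
have [K KM] : exists K : nat, N.+1%:R * M < K%:R.
  by exists (Num.truncn (N.+1%:R * M)).+1; exact: truncnS_gt.
pose B (j : 'I_K) := [set x | j.+1%:R <= N.+1%:R * f x].
have mB j : measurable (B j).
  have /(_ measurableT [set true]) :
      measurable_fun setT (fun x => j.+1%:R <= N.+1%:R * f x).
    by apply: measurable_fun_ler => //; exact: measurable_funM.
  by rewrite setTI; exact.
pose g x : R := N.+1%:R^-1 * \sum_(j < K) \1_(B j) x.
have N0 : 0 < N.+1%:R :> R by [].
have fg x : `|f x - g x| <= N.+1%:R^-1.
  have : 0 <= N.+1%:R * f x - \sum_(j < K) \1_(B j) x <= 1.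
    under eq_bigr => j _ do rewrite indicE /B mem_setE.
    rewrite subr_ge0 lerBlDr addrC -lerBlDr andbC sum_steps_lt ?mulr_ge0//.
    rewrite (le_lt_trans _ KM)// ler_pM2l//.
    by rewrite (le_trans (ler_norm _)).
  move=> h; rewrite -[f x](mulKf (lt0r_neq0 N0)) /g -mulrBr normrM.
  rewrite ger0_norm ?invr_ge0// ler_piMr ?invr_ge0//.
  by case/andP: h => h0 h1; rewrite ger0_norm.

have mIY j : measurable_fun setT (fun w => \1_(B j) (Y w) : R).
  exact: mfun_comp_indic.
have LIY j : L1 P (fun w => \1_(B j) (Y w)).
  by apply: (@L1_bounded _ _ _ _ _ 1) => // w; exact: norm_indic_le1.
have LHI j : L1 P (fun w => H w * \1_(B j) (Y w)).
  apply: (@L1_bounded _ _ _ _ _ (C * 1)); first exact: measurable_funM.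
  by move=> w; rewrite normrM ler_pM// norm_indic_le1.
have Lg : L1 P (fun w => g (Y w)) by apply: L1Z; exact: L1_sum.
have Lf : L1 P (fun w => f (Y w)).
  by apply: (@L1_bounded _ _ _ _ _ M) => //; exact: measurableT_comp.
have LHg : L1 P (fun w => H w * g (Y w)).
  rewrite /g; under eq_fun do rewrite mulrCA mulr_sumr.
  by apply: L1Z; exact: L1_sum.
have LHf : L1 P (fun w => H w * f (Y w)).
  apply: (@L1_bounded _ _ _ _ _ (C * M)).
    by apply: measurable_funM => //; exact: measurableT_comp.
  by move=> w; rewrite normrM ler_pM.
have gE : Er P (fun w => H w * g (Y w)) = Er P H * Er P (fun w => g (Y w)).
  rewrite /g; under eq_Er do rewrite mulrCA mulr_sumr.
  rewrite !ErZ; [|exact: L1_sum|exact: L1_sum].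
  rewrite !Er_sum// [RHS]mulrCA; congr (_ * _); rewrite mulr_sumr.
  by apply: eq_bigr => j _; exact: prod.
have -> : Er P (fun w => H w * f (Y w)) - Er P H * Er P (fun w => f (Y w)) =
    Er P (fun w => H w * f (Y w) - H w * g (Y w)) -
    Er P H * Er P (fun w => f (Y w) - g (Y w)).
  by rewrite !ErB// gE; ring.
apply: (@le_trans _ _ (C * N.+1%:R^-1 + C * N.+1%:R^-1)); last first.
  have -> : C * N.+1%:R^-1 + C * N.+1%:R^-1 = (2 * C) / N.+1%:R by ring.
  by rewrite ler_pdivrMr// [leRHS]mulrC -ler_pdivrMr// ltW.
rewrite (le_trans (ler_normB _ _))// lerD//.
  apply: norm_Er_le; first exact: L1B.
  by move=> w; rewrite -mulrBr normrM ler_pM.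
rewrite normrM ler_pM//; first exact: norm_Er_le.
by apply: norm_Er_le => //; exact: L1B.
Qed.

(** Independence of a bounded [H] from the family indexed by [J], stated without sigma-algebras. The
    condition is linear in [H] and survives multiplication by a function of one [X k], the two
    operations of the cosine recursion. *)
Definition indep_from (X : nat -> T -> R) (J : pred nat) (H : T -> R) : Prop :=
  [/\ measurable_fun setT H, exists C : R, forall w, `|H w| <= C &
  forall (I : seq nat) (B : nat -> set R), uniq I -> all J I ->
    (forall i, measurable (B i)) ->
    Er P (fun w => H w * \prod_(i <- I) \1_(B i) (X i w)) =
    Er P H * \prod_(i <- I) Er P (fun w => \1_(B i) (X i w))].

Context (X : nat -> T -> R).
Hypothesis mX : forall i, measurable_fun setT (X i).
Hypothesis indX : mutually_independent P X.

Lemma prod_indic (I : seq nat) (B : nat -> set R) w :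
  \prod_(i <- I) \1_(B i) (X i w) =
  \1_(\bigcap_(i in [set` I]) (X i @^-1` B i)) w :> R.
Proof.
elim: I => [|i I IH].
  rewrite big_nil indicE mem_set// => i /=.
rewrite big_cons IH !indicE -natrM mulnb; congr (_%:R); congr nat_of_bool.
apply/andP/idP => [[/set_mem Bi /set_mem BI]|/set_mem h].
  by apply/mem_set => j /=; rewrite inE => /predU1P[->//|]; exact: BI.
split; apply/mem_set; first by apply: h; rewrite /= mem_head.
by move=> j /= jI; apply: h; rewrite /= inE jI orbT.
Qed.

Lemma measurable_bigcap_preimage (I : seq nat) (B : nat -> set R) :
  (forall i, measurable (B i)) ->
  measurable (\bigcap_(i in [set` I]) (X i @^-1` B i)).
Proof.
move=> mB; apply: bigcap_measurableType => i _.
by rewrite -[_ @^-1` _]setTI; exact: mX.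
Qed.

(** Mutual independence itself, rewritten with indicators; it starts the induction on the number of
    summands. *)
Lemma indep_from_cst (c : R) : indep_from X predT (fun=> c).
Proof.
split; [exact: measurable_cst|by exists (normr c)|].
move=> I B uI _ mB.
have mcap := measurable_bigcap_preimage I mB.
rewrite Er_cst (@eq_Er _ _ _ _ _ (fun w => c * \1_(\bigcap_(i in [set` I]) (X i @^-1` B i)) w)); last first.
  by move=> w; rewrite prod_indic.
rewrite ErZ; last exact: L1_indic.
rewrite -Pr_indic// /Pr indX//; congr (_ * _); apply: eq_bigr => i _.
have mi : measurable (X i @^-1` B i).
  by rewrite -[_ @^-1` _]setTI; exact: mX.
by rewrite -[LHS]/(Pr P _) Pr_indic.
Qed.

(** [X k] is absorbed into [H] at the price of removing [k] from the indices still independent of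
    it; the expectation factorises on the way. *)
Lemma indep_fromM (J : pred nat) (H : T -> R) (f : R -> R) (M : R) (k : nat) :
  indep_from X J H -> J k -> measurable_fun setT f -> (forall x, `|f x| <= M) ->
  indep_from X (predD1 J k) (fun w => H w * f (X k w)) /\
  Er P (fun w => H w * f (X k w)) = Er P H * Er P (fun w => f (X k w)).
Proof.
move=> [mH [C HC] HJ] Jk mf fM.
have C0 : 0 <= C by rewrite (le_trans _ (HC point)).
have mfX : measurable_fun setT (fun w => f (X k w)) by exact: measurableT_comp.
(* The product rule with a product of further indicators carried along. With [I] empty it is the
   second claim, with general [I] it yields the first. *)
have step I B : uniq I -> all (predD1 J k) I -> (forall i, measurable (B i)) ->
    Er P (fun w => H w * \prod_(i <- I) \1_(B i) (X i w) * f (X k w)) =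
    Er P (fun w => H w * \prod_(i <- I) \1_(B i) (X i w)) *
    Er P (fun w => f (X k w)).
  move=> uI aI mB.
  have JI : all J I by apply: sub_all aI => i /= /andP[].
  have kI : k \notin I.
    by apply/negP => kI; move/allP: aI => /(_ _ kI) /=; rewrite eqxx.
  apply: (@Er_mul_bounded _ _ _ C M) => //.
  - apply: measurable_funM => //; under eq_fun do rewrite prod_indic.
    exact/measurable_indic/measurable_bigcap_preimage.
  - move=> w; rewrite normrM -[C]mulr1 ler_pM// prod_indic.
    exact: norm_indic_le1.
  (* As [k] is not in [I], the event [D] for [X k] can be appended as one more coordinate of the
     family of sets. *)
  - move=> D mD; pose B' i := if i == k then D else B i.
    have mB' i : measurable (B' i) by rewrite /B'; case: ifP.
    have eqB w : \prod_(i <- I) \1_(B i) (X i w) =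
                 \prod_(i <- I) \1_(B' i) (X i w) :> R.
      apply: eq_big_seq => i iI; rewrite /B' ifN//.
      by apply: contraNneq kI => <-.
    have eqB2 : \prod_(i <- I) Er P (fun w => \1_(B i) (X i w)) =
                 \prod_(i <- I) Er P (fun w => \1_(B' i) (X i w)).
      apply: eq_big_seq => i iI; rewrite /B' ifN//.
      by apply: contraNneq kI => <-.
    have ukI : uniq (k :: I) by rewrite /= kI.
    have JkI : all J (k :: I) by rewrite /= Jk.
    have e1 := HJ _ _ ukI JkI mB'.
    rewrite HJ// eqB2 -mulrA [X in _ * X]mulrC.
    have BkE : B' k = D by rewrite /B' eqxx.
    rewrite big_cons BkE in e1; rewrite -e1; apply: eq_Er => w.
    by rewrite eqB big_cons BkE; ring.
split; last first.
  have := step [::] (fun=> setT) erefl erefl (fun=> measurableT).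
  by under eq_Er do rewrite big_nil mulr1; under [in RHS]eq_Er do rewrite big_nil mulr1.
split; first exact: measurable_funM.
  by exists (C * M) => w; rewrite normrM ler_pM.
move=> I B uI aI mB.
have JI : all J I by apply: sub_all aI => i /= /andP[].
rewrite (@eq_Er _ _ _ _ _ (fun w => H w * \prod_(i <- I) \1_(B i) (X i w) * f (X k w))); last first.
  by move=> w; rewrite mulrAC.
rewrite step// HJ// mulrAC; congr (_ * _).
have := step [::] B erefl erefl mB.
by under eq_Er do rewrite big_nil mulr1; under [in RHS]eq_Er do rewrite big_nil mulr1.
Qed.

(** Required because the addition formula for the cosine produces a difference of two products. *)
Lemma indep_fromB (J : pred nat) (H K : T -> R) :
  indep_from X J H -> indep_from X J K -> indep_from X J (fun w => H w - K w).
Proof.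
move=> [mH [C HC] HJ] [mK [D KD] KJ]; split; first exact: measurable_funB.
  by exists (C + D) => w; rewrite (le_trans (ler_normB _ _))// lerD.
move=> I B uI aI mB.
have LM (h : T -> R) (c : R) : measurable_fun setT h -> (forall w, `|h w| <= c) ->
    L1 P (fun w => h w * \prod_(i <- I) \1_(B i) (X i w)).
  move=> mh hc; apply: (@L1_bounded _ _ _ _ _ c).
    apply: measurable_funM => //; under eq_fun do rewrite prod_indic.
    exact/measurable_indic/measurable_bigcap_preimage.
  by move=> w; rewrite normrM -[c]mulr1 ler_pM// prod_indic norm_indic_le1.
have e1 := ErB (LM _ _ mH HC) (LM _ _ mK KD).
have e2 := ErB (L1_bounded P mH HC) (L1_bounded P mK KD).
rewrite e2 mulrBl -HJ// -KJ// -e1; apply: eq_Er => w.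
by rewrite mulrBl.
Qed.

Lemma sub_indep_from (J J' : pred nat) (H : T -> R) :
  subpred J' J -> indep_from X J H -> indep_from X J' H.
Proof.
move=> JJ [mH HC HJ]; split=> // I B uI aI mB; apply: HJ => //.
exact: sub_all aI.
Qed.

End independence.

(** * The central limit theorem for trigonometric test functions *)

Section trigonometric_expansions.
Context (R : realType).
Implicit Type x : R.

Lemma norm_sin_le x : `|sin x| <= `|x|.
Proof.
wlog x0 : x / 0 < x.
  move=> wl; have [x0|x0|->] := ltgtP x 0; last by rewrite sin0.
    by rewrite -normrN -sinN -(normrN x) wl// oppr_gt0.
  exact: wl.
have [|c _] := @MVT R sin cos 0 x x0 (fun y _ => is_derive_sin y).
  by apply: continuous_subspaceT; exact: continuous_sin.
by rewrite sin0 !subr0 => ->; rewrite normrM ler_piMl// cos_max.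
Qed.

(** By the mean value theorem $\sin x - x = (\cos c - 1) x$, and $1 - \cos c = 2 \sin^2(c/2) \le
    c^2/2$. Only the order 3 matters, not the constant. *)
Lemma norm_sin_sub_le x : `|sin x - x| <= `|x| ^+ 3.
Proof.
wlog x0 : x / 0 < x.
  move=> wl; have [x0|x0|->] := ltgtP x 0; last by rewrite sin0 subr0 normr0 exprn_ge0.
    have := wl (- x); rewrite sinN -opprD !normrN; apply.
    by rewrite oppr_gt0.
  exact: wl.
have [|c] := @MVT R sin cos 0 x x0 (fun y _ => is_derive_sin y).
  by apply: continuous_subspaceT; exact: continuous_sin.
rewrite in_itv /= sin0 !subr0 => /andP[c0 cx] ->.
rewrite -[X in _ - X]mul1r -mulrBl normrM exprSr ler_wpM2r//.
have -> : cos c = cos ((c / 2) *+ 2) by rewrite -mulr_natr divfK.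
rewrite cos_mulr2n cos2sin2.
have -> : (1 - sin (c / 2) ^+ 2) *+ 2 - 1 - 1 = - (sin (c / 2) ^+ 2 *+ 2) by ring.
rewrite normrN ger0_norm ?mulrn_wge0 ?sqr_ge0// (gtr0_norm x0).
rewrite -[sin _ ^+ 2]real_normK ?num_real//.
have s1 := norm_sin_le (c / 2).
apply: (@le_trans _ _ ((c / 2) ^+ 2 *+ 2)); last by nra.
rewrite lerMn2r /= -[leRHS]real_normK ?num_real//.
by rewrite lerXn2r ?nnegrE.
Qed.

(** A bound of order 2 valid on the whole line: it turns into an integrable envelope when only
    second moments are available. *)
Lemma norm_sin_sub_le2 x : `|sin x - x| <= 2 * x ^+ 2.
Proof.
have [x1|x1] := lerP `|x| 1.
  rewrite (le_trans (norm_sin_sub_le x))// -[x ^+ 2]real_normK ?num_real//.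
  by rewrite exprSr mulrC ler_wpM2r ?sqr_ge0// (le_trans x1)// ler1n.
rewrite (le_trans (ler_normB _ _))// -[x ^+ 2]real_normK ?num_real//.
have := norm_sin_le x; nra.
Qed.

(** The half-angle formula, which reduces both cosine remainders to estimates for the sine. *)
Lemma cos_half x : cos x - 1 + x ^+ 2 / 2 = 2 * ((x / 2) ^+ 2 - sin (x / 2) ^+ 2).
Proof.
have {1}-> : x = (x / 2) *+ 2 by rewrite -mulr_natr divfK.
by rewrite cos_mulr2n cos2sin2; field.
Qed.

Lemma norm_cos_sub_le2 x : `|cos x - 1 + x ^+ 2 / 2| <= 2 * x ^+ 2.
Proof.
rewrite cos_half normrM ger0_norm// ler_wpM2l// ler_norml.
have := sqr_ge0 (sin (x / 2)); have := sqr_ge0 x; have := norm_sin_le (x / 2).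
move=> /(lerXn2r 2); rewrite !nnegrE !real_normK ?num_real// => /(_ (normr_ge0 _) (normr_ge0 _)) h1 h2 h3.
by apply/andP; split; nra.
Qed.

Lemma norm_cos_sub_le x : `|cos x - 1 + x ^+ 2 / 2| <= x ^+ 4.
Proof.
rewrite cos_half subr_sqr !normrM ger0_norm// mulrCA mulrA.
have h1 := norm_sin_sub_le (x / 2); rewrite distrC in h1.
have h2 : `|x / 2 + sin (x / 2)| <= 2 * `|x / 2|.
  rewrite (le_trans (ler_normD _ _))// mulr_natl mulr2n lerD2l.
  exact: norm_sin_le.
have -> : x ^+ 4 = 16 * `|x / 2| ^+ 4.
  by rewrite -(normrX 4) (ger0_norm (exprn_even_ge0 _ _))//; field.
have h3 := ler_pM (normr_ge0 _) (normr_ge0 _) h1 h2.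
have h4 : 0 <= `|x / 2| ^+ 4 by rewrite exprn_ge0.
nra.
Qed.

Lemma expRN_approx x : 0 <= x -> x <= 1 -> `|expR (- x) - 1 + x| <= x ^+ 2.
Proof.
move=> x0 x1; have := expR_ge1Dx (- x); have := expR_ge1Dx x.
have := expRxMexpNx_1 x; have := expR_gt0 (- x).
set u := expR x; set v := expR (- x) => v0 uv u1 v1.
have v2 : (1 + x) * v <= 1.
  by have := ler_wpM2r (ltW v0) u1; rewrite uv.
(* From $e^{-x} \le 1/(1+x)$ and $(1+x)(1 - x + x^2) = 1 + x^3 \ge 1$. *)
have v3 : v <= 1 - x + x ^+ 2.
  rewrite -(@ler_pM2l _ (1 + x)); last by rewrite ltr_wpDr.
  rewrite (le_trans v2)//.
  have -> : (1 + x) * (1 - x + x ^+ 2) = 1 + x ^+ 3 by ring.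
  by rewrite lerDl exprn_ge0.
rewrite ler_norml; apply/andP; split; last by lra.
have := sqr_ge0 x; lra.
Qed.

End trigonometric_expansions.

(** * Moments of sums of independent identically distributed variables *)

Section iid.
Context d (T : measurableType d) (R : realType) (P : probability T R)
  (X : nat -> {RV P >-> R}) (X0 : {RV P >-> R}).
Hypothesis iidX : iid_with_parent X X0.
Implicit Types (a b f : R -> R).

Lemma mfun_RV (Y : {RV P >-> R}) f : measurable_fun setT f ->
  measurable_fun setT (fun w => f (Y w)).
Proof. by move=> mf; exact: measurableT_comp. Qed.

Lemma integral_iid i (g : R -> \bar R) :
  (\int[distribution P (X i)]_x g x = \int[distribution P X0]_x g x)%E.
Proof.
apply: eq_measure_integral => A mA _.
by rewrite /distribution /pushforward; exact: iidX.2.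
Qed.

Lemma L1_iid i f : measurable_fun setT f -> L1 P (fun w => f (X0 w)) ->
  L1 P (fun w => f (X i w)).
Proof.
move=> mf /integrableP[_ ifoo]; apply/integrableP; split.
  by apply/measurable_EFinP; exact: mfun_RV.
have mg : measurable_fun setT (fun x => `|(f x)%:E|%E).
  by apply: measurableT_comp => //; exact/measurable_EFinP.
have e1 := ge0_integral_distribution (X i) mg (fun=> abse_ge0 _).
have e2 := ge0_integral_distribution X0 mg (fun=> abse_ge0 _).
by rewrite [X in (X < _)%E](_ : _ = (\int[P]_x ((fun x => `|(f x)%:E|) \o X i) x)%E)// -e1 integral_iid e2.
Qed.

Lemma Er_iid i f : measurable_fun setT f -> L1 P (fun w => f (X0 w)) ->
  Er P (fun w => f (X i w)) = Er P (fun w => f (X0 w)).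
Proof.
move=> mf f1; have fi := L1_iid i mf f1.
have mg : measurable_fun setT (EFin \o f) by exact/measurable_EFinP.
have e1 := integral_distribution mg fi.
have e2 := integral_distribution mg f1.
rewrite !ErE /Rintegral; congr fine.
by move: e1; rewrite integral_iid e2 => ->.
Qed.

Lemma L2_iid i f : measurable_fun setT f -> L2 P (fun w => f (X0 w)) ->
  L2 P (fun w => f (X i w)).
Proof.
move=> mf [_ f2]; split; first exact: mfun_RV.
by apply: (@L1_iid i (fun x => f x ^+ 2)) => //; exact: measurable_funX.
Qed.

Lemma mX i : measurable_fun setT (X i).
Proof. by []. Qed.

(** Two absorptions starting from the constant 1: first [a (X i w)], then [b (X j w)]. *)
Lemma Er_iid_pair_bounded a b (M : R) (i j : nat) : measurable_fun setT a ->
  measurable_fun setT b -> (forall x, `|a x| <= M) -> (forall x, `|b x| <= M) ->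
  i != j ->
  Er P (fun w => a (X i w) * b (X j w)) =
  Er P (fun w => a (X i w)) * Er P (fun w => b (X j w)).
Proof.
move=> ma mb aM bM ij; have indX := iidX.1.
have [h1 _] := @indep_fromM _ _ _ _ _ mX predT (fun=> 1) a M i (indep_from_cst mX indX 1) isT ma aM.
have ji : predD1 predT i j by rewrite /= eq_sym ij.
have [_] := indep_fromM mX h1 ji mb bM.
by under eq_Er do rewrite mul1r; under [in RHS]eq_Er do rewrite mul1r.
Qed.

Lemma truncate_cvg (x y : R) :
  x * (`|y| <= n%:R)%R%:R @[n --> \oo] --> x.
Proof.
apply: cvg_near_cst; near=> n.
have -> : `|y| <= n%:R by near: n; exact: nbhs_infty_ger.
by rewrite mulr1.
Unshelve. all: end_near. Qed.

(** The bounded case is applied to truncations. Passing to the limit in the product is dominated by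
    $|a(X_i) a(X_j)|$, integrable by square integrability. *)
Lemma Er_iid_pair a (i j : nat) : measurable_fun setT a -> L2 P (fun w => a (X0 w)) ->
  i != j ->
  Er P (fun w => a (X i w) * a (X j w)) = Er P (fun w => a (X0 w)) ^+ 2.
Proof.
move=> ma a2 ij.
(* Values above level [n] are set to 0, so [b n] is bounded by [n], dominated by [a], and eventually
   equal to it at each point. *)
pose b n x := a x * (`|a x| <= n%:R)%R%:R.
have mb n : measurable_fun setT (b n).
  apply: measurable_funM => //.
  rewrite (_ : (fun x => _) = \1_[set x | `|a x| <= n%:R]).
    apply: measurable_indic; apply: measurable_le_fun.
    exact: measurableT_comp.
  by apply/funext => x; rewrite indicE mem_setE.
have bn n x : `|b n x| <= n%:R.
  by rewrite /b normrM; have [h|_] := boolP (`|a x| <= n%:R);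
    rewrite ?normr1 ?normr0 ?mulr1 ?mulr0.
have ba n x : `|b n x| <= `|a x|.
  by rewrite /b normrM; have [h|_] := boolP (`|a x| <= n%:R);
    rewrite ?normr1 ?normr0 ?mulr1 ?mulr0.
have bcv x : b n x @[n --> \oo] --> a x by exact: truncate_cvg.
have ai := L2_iid i ma a2; have aj := L2_iid j ma a2.
have cv1 : Er P (fun w => b n (X i w) * b n (X j w)) @[n --> \oo] -->
    Er P (fun w => a (X i w) * a (X j w)).
  apply: (@cvg_Er _ _ _ _ _ _ (fun w => `|a (X i w) * a (X j w)|)).
  - by move=> n; apply: measurable_funM; exact: mfun_RV.
  - by apply: L1_norm; exact: L2M.
  - by move=> n w; rewrite [leLHS]normrM [leRHS]normrM; apply: ler_pM; rewrite ?ba.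
  - by move=> w; apply: cvgM; exact: bcv.
have cv2 k : Er P (fun w => b n (X k w)) @[n --> \oo] --> Er P (fun w => a (X k w)).
  apply: (@cvg_Er _ _ _ _ _ _ (fun w => `|a (X k w)|)) => //.
  - by move=> n; exact: mfun_RV.
  - by apply: L1_norm; exact/L2_L1/L2_iid.
have cv3 : Er P (fun w => b n (X i w) * b n (X j w)) @[n --> \oo] -->
    Er P (fun w => a (X i w)) * Er P (fun w => a (X j w)).
  under eq_fun do rewrite (@Er_iid_pair_bounded _ _ _ _ _ (mb _) (mb _) (bn _) (bn _) ij).
  exact: cvgM.
rewrite (cvg_unique _ cv1 cv3)//.
have a1 := L2_L1 a2.
by rewrite !Er_iid// expr2.
Qed.

Lemma Er_iid_sum_sqr a n : measurable_fun setT a -> L2 P (fun w => a (X0 w)) ->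
  Er P (fun w => a (X0 w)) = 0 ->
  Er P (fun w => (\sum_(i < n) a (X i w)) ^+ 2) =
  n%:R * Er P (fun w => a (X0 w) ^+ 2).
Proof.
move=> ma a2 a0; have aL i := L2_iid i ma a2.
elim: n => [|n IH].
  by rewrite mul0r -[RHS](Er_cst P 0); apply: eq_Er => w; rewrite big_ord0 expr0n.
have S2 : L2 P (fun w => \sum_(i < n) a (X i w)) by exact: L2_sum.
rewrite (@eq_Er _ _ _ _ _ (fun w => (\sum_(i < n) a (X i w)) ^+ 2 +
  (2 * (\sum_(i < n) a (X i w) * a (X n w)) + a (X n w) ^+ 2))); last first.
  by move=> w; rewrite big_ord_recr /= -mulr_suml; ring.
have L12 (i : 'I_n) : L1 P (fun w => a (X i w) * a (X n w)) by exact: L2M.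
rewrite ErD ?IH; [|exact: S2.2|]; last first.
  by apply: L1D; [exact/L1Z/L1_sum|exact: (aL n).2].
rewrite ErD; [|exact/L1Z/L1_sum|exact: (aL n).2].
rewrite ErZ; last exact: L1_sum.
rewrite Er_sum// big1 ?mulr0 ?add0r; last first.
  by move=> i _; rewrite Er_iid_pair// ?a0 ?expr0n// neq_ltn ltn_ord.
rewrite (@Er_iid n (fun x => a x ^+ 2)); first by rewrite -natr1 mulrDl mul1r.
  exact: measurable_funX.
exact: a2.2.
Qed.

Lemma OP_iid_sum a : measurable_fun setT a -> L2 P (fun w => a (X0 w)) ->
  Er P (fun w => a (X0 w)) = 0 ->
  OP P (fun n w => (Num.sqrt n%:R)^-1 * \sum_(i < n) a (X i w)).
Proof.
move=> ma a2 a0; have aL i := L2_iid i ma a2.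
have S2 n : L2 P (fun w => \sum_(i < n) a (X i w)) by exact: L2_sum.
apply: (@OP_Er_sqr _ _ _ _ _ (Er P (fun w => a (X0 w) ^+ 2))) => n.
  exact: L2Z.
under eq_Er do rewrite exprMn.
rewrite ErZ ?Er_iid_sum_sqr//; last exact: (S2 n).2.
rewrite exprVn sqr_sqrtr// mulrA ler_piMl//.
  by apply: Er_ge0 => w; exact: sqr_ge0.
(* At [n = 0] the inverse of 0 is 0, so the factor is 0 instead of 1. *)
by have [->|n0] := eqVneq (n%:R : R) 0; rewrite ?mulr0// mulVf.
Qed.

Lemma oP_iid_mean a : measurable_fun setT a -> L2 P (fun w => a (X0 w)) ->
  Er P (fun w => a (X0 w)) = 0 ->
  oP P (fun n w => n%:R^-1 * \sum_(i < n) a (X i w)).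
Proof.
move=> ma a2 a0; have O := OP_iid_sum ma a2 a0.
have o1 : oP P (fun n (_ : T) => (Num.sqrt n%:R : R)^-1).
  apply: oP_cvg; apply/cvgr0Pnorm_le => e e0; near=> n.
  rewrite ger0_norm ?invr_ge0// -[e]invrK lef_pV2 ?posrE ?invr_gt0//.
    by near: n; exact: near_sqrt_ge.
  by rewrite (@lt_le_trans _ _ 1)//; near: n; exact: near_sqrt_ge.
apply: (oP_ext _ (oPM o1 O)) => n w; rewrite mulrA -invfM -expr2 sqr_sqrtr//.
Unshelve. all: end_near. Qed.

End iid.

(** * Characteristic functions of normalized sums *)

Section characteristic_clt.
Context d (T : measurableType d) (R : realType) (P : probability T R)
  (X : nat -> {RV P >-> R}) (X0 : {RV P >-> R}).
Hypothesis iidX : iid_with_parent X X0.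
Context (a : R -> R).
Hypothesis ma : measurable_fun setT a.

Lemma measurable_cos_fun : measurable_fun setT (@cos R).
Proof. by apply: continuous_measurable_fun; exact: continuous_cos. Qed.

Lemma measurable_sin_fun : measurable_fun setT (@sin R).
Proof. by apply: continuous_measurable_fun; exact: continuous_sin. Qed.

Let C (s : R) k (th : R) : R :=
  Er P (fun w => cos (th + s * \sum_(i < k) a (X i w))).
Let u (s : R) : R := Er P (fun w => cos (s * a (X0 w))).
Let v (s : R) : R := Er P (fun w => sin (s * a (X0 w))).

(** Addition formula for the last summand, with the sine of the partial sum written as a cosine of
    phase [th - pi / 2]. Independence from the later variables is proved for all phases at once,
    since the shifted phase enters the induction. *)
Lemma cos_partial_sum_recr (s : R) k :
  (forall th, indep_from P (fun i => X i) (leq k)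
    (fun w => cos (th + s * \sum_(i < k) a (X i w)))) /\
  (forall th, C s k.+1 th = C s k th * u s - C s k (th - pi / 2) * v s).
Proof.
pose c x := cos (s * a x); pose z x := sin (s * a x).
have mc : measurable_fun setT c.
  by apply: measurableT_comp; [exact: measurable_cos_fun|exact: measurable_funM].
have mz : measurable_fun setT z.
  by apply: measurableT_comp; [exact: measurable_sin_fun|exact: measurable_funM].
have c1 x : `|c x| <= 1 by exact: cos_max.
have z1 x : `|z x| <= 1 by exact: sin_max.
have cosE k' th w : cos (th + s * \sum_(i < k'.+1) a (X i w)) =
    cos (th + s * \sum_(i < k') a (X i w)) * c (X k' w) -
    cos (th - pi / 2 + s * \sum_(i < k') a (X i w)) * z (X k' w).
  by rewrite big_ord_recr /= mulrDr addrA cosD [_ - _ + _]addrAC cosBpihalf.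
have L1b (f : R -> R) i : measurable_fun setT f -> (forall x, `|f x| <= 1) ->
    L1 P (fun w => f (X i w)).
  move=> mf f1; apply: (@L1_bounded _ _ _ _ _ 1) => //; exact: mfun_RV.
have L1b0 (f : R -> R) : measurable_fun setT f -> (forall x, `|f x| <= 1) ->
    L1 P (fun w => f (X0 w)).
  move=> mf f1; apply: (@L1_bounded _ _ _ _ _ 1) => //; exact: mfun_RV.
have ind k' : forall th, indep_from P (fun i => X i) (leq k')
    (fun w => cos (th + s * \sum_(i < k') a (X i w))).
  elim: k' => [|k' IH] th.
    have -> : (fun w => cos (th + s * \sum_(i < 0) a (X i w))) = (fun=> cos th).
      by apply/funext => w; rewrite big_ord0 mulr0 addr0.
    apply: sub_indep_from (indep_from_cst (@mX _ _ _ _ X) iidX.1 _) => //.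
  have -> : (fun w => cos (th + s * \sum_(i < k'.+1) a (X i w))) = (fun w =>
    cos (th + s * \sum_(i < k') a (X i w)) * c (X k' w) -
    cos (th - pi / 2 + s * \sum_(i < k') a (X i w)) * z (X k' w)).
    by apply/funext => w; rewrite cosE.
  apply: (indep_fromB (@mX _ _ _ _ X)).
    have [+ _] := indep_fromM (@mX _ _ _ _ X) (IH th) (leqnn k') mc c1.
    by apply: sub_indep_from => i /= ki; rewrite (ltnW ki) andbT gtn_eqF.
  have [+ _] := indep_fromM (@mX _ _ _ _ X) (IH (th - pi / 2)) (leqnn k') mz z1.
  by apply: sub_indep_from => i /= ki; rewrite (ltnW ki) andbT gtn_eqF.
split=> [//|th].
have [_ e1] := indep_fromM (@mX _ _ _ _ X) (ind k th) (leqnn k) mc c1.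
have [_ e2] := indep_fromM (@mX _ _ _ _ X) (ind k (th - pi / 2)) (leqnn k) mz z1.
have Lprod th' (f : R -> R) : measurable_fun setT f -> (forall x, `|f x| <= 1) ->
    L1 P (fun w => cos (th' + s * \sum_(i < k) a (X i w)) * f (X k w)).
  move=> mf f1; apply: (@L1_bounded _ _ _ _ _ 1).
    apply: measurable_funM; last exact: mfun_RV.
    by have [] := ind k th'.
  by move=> w; rewrite normrM -[leRHS]mulr1 ler_pM// cos_max.
rewrite /C (@eq_Er _ _ _ _ _ _ (cosE k th)) ErB; [|exact: Lprod|exact: Lprod].
rewrite e1 e2 /C /u /v.
by rewrite (Er_iid iidX k mc (L1b0 _ mc c1)) (Er_iid iidX k mz (L1b0 _ mz z1)).
Qed.

(** [cos th * rho ^+ k] solves the same recursion with [u] replaced by [rho] and [v] by 0. Since [C]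
    and [rho] are bounded by 1, the errors of the single steps add up without amplification. *)
Lemma cos_partial_sum_bound (s rho : R) k th : `|rho| <= 1 ->
  `|C s k th - cos th * rho ^+ k| <= k%:R * (`|u s - rho| + `|v s|).
Proof.
move=> rho1; elim: k => [|k IH] in th *.
  have -> : C s 0 th = cos th.
    rewrite -[RHS](Er_cst P); apply: eq_Er => w.
    by rewrite big_ord0 mulr0 addr0.
  by rewrite mul0r expr0 mulr1 subrr normr0.
have C1 th' : `|C s k th'| <= 1.
  apply: norm_Er_le; last by move=> w; exact: cos_max.
  apply: (@L1_bounded _ _ _ _ _ 1); last by move=> w; exact: cos_max.
  by have [] := (cos_partial_sum_recr s k).1 th'.
rewrite (cos_partial_sum_recr s k).2.
have -> : C s k th * u s - C s k (th - pi / 2) * v s - cos th * rho ^+ k.+1 =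
  (C s k th * (u s - rho) - C s k (th - pi / 2) * v s) +
  rho * (C s k th - cos th * rho ^+ k) by rewrite exprS; ring.
rewrite -(natr1 k) [leRHS]mulrDl mul1r [leRHS]addrC.
rewrite (le_trans (ler_normD _ _))// lerD//; last first.
  by rewrite normrM (le_trans _ (IH th))// ler_piMl.
rewrite (le_trans (ler_normB _ _))// lerD// normrM ler_piMl//.
Qed.

Hypothesis a2 : L2 P (fun w => a (X0 w)).
Hypothesis a0 : Er P (fun w => a (X0 w)) = 0.
Let sg2 : R := Er P (fun w => a (X0 w) ^+ 2).

Lemma inv_sqrt_sqr (n : nat) : n.+1%:R * (Num.sqrt n.+1%:R)^-1 ^+ 2 = 1 :> R.
Proof. by rewrite exprVn sqr_sqrtr// divff. Qed.

Lemma cvg_inv_sqrt : (Num.sqrt (n.+1%:R : R))^-1 @[n --> \oo] --> (0 : R).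
Proof.
apply/cvgr0Pnorm_le => e e0; near=> n.
rewrite ger0_norm ?invr_ge0// -[e]invrK lef_pV2 ?posrE ?invr_gt0 ?sqrtr_gt0//.
rewrite (@le_trans _ _ (Num.sqrt n%:R))//; last by rewrite ler_wsqrtr// ler_nat.
by near: n; exact: near_sqrt_ge.
Unshelve. all: end_near. Qed.

(** The two bounds have separate roles: after scaling, the quadratic one is the envelope $2 a^2$,
    while the one of order $m > 2$ leaves a factor at most $n^{-1/2}$ and so gives the pointwise
    limit. *)
Lemma cvg_scaled_remainder (g : R -> R) (m : nat) :
  measurable_fun setT g -> (2 < m)%N ->
  (forall x, `|g x| <= 2 * x ^+ 2) -> (forall x, `|g x| <= `|x| ^+ m) ->
  n.+1%:R * Er P (fun w => g ((Num.sqrt n.+1%:R)^-1 * a (X0 w))) @[n --> \oo]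
    --> (0 : R).
Proof.
move=> mg m2 g2 gm.
pose s (n : nat) : R := (Num.sqrt n.+1%:R)^-1.
have mgn n : measurable_fun setT (fun w => g (s n * a (X0 w))).
  apply: measurableT_comp => //; apply: measurable_funM => //.
  exact: mfun_RV.
have bnd n w : `|n.+1%:R * g (s n * a (X0 w))| <= 2 * a (X0 w) ^+ 2.
  rewrite normrM ger0_norm// (le_trans (ler_wpM2l _ (g2 _)))//.
  by rewrite exprMn mulrCA mulrA mulrA -[_ * n.+1%:R * _]mulrA inv_sqrt_sqr mulr1.
have Lg n : L1 P (fun w => g (s n * a (X0 w))).
  apply: (L1_le (mgn n) (L1Z (2 * s n ^+ 2) a2.2)) => w.
  by rewrite (le_trans (g2 _))// exprMn mulrA.
have -> : (fun n => n.+1%:R * Er P (fun w => g ((Num.sqrt n.+1%:R)^-1 * a (X0 w)))) =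
    (fun n => Er P (fun w => n.+1%:R * g (s n * a (X0 w)))).
  by apply/funext => n; rewrite ErZ//; exact: Lg.
rewrite -[X in _ --> X](Er_cst P); apply: (cvg_Er _ (L1Z 2 a2.2)) => //.
  by move=> n; apply: measurable_funM.
move=> w; apply/cvgr0Pnorm_le => e e0.
have s0 : s n * `|a (X0 w)| ^+ m @[n --> \oo] --> (0 : R).
  by rewrite -(mul0r (`|a (X0 w)| ^+ m)); apply: cvgMl; exact: cvg_inv_sqrt.
move/cvgr0Pnorm_le : s0 => /(_ _ e0) s0; near=> n.
have sn0 : 0 <= s n by rewrite invr_ge0.
have sn1 : s n <= 1.
  by rewrite invf_le1 ?sqrtr_gt0// -[X in X <= _]sqrtr1 ler_wsqrtr// ler1n.
apply: (@le_trans _ _ `|s n * `|a (X0 w)| ^+ m|); last by near: n.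
rewrite normrM (ger0_norm (ler0n _ _)) (le_trans (ler_wpM2l _ (gm _)))//.
rewrite normrM exprMn (ger0_norm sn0) [leRHS]ger0_norm ?mulr_ge0 ?exprn_ge0//.
rewrite mulrA ler_wpM2r ?exprn_ge0//.
have ns : n.+1%:R * s n * s n = 1 by rewrite -mulrA -expr2 inv_sqrt_sqr.
rewrite -(subnKC m2) exprD exprSr !mulrA ns mul1r ler_piMr//.
by rewrite exprn_ile1.
Unshelve. all: end_near. Qed.

Lemma cvg_Er_cos_iid_sum (th : R) :
  Er P (fun w => cos (th + (Num.sqrt n%:R)^-1 * \sum_(i < n) a (X i w)))
    @[n --> \oo] --> cos th * expR (- (sg2 / 2)).
Proof.
rewrite -cvg_shiftS.
pose s (n : nat) : R := (Num.sqrt n.+1%:R)^-1.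
(* The $(n+1)$-st root of the Gaussian factor, so that [rho n ^+ n.+1] is exactly the limit. *)
pose rho (n : nat) : R := expR (- (sg2 / 2 / n.+1%:R)).
have sg0 : 0 <= sg2 by apply: Er_ge0 => w; exact: sqr_ge0.
have rho1 n : `|rho n| <= 1.
  by rewrite ger0_norm ?expR_ge0// -expR0 ler_expR oppr_le0 !divr_ge0.
have rhoX n : rho n ^+ n.+1 = expR (- (sg2 / 2)).
  by rewrite -expRM_natl; congr expR; field.
have cvS : n.+1%:R * (Er P (fun w => sin (s n * a (X0 w)) - s n * a (X0 w))) @[n --> \oo] --> (0 : R).
  apply: (@cvg_scaled_remainder (fun x => sin x - x) 3) => //.
  - by apply: measurable_funB => //; exact: measurable_sin_fun.
  - exact: norm_sin_sub_le2.
  - exact: norm_sin_sub_le.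
have cvC : n.+1%:R * (Er P (fun w => cos (s n * a (X0 w)) - 1 +
    (s n * a (X0 w)) ^+ 2 / 2)) @[n --> \oo] --> (0 : R).
  apply: (@cvg_scaled_remainder (fun x => cos x - 1 + x ^+ 2 / 2) 4) => //.
  - apply: measurable_funD; last by apply: measurable_funM => //; exact: measurable_funX.
    by apply: measurable_funB => //; exact: measurable_cos_fun.
  - exact: norm_cos_sub_le2.
  - by move=> x; rewrite -normrX (@ger0_norm _ (x ^+ 4)) ?exprn_even_ge0// norm_cos_sub_le.
have cvR : n.+1%:R * (rho n - 1 + sg2 / 2 / n.+1%:R) @[n --> \oo] --> (0 : R).
  have h : (sg2 / 2) ^+ 2 * n.+1%:R^-1 @[n --> \oo] --> (0 : R).
    rewrite -(mulr0 ((sg2 / 2) ^+ 2)); apply: cvgMr.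
    exact: cvg_harmonic.
  apply/cvgr0Pnorm_le => e e0; move/cvgr0Pnorm_le : h => /(_ _ e0) h; near=> n.
  apply: (@le_trans _ _ `|(sg2 / 2) ^+ 2 * n.+1%:R^-1|); last by near: n.
  rewrite normrM ger0_norm// [leRHS]ger0_norm ?mulr_ge0 ?sqr_ge0 ?invr_ge0//.
  have x1 : sg2 / 2 / n.+1%:R <= 1.
    rewrite ler_pdivrMr// mul1r (@le_trans _ _ n%:R) ?ler_nat//.
    by near: n; exact: nbhs_infty_ger.
  have x0 : 0 <= sg2 / 2 / n.+1%:R by rewrite !divr_ge0.
  rewrite (le_trans (ler_wpM2l _ (expRN_approx x0 x1)))//.
  suff -> : n.+1%:R * (sg2 / 2 / n.+1%:R) ^+ 2 = (sg2 / 2) ^+ 2 * n.+1%:R^-1 by [].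
  by field.
have mcn n : measurable_fun setT (fun w => cos (s n * a (X0 w))).
  apply: measurableT_comp; first exact: measurable_cos_fun.
  by apply: measurable_funM => //; exact: mfun_RV.
have mzn n : measurable_fun setT (fun w => sin (s n * a (X0 w))).
  apply: measurableT_comp; first exact: measurable_sin_fun.
  by apply: measurable_funM => //; exact: mfun_RV.
have Lc n : L1 P (fun w => cos (s n * a (X0 w))).
  by apply: (@L1_bounded _ _ _ _ _ 1) => // w; exact: cos_max.
have Lz n : L1 P (fun w => sin (s n * a (X0 w))).
  by apply: (@L1_bounded _ _ _ _ _ 1) => // w; exact: sin_max.
have La n : L1 P (fun w => s n * a (X0 w)) by exact/L1Z/L2_L1.
have La2 n : L1 P (fun w => (s n ^+ 2 / 2) * a (X0 w) ^+ 2).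
  by apply: L1Z; exact: a2.2.
(* The linear term has mean 0, hence [v (s n)] is a pure remainder and is $o(1/n)$. *)
have vE n : Er P (fun w => sin (s n * a (X0 w)) - s n * a (X0 w)) = v (s n).
  by rewrite ErB// ErZ ?a0 ?mulr0 ?subr0//; exact: L2_L1.
have uE n : Er P (fun w => cos (s n * a (X0 w)) - 1 + (s n * a (X0 w)) ^+ 2 / 2) =
    u (s n) - 1 + sg2 / 2 / n.+1%:R.
  rewrite (@eq_Er _ _ _ _ _ (fun w => cos (s n * a (X0 w)) - 1 +
    (s n ^+ 2 / 2) * a (X0 w) ^+ 2)); last by move=> w; rewrite exprMn; ring.
  rewrite ErD//; last by apply: L1B => //; exact: L1_cst.
  rewrite ErB//; last exact: L1_cst.
  rewrite Er_cst ErZ; last exact: a2.2.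
  congr (_ + _); rewrite -/sg2 /s exprVn sqr_sqrtr//; by field.
apply/cvgrPdist_le => e e0; have e3 : 0 < e / 3 by rewrite divr_gt0.
move/cvgr0Pnorm_le : cvS => /(_ _ e3) cvS.
move/cvgr0Pnorm_le : cvC => /(_ _ e3) cvC.
move/cvgr0Pnorm_le : cvR => /(_ _ e3) cvR.
near=> n; rewrite distrC -(rhoX n).
apply: (le_trans (cos_partial_sum_bound (s n) n.+1 th (rho1 n))).
have h1 : n.+1%:R * `|v (s n)| <= e / 3.
  rewrite -vE -(@ger0_norm _ (n.+1%:R : R))// -normrM; near: n; exact: cvS.
have h2 : n.+1%:R * `|u (s n) - 1 + sg2 / 2 / n.+1%:R| <= e / 3.
  rewrite -uE -(@ger0_norm _ (n.+1%:R : R))// -normrM; near: n; exact: cvC.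
have h3 : n.+1%:R * `|rho n - 1 + sg2 / 2 / n.+1%:R| <= e / 3.
  rewrite -[X in X * _]ger0_norm// -normrM; near: n; exact: cvR.
(* [u] and [rho] have the common expansion $1 - \sigma^2/(2(n+1))$ up to $o(1/n)$. *)
have -> : u (s n) - rho n = (u (s n) - 1 + sg2 / 2 / n.+1%:R) -
  (rho n - 1 + sg2 / 2 / n.+1%:R) by ring.
rewrite mulrDr.
have h4 := ler_wpM2l (ler0n R n.+1) (ler_normB (u (s n) - 1 + sg2 / 2 / n.+1%:R)
  (rho n - 1 + sg2 / 2 / n.+1%:R)).
rewrite mulrDr in h4; lra.
Unshelve. all: end_near. Qed.

End characteristic_clt.

(** * The Gaussian characteristic function *)

(** The fundamental theorem on $[-(n+1), n+1]$ and dominated convergence, so the behaviour of [H]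
    along integers suffices. It provides integration by parts on the line. *)
Lemma Rintegral_derivative0 (R : realType) (H h g : R -> R) :
  (forall x : R, is_derive x 1 H (h x)) -> continuous h ->
  lebesgue_measure.-integrable setT (EFin \o g) -> (forall x, `|h x| <= g x) ->
  H n%:R @[n --> \oo] --> (0 : R) -> H (- n%:R) @[n --> \oo] --> (0 : R) ->
  \int[@lebesgue_measure R]_x h x = 0.
Proof.
move=> dH ch ig hg Hy HNy.
pose I (n : nat) : set R := `[- n.+1%:R, n.+1%:R]%classic.
pose k (n : nat) (x : R) : R := h x * \1_(I n) x.
have mh : measurable_fun setT h by exact: continuous_measurable_fun.
have mI n : measurable_fun setT (\1_(I n) : R -> R).
  by apply: measurable_indic; exact: measurable_itv.
have mk n : measurable_fun setT (fun x => (k n x)%:E).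
  by apply/measurable_EFinP; apply: measurable_funM.
have I1 n x : `|\1_(I n) x : R| <= 1.
  by rewrite indicE; case: (_ \in _); rewrite ?normr1 ?normr0.
have cvk x : [set: R] x -> (k n x)%:E @[n --> \oo] --> (h x)%:E.
  move=> _; apply: cvg_EFin; first exact: nearW.
  apply: cvg_near_cst; near=> n; rewrite /= /k indicE mem_set ?mulr1//.
  rewrite /I /= in_itv /= -ler_norml (@le_trans _ _ n%:R) ?ler_nat//.
  by near: n; exact: nbhs_infty_ger.
have kg n x : [set: R] x -> (`|(k n x)%:E| <= (EFin \o g) x)%E.
  move=> _; rewrite lee_fin /k normrM (le_trans _ (hg x))// ler_piMr//.
have gfin x : [set: R] x -> (EFin \o g) x \is a fin_num by [].
have cv1 : (\int[lebesgue_measure]_x (k n x)%:E)%E @[n --> \oo] -->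
    (\int[lebesgue_measure]_x (h x)%:E)%E.
  exact: (@dominated_cvg _ _ _ lebesgue_measure setT measurableT _ _ (EFin \o g)).
have FTC n : (\int[lebesgue_measure]_x (k n x)%:E = (H n.+1%:R)%:E - (H (- n.+1%:R))%:E)%E.
  rewrite -(@continuous_FTC2 _ h).
  - rewrite [RHS]integral_mkcond; apply: eq_integral => x _.
    by rewrite /k patchE indicE -/(I n); case: (x \in I n); rewrite ?mulr1 ?mulr0.
  - by rewrite gtrN.
  - exact: continuous_subspaceT.
  - have cH x : {for x, continuous H}.
      apply/differentiable_continuous/derivable1_diffP.
      exact: ex_derive.
    split.
    + by move=> x _; exact: ex_derive.
    + by apply: cvg_at_right_filter; exact: cH.
    + by apply: cvg_at_left_filter; exact: cH.
  - by move=> x _; rewrite derive1E; exact: derive_val.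
have cv2 : (\int[lebesgue_measure]_x (k n x)%:E)%E @[n --> \oo] --> (0 : \bar R)%E.
  under eq_fun do rewrite FTC -EFinB.
  apply: cvg_EFin; first exact: nearW.
  rewrite -[X in _ --> X](subr0 0).
  by apply: cvgB; [rewrite (cvg_shiftS (fun n => H n%:R))|rewrite (cvg_shiftS (fun n => H (- n%:R)))].
by rewrite /Rintegral (cvg_unique _ cv1 cv2).
Unshelve. all: end_near. Qed.

Section gaussian_characteristic.
Context (R : realType).
Notation mu := (@lebesgue_measure R).
Let phi (x : R) : R := normal_pdf 0 1 x.
Let c : R := normal_peak 1.

Lemma std_normal_pdfE x : phi x = c * expR (- (x ^+ 2 / 2)).
Proof.
rewrite /phi normal_pdfE ?oner_neq0// /normal_fun subr0 expr1n mulNr.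
by rewrite -mulr_natr mul1r.
Qed.

Lemma std_normal_pdf_ge0 x : 0 <= phi x.
Proof. exact: normal_pdf_ge0. Qed.

Lemma measurable_std_normal_pdf : measurable_fun setT phi.
Proof. exact: measurable_normal_pdf. Qed.

(** Completing the square, $e^{1/2}$ times the normal density centred at $\pm 1$ is $e^{\pm
    x}\varphi(x)$, and $|x| \le e^x + e^{-x}$. Integrability of $|x|\varphi$ thus follows from that
    of normal densities. *)
Lemma std_normal_pdf_shift x :
  `|x| * phi x <= expR (1 / 2) * (normal_pdf 1 1 x + normal_pdf (-1) 1 x).
Proof.
have c0 : 0 <= c by exact: normal_peak_ge0.
have shiftE (m : R) : m ^+ 2 = 1 ->
    expR (1 / 2) * normal_pdf m 1 x = expR (m * x) * phi x.
  move=> m1; rewrite std_normal_pdfE normal_pdfE ?oner_neq0// /normal_fun -/c.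
  rewrite mulrCA [RHS]mulrCA -!expRD; congr (c * expR _).
  have -> : (x - m) ^+ 2 = x ^+ 2 - 2 * m * x + 1 by rewrite sqrrB m1 -mulr_natl; ring.
  by field.
rewrite mulrDr !shiftE ?expr1n ?sqrrN ?expr1n// mul1r mulN1r -mulrDl.
apply: ler_wpM2r; first exact: std_normal_pdf_ge0.
have h1 := expR_ge1Dx x; have h2 := expR_ge1Dx (- x).
have h3 := expR_gt0 x; have h4 := expR_gt0 (- x).
by rewrite ler_norml; apply/andP; split; lra.
Qed.

Lemma integrable_norm_std_normal :
  mu.-integrable setT (EFin \o (fun x => `|x| * phi x)).
Proof.
pose g (x : R) : R := expR (1 / 2) * (normal_pdf 1 1 x + normal_pdf (-1) 1 x).
have ig : mu.-integrable setT (EFin \o g).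
  have := integrableZl measurableT (expR (1 / 2)) (integrableD measurableT
    (integrable_normal_pdf (1 : R) 1) (integrable_normal_pdf (- 1 : R) 1)).
  by apply: eq_integrable.
apply: (le_integrable _ _ _ ig) => //.
  apply/measurable_EFinP/measurable_funM; last exact: measurable_std_normal_pdf.
  exact: (measurableT_comp (@normr_measurable R setT) (@measurable_id _ _ setT)).
move=> x _ /=; rewrite lee_fin ger0_norm ?mulr_ge0 ?std_normal_pdf_ge0//.
by rewrite (le_trans (std_normal_pdf_shift x))// ler_norm.
Qed.

Lemma integrable_bounded_std_normal (f : R -> R) (M : R) :
  measurable_fun setT f -> (forall x, `|f x| <= M) ->
  mu.-integrable setT (EFin \o (fun x => f x * phi x)).
Proof.
move=> mf fM.
have ig := integrableZl measurableT M (integrable_normal_pdf (0 : R) 1).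
apply: (le_integrable _ _ _ ig) => //.
  by apply/measurable_EFinP/measurable_funM => //; exact: measurable_std_normal_pdf.
move=> x _ /=; rewrite lee_fin normrM [leRHS]normrM ler_wpM2r//.
by rewrite (le_trans (fM x))// ler_norm.
Qed.

Lemma measurable_cos_affine (th s : R) :
  measurable_fun setT (fun z => cos (th + s * z)).
Proof.
apply: measurableT_comp; first exact: measurable_cos_fun.
by apply: measurable_funD => //; exact: measurable_funM.
Qed.

Lemma measurable_sin_affine (th s : R) :
  measurable_fun setT (fun z => sin (th + s * z)).
Proof.
apply: measurableT_comp; first exact: measurable_sin_fun.
by apply: measurable_funD => //; exact: measurable_funM.
Qed.

Let F th s : R := \int[mu]_z (cos (th + s * z) * phi z).
Let D th s : R := \int[mu]_z (z * sin (th + s * z) * phi z).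

Lemma integrable_id_sin th s :
  mu.-integrable setT (EFin \o (fun z => z * sin (th + s * z) * phi z)).
Proof.
apply: (le_integrable _ _ _ integrable_norm_std_normal) => //.
  apply/measurable_EFinP/measurable_funM; last exact: measurable_std_normal_pdf.
  by apply: measurable_funM => //; exact: measurable_sin_affine.
move=> z _ /=; rewrite lee_fin !normrM normr_id ler_wpM2r//.
by rewrite ler_piMr// sin_max.
Qed.

Lemma integrable_cos th s :
  mu.-integrable setT (EFin \o (fun z => cos (th + s * z) * phi z)).
Proof.
apply: (@integrable_bounded_std_normal _ 1); last by move=> x; exact: cos_max.
exact: measurable_cos_affine.
Qed.

(** Differentiation under the integral sign with envelope $|z|\varphi(z)$. Combined with
    [gauss_cos_ibp] it gives the equation $F' = -sF$. *)
Lemma is_derive_gauss_cos th (s : R) : is_derive s 1 (F th) (- D th s).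
Proof.
pose f (s z : R) : R := cos (th + s * z) * phi z.
have df (x y : R) : is_derive x 1 (f^~ y) (- (y * sin (th + x * y) * phi y)).
  apply: is_derive_eq; rewrite /GRing.scale /=; ring.
have dfE (x y : R) : partial1of2 f x y = - (y * sin (th + x * y) * phi y).
  by rewrite partial1of2E; exact: derive_val.
have si : (`]s - 1, s + 1[%classic : set R) s.
  by rewrite /= in_itv /=; apply/andP; split; lra.
have h1 x : (`]s - 1, s + 1[%classic : set R) x -> mu.-integrable setT (EFin \o f x).
  by move=> _; exact: integrable_cos.
have h2 (x y : R) : (`]s - 1, s + 1[%classic : set R) x -> [set: R] y -> derivable (f^~ y) x 1.
  by move=> _ _; exact: ex_derive.
have h3 (y : R) : 0 <= `|y| * phi y by rewrite mulr_ge0 ?std_normal_pdf_ge0.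
have h4 (x y : R) : (`]s - 1, s + 1[%classic : set R) x -> [set: R] y -> `|partial1of2 f x y| <= `|y| * phi y.
  move=> _ _; rewrite dfE normrN !normrM.
  by rewrite (ger0_norm (std_normal_pdf_ge0 y)) ler_wpM2r ?std_normal_pdf_ge0// ler_piMr// sin_max.
have dF := derivable_under_integral measurableT si h1 h2 h3 integrable_norm_std_normal h4.
have eF := differentiation_under_integral measurableT si h1 h2 h3 integrable_norm_std_normal h4.
apply: DeriveDef => //.
rewrite -derive1E [LHS]eF.
under eq_Rintegral do rewrite dfE -mulN1r.
by rewrite RintegralZl ?mulN1r//; exact: integrable_id_sin.
Qed.

(** Since $\varphi' = -z\varphi$, the difference of the two sides is the integral of the derivative
    of $\sin(th + sz)\varphi(z)$, which vanishes at infinity. *)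
Lemma gauss_cos_ibp th s : D th s = s * F th s.
Proof.
pose H z : R := sin (th + s * z) * phi z.
pose h z : R := s * (cos (th + s * z) * phi z) - z * sin (th + s * z) * phi z.
have phiE : phi = (fun x => c * expR (- (x ^+ 2 / 2))).
  by apply/funext => x; exact: std_normal_pdfE.
have dH (x : R) : is_derive x 1 H (h x).
  by rewrite /H /h phiE; apply: is_derive_eq; rewrite /GRing.scale /=; field.
have ch : continuous h.
  have cphi : continuous phi by apply: continuous_normal_pdf; rewrite oner_neq0.
  have caff : continuous (fun z : R => th + s * z).
    by move=> y; apply: cvgD; [exact: cvg_cst|apply: cvgMr; exact: cvg_id].
  have ccos y : cos (th + s * z) @[z --> y] --> cos (th + s * y).
    by apply: (continuous_comp (caff y)); exact: continuous_cos.
  have csin y : sin (th + s * z) @[z --> y] --> sin (th + s * y).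
    by apply: (continuous_comp (caff y)); exact: continuous_sin.
  move=> y; apply: cvgB.
    by apply: cvgMr; apply: cvgM; [exact: ccos|exact: cphi].
  by apply: cvgM; [apply: cvgM; [exact: cvg_id|exact: csin]|exact: cphi].
have ig : mu.-integrable setT (EFin \o (fun x => `|s| * phi x + `|x| * phi x)).
  have := integrableD measurableT
    (integrableZl measurableT `|s| (integrable_normal_pdf (0 : R) 1))
    integrable_norm_std_normal.
  by apply: eq_integrable.
have hg (y : R) : `|h y| <= `|s| * phi y + `|y| * phi y.
  rewrite (le_trans (ler_normB _ _))// !normrM (ger0_norm (std_normal_pdf_ge0 y)).
  rewrite lerD// ?ler_wpM2l//.
    by rewrite ler_piMl ?std_normal_pdf_ge0// cos_max.
  by rewrite ler_wpM2r ?std_normal_pdf_ge0// ler_piMr// sin_max.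
have phi0 : phi n%:R @[n --> \oo] --> (0 : R).
  apply/cvgr0Pnorm_le => e e0; near=> n.
  rewrite ger0_norm ?std_normal_pdf_ge0// std_normal_pdfE.
  rewrite expRN ler_pdivrMr ?expR_gt0//.
  have c0 : 0 <= c by exact: normal_peak_ge0.
  have n1 : 1 <= n%:R :> R by near: n; exact: nbhs_infty_ger.
  have n2 : 2 * c / e <= n%:R by near: n; exact: nbhs_infty_ger.
  (* Polynomial growth of the exponential already beats [c / e] once $n \ge 1$ and $n \ge 2c/e$. *)
  have h1 : 1 + n%:R ^+ 2 / 2 <= expR (n%:R ^+ 2 / 2 : R) by exact: expR_ge1Dx.
  rewrite (le_trans _ (ler_wpM2l (ltW e0) h1))//.
  by move: n2; rewrite ler_pdivrMr// => n2; nra.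
have phiN (x : R) : phi (- x) = phi x by rewrite !std_normal_pdfE sqrrN.
have H0 (u : nat -> R) : (forall n, phi (u n) = phi n%:R) -> H (u n) @[n --> \oo] --> (0 : R).
  move=> uE; apply/cvgr0Pnorm_le => e e0; move/cvgr0Pnorm_le : phi0 => /(_ _ e0) phi0.
  near=> n; rewrite /H uE normrM (@le_trans _ _ `|phi n%:R|)//; last by near: n.
  by rewrite ler_piMl// sin_max.
have := Rintegral_derivative0 dH ch ig hg (H0 _ (fun=> erefl)) (H0 _ (fun n => phiN _)).
rewrite /h RintegralB//=; last 2 first.
- by have := integrableZl measurableT s (integrable_cos th s).
- exact: integrable_id_sin.
rewrite RintegralZl//; last exact: integrable_cos.
by move/eqP; rewrite subr_eq0 => /eqP.
Unshelve. all: end_near. Qed.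

(** $F(s) e^{s^2/2}$ has derivative 0, and its value at $s = 0$ is $\cos th$ because $\varphi$ has
    mass 1. *)
Lemma gauss_cosE th s : F th s = cos th * expR (- (s ^+ 2 / 2)).
Proof.
have dG (x : R) : is_derive x 1 (fun s => F th s * expR (s ^+ 2 / 2)) 0.
  have dF := is_derive_gauss_cos th x.
  by apply: is_derive_eq; rewrite gauss_cos_ibp /GRing.scale /=; field.
have := is_derive_0_is_cst s 0 dG; rewrite expr0n /= mul0r expR0 mulr1.
have -> : F th 0 = cos th.
  rewrite /F; under eq_Rintegral do rewrite mul0r addr0.
  rewrite RintegralZl//; last exact: integrable_normal_pdf.
  by rewrite /Rintegral integral_normal_pdf mulr1.
by move=> <-; rewrite -mulrA -expRD subrr expR0 mulr1.
Qed.

End gaussian_characteristic.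

(** * Approximation by trigonometric polynomials *)

Section bernstein.
Context (R : realType).
Implicit Types (F G : nat -> R) (u v : R).

(* [bernstein F m u k] is the expectation of [F (k + S)] for S binomial (m, u). *)
Fixpoint bernstein F m u k : R :=
  if m is m'.+1 then u * bernstein F m' u k.+1 + (1 - u) * bernstein F m' u k
  else F k.

Lemma le_bernstein F G m u k : 0 <= u <= 1 -> (forall j, F j <= G j) ->
  bernstein F m u k <= bernstein G m u k.
Proof.
move=> /andP[u0 u1] FG; elim: m k => [|m IH] k //=.
by rewrite lerD// ler_wpM2l// subr_ge0.
Qed.

Lemma bernstein_cst (c : R) m u k : bernstein (fun=> c) m u k = c.
Proof. by elim: m k => [|m IH] k //=; rewrite !IH; ring. Qed.

Lemma bernsteinD F G m u k :
  bernstein (fun j => F j + G j) m u k = bernstein F m u k + bernstein G m u k.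
Proof. by elim: m k => [|m IH] k //=; rewrite !IH; ring. Qed.

Lemma bernsteinZ (c : R) F m u k :
  bernstein (fun j => c * F j) m u k = c * bernstein F m u k.
Proof. by elim: m k => [|m IH] k //=; rewrite !IH; ring. Qed.

Lemma eq_bernstein F G m u k : F =1 G -> bernstein F m u k = bernstein G m u k.
Proof. by move=> /funext ->. Qed.

(** Variance plus squared bias of a shifted binomial variable, the source of the rate in Bernstein's
    theorem. *)
Lemma bernstein_sqr (a : R) m u k :
  bernstein (fun j => (j%:R - a) ^+ 2) m u k =
  m%:R * (u * (1 - u)) + (k%:R + m%:R * u - a) ^+ 2.
Proof.
elim: m k => [|m IH] k /=; first by rewrite !mul0r add0r addr0.
by rewrite !IH -!natr1; ring.
Qed.

Lemma norm_bernstein_le F (M : R) m u k : 0 <= u <= 1 ->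
  (forall j, `|F j| <= M) -> `|bernstein F m u k| <= M.
Proof.
move=> u01 FM; rewrite ler_norml -(bernstein_cst (- M) m u k).
rewrite -[X in _ && (_ <= X)](bernstein_cst M m u k).
by apply/andP; split; apply: le_bernstein => // j;
  move: (FM j); rewrite ler_norml => /andP[].
Qed.

Definition bernstein2 (H : nat -> nat -> R) m u v : R :=
  bernstein (fun i => bernstein (H i) m v 0) m u 0.

Lemma norm_bernstein2_le (H : nat -> nat -> R) (M : R) m u v :
  0 <= u <= 1 -> 0 <= v <= 1 ->
  (forall i j, `|H i j| <= M) -> `|bernstein2 H m u v| <= M.
Proof.
move=> u01 v01 HM; apply: norm_bernstein_le => // i.
exact: norm_bernstein_le.
Qed.

(** Monotonicity transfers the quadratic majorant to the binomial mean. Centred at [m.+1 * u] and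
    [m.+1 * v] the bias vanishes, and each variance is crudely at most [m.+1]. *)
Lemma bernstein2_approx (H : nat -> nat -> R) (c e K : R) m u v :
  0 <= u <= 1 -> 0 <= v <= 1 -> 0 <= K ->
  (forall i j, `|H i j - c| <=
     e + K * ((i%:R - m.+1%:R * u) ^+ 2 + (j%:R - m.+1%:R * v) ^+ 2)) ->
  `|bernstein2 H m.+1 u v - c| <= e + 2 * (K * m.+1%:R).
Proof.
move=> u01 v01 K0 Hc; set n := m.+1 in Hc *.
pose W i j : R := e + K * ((i%:R - n%:R * u) ^+ 2 + (j%:R - n%:R * v) ^+ 2).
have WE i : bernstein (W i) n v 0 =
    (e + K * (n%:R * (v * (1 - v)))) + K * (i%:R - n%:R * u) ^+ 2.
  rewrite /W bernsteinD bernstein_cst bernsteinZ bernsteinD bernstein_cst.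
  by rewrite bernstein_sqr; ring.
have W2 : bernstein2 W n u v =
    e + K * n%:R * (v * (1 - v) + u * (1 - u)).
  rewrite /bernstein2 (eq_bernstein _ _ _ WE) bernsteinD bernstein_cst.
  by rewrite bernsteinZ bernstein_sqr; ring.
have cE : bernstein2 (fun _ _ => c) n u v = c.
  by rewrite /bernstein2 bernstein_cst bernstein_cst.
have up : bernstein2 H n u v - c <= bernstein2 W n u v.
  rewrite lerBlDr -{1}cE /bernstein2 -bernsteinD.
  apply: le_bernstein => // i; rewrite -bernsteinD; apply: le_bernstein => // j.
  rewrite -lerBlDr; exact: le_trans (ler_norm _) (Hc i j).
have dn : c - bernstein2 H n u v <= bernstein2 W n u v.
  rewrite lerBlDr -[X in X <= _]cE /bernstein2 -bernsteinD.
  apply: le_bernstein => // i; rewrite -bernsteinD; apply: le_bernstein => // j.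
  rewrite -lerBlDr; apply: le_trans (ler_norm _) _; rewrite distrC; exact: Hc.
have W3 : bernstein2 W n u v <= e + 2 * (K * n%:R).
  rewrite W2 lerD2l mulrC; apply: ler_wpM2r; first by rewrite mulr_ge0.
  by move: u01 v01 => /andP[? ?] /andP[? ?]; nra.
by rewrite ler_norml (le_trans up)// andbT lerNl opprB (le_trans dn).
Qed.

End bernstein.

Section trigonometric_polynomials.
Context (R : realType).
Implicit Types f g : R -> R -> R.

(** One constructor does scaling and addition together, and the free phase covers sines and
    constants. Inductions therefore have one linear case and one case of exactly the type treated by
    the central limit theorem. *)
Inductive trigpoly : (R -> R -> R) -> Prop :=
| trigpoly_cos th s t : trigpoly (fun x y => cos (th + (s * x + t * y)))
| trigpoly_lin c f g : trigpoly f -> trigpoly g ->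
    trigpoly (fun x y => c * f x y + g x y).

Lemma trigpoly_ext f g : (forall x y, f x y = g x y) -> trigpoly f -> trigpoly g.
Proof.
by move=> fg; have -> : f = g by apply/funext => x; apply/funext => y.
Qed.

Lemma trigpolyZ c f : trigpoly f -> trigpoly (fun x y => c * f x y).
Proof.
move=> f1; apply: trigpoly_ext (trigpoly_lin c f1 (trigpoly_lin (-1) f1 f1)).
by move=> x y /=; ring.
Qed.

Lemma trigpolyD f g : trigpoly f -> trigpoly g ->
  trigpoly (fun x y => f x y + g x y).
Proof.
move=> f1 g1; apply: trigpoly_ext (trigpoly_lin 1 f1 g1) => x y.
by rewrite mul1r.
Qed.

Lemma trigpoly_cst c : trigpoly (fun _ _ => c).
Proof.
apply: trigpoly_ext (trigpolyZ c (trigpoly_cos 0 0 0)) => x y.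
by rewrite !mul0r !addr0 cos0 mulr1.
Qed.

(** Double induction reducing to $\cos A \cos B = (\cos(A-B) + \cos(A+B))/2$. *)
Lemma trigpolyM f g : trigpoly f -> trigpoly g ->
  trigpoly (fun x y => f x y * g x y).
Proof.
move=> f1; elim: f1 g => [th s t g|c f1 f2 _ IH1 _ IH2 g g1]; last first.
  apply: trigpoly_ext (trigpoly_lin c (IH1 _ g1) (IH2 _ g1)) => x y /=; ring.
elim=> [th' s' t'|c g1 g2 _ IH1 _ IH2]; last first.
  apply: trigpoly_ext (trigpoly_lin c IH1 IH2) => x y /=; ring.
apply: trigpoly_ext (trigpolyZ (1 / 2) (trigpolyD
   (trigpoly_cos (th - th') (s - s') (t - t'))
   (trigpoly_cos (th + th') (s + s') (t + t')))) => x y /=.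
set A := th + (s * x + t * y); set B := th' + (s' * x + t' * y).
have -> : th - th' + ((s - s') * x + (t - t') * y) = A - B by rewrite /A /B; ring.
have -> : th + th' + ((s + s') * x + (t + t') * y) = A + B by rewrite /A /B; ring.
by rewrite cosB [cos (A + B)]cosD; field.
Qed.

Lemma trigpoly_sin1 s : trigpoly (fun x _ => sin (s * x)).
Proof.
apply: trigpoly_ext (trigpoly_cos (- (pi / 2)) s 0) => x y.
by rewrite mul0r addr0 addrC cosBpihalf.
Qed.

Lemma trigpoly_sin2 s : trigpoly (fun _ y => sin (s * y)).
Proof.
apply: trigpoly_ext (trigpoly_cos (- (pi / 2)) 0 s) => x y.
by rewrite mul0r add0r addrC cosBpihalf.
Qed.

Lemma trigpoly_bernstein (H : nat -> R -> R -> R) (u : R -> R -> R) m k :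
  trigpoly u -> (forall i, trigpoly (H i)) ->
  trigpoly (fun x y => bernstein (fun i => H i x y) m (u x y) k).
Proof.
move=> u1 H1; elim: m k => [|m IH] k //=.
apply: trigpolyD; apply: trigpolyM => //.
apply: trigpolyD; first exact: trigpoly_cst.
apply: trigpoly_ext (trigpolyZ (-1) u1) => x y; ring.
Qed.

Lemma trigpoly_measurable d (T : measurableType d) f (Y1 Y2 : T -> R) :
  trigpoly f -> measurable_fun setT Y1 -> measurable_fun setT Y2 ->
  measurable_fun setT (fun w => f (Y1 w) (Y2 w)).
Proof.
move=> f1 m1 m2; elim: f1 => [th s t|c f1 f2 _ h1 _ h2].
  apply: measurableT_comp; first exact: measurable_cos_fun.
  by apply: measurable_funD => //; apply: measurable_funD; exact: measurable_funM.
by apply: measurable_funD => //; exact: measurable_funM.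
Qed.

End trigonometric_polynomials.

Section trigonometric_approximation.
Context (R : realType).

(** Only the base point is confined to the square, because the estimate is applied to nodes [i / n1]
    for all naturals [i], including those beyond 1. Compactness is used as near-covering along radii
    tending to 0 from the right. *)
Lemma heine_square (G : R * R -> R) (e : R) : continuous G -> 0 < e ->
  exists2 dl, 0 < dl & forall u v u' v', 0 <= u <= 1 -> 0 <= v <= 1 ->
    `|u' - u| < dl -> `|v' - v| < dl -> `|G (u', v') - G (u, v)| <= e.
Proof.
move=> cG e0; pose K : set (R * R) := `[0, 1]%classic `*` `[0, 1]%classic.
have cK : compact K by apply: compact_setX; exact: segment_compact.
have /compact_near_coveringP nc := cK.
pose Q (dl : R) (z : R * R) := forall u' v',
  `|u' - z.1| < dl -> `|v' - z.2| < dl -> `|G (u', v') - G z| <= e.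
have e2 : 0 < e / 2 by rewrite divr_gt0.
have := nc R (0^'+) Q _; case.
  move=> z _; have /cvgrPdist_lt /(_ _ e2) := cG z.
  move=> /nbhs_ballP[r /= r0 Hr]; have r2 : 0 < r / 2 by rewrite divr_gt0.
  exists (ball z (r / 2), [set dl | dl < r / 2]).
    split; first exact: nbhsx_ballx.
    exact: nbhs_right_lt.
  move=> [z' dl] /= [[z1 z2] dlr] u' v' h1 h2.
  have Gz : `|G z - G z'| < e / 2.
    apply: Hr; split.
      by apply: lt_le_trans z1 _; rewrite ler_pdivrMr// ler_pMr// ler1n.
    by apply: lt_le_trans z2 _; rewrite ler_pdivrMr// ler_pMr// ler1n.
  have Guv : `|G z - G (u', v')| < e / 2.
    apply: Hr; split.
      rewrite /ball /= in z1 *; rewrite -(subrKA z'.1) (le_lt_trans (ler_normD _ _))//.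
      by rewrite [ltRHS](splitr r) ltrD// distrC (lt_trans h1).
    rewrite /ball /= in z2 *; rewrite -(subrKA z'.2) (le_lt_trans (ler_normD _ _))//.
    by rewrite [ltRHS](splitr r) ltrD// distrC (lt_trans h2).
  rewrite -(subrKA (G z)) (le_trans (ler_normD _ _))// [leRHS](splitr e) lerD ?ltW//.
  by rewrite distrC.
move=> dl0 /= dl00 H.
exists (dl0 / 2); first by rewrite divr_gt0.
move=> u v u' v' u01 v01 uu vv.
apply: (H (dl0 / 2)) => //=; last by rewrite divr_gt0.
  rewrite sub0r normrN ger0_norm ?divr_ge0 ?ltW// ltr_pdivrMr//.
  by rewrite ltr_pMr// ltr1n.
Qed.

(** The substitution $x \mapsto (1 + \sin(x/L))/2$ is injective on $[-L, L]$, so there [g] is a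
    continuous function of the substituted variables. Its Bernstein polynomial keeps the bound [M]
    on the whole plane. *)
Lemma trig_approx (g : R -> R -> R) (M L e : R) :
  continuous (fun z : R * R => g z.1 z.2) -> (forall x y, `|g x y| <= M) ->
  0 < L -> 0 < e ->
  exists f, [/\ trigpoly f, forall x y, `|f x y| <= M &
    forall x y, `|x| <= L -> `|y| <= L -> `|f x y - g x y| <= e].
Proof.
move=> cg gM L0 e0.
have M0 : 0 <= M by rewrite (le_trans _ (gM 0 0)).
pose s0 : R := sin 1.
have pi1 : 1 < pi / 2 :> R.
  rewrite ltNge; apply/negP => h; have := cos1_gt0 R.
  have h2 : pi / 2 = 1 :> R by apply/le_anti; rewrite h pihalf_ge1.
  by rewrite -{1}h2 cos_pihalf ltxx.
have itv1 (x : R) : `|x| <= 1 -> x \in `[- (pi / 2), pi / 2].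
  rewrite ler_norml in_itv /= => /andP[x1 x2].
  by rewrite (le_trans _ x1) ?lerN2 ?(le_trans x2)// ltW.
have s0_gt0 : 0 < s0 by apply: sin_gt0_pihalf; rewrite ltr01.
have s0_lt1 : s0 < 1.
  rewrite -sin_pihalf ltr_sin//; first by apply: itv1; rewrite normr1.
  by rewrite in_itv /= lexx andbT ge0_cp// divr_ge0// pi_ge0.
(* For $|x| \le L$ the sine stays in $[-\sin 1, \sin 1]$, strictly inside $(-1, 1)$ where [asin] is
   continuous. Clamping to this interval makes the inverse substitution [psi] continuous
   everywhere. *)
pose clamp (z : R) : R := Num.max (- s0) (Num.min s0 z).
have clamp1 z : -1 < clamp z < 1.
  apply/andP; split; first by rewrite /clamp lt_max ltrN2 s0_lt1.
  by rewrite /clamp gt_max gt_min s0_lt1 andbT (lt_trans _ s0_lt1)// gtrN.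
have clampE z : `|z| <= s0 -> clamp z = z.
  by rewrite ler_norml => /andP[z1 z2]; rewrite /clamp (min_r z2) (max_r z1).
have cclamp : continuous clamp.
  move=> z; apply: (@continuous_max R R (cst (- s0)) (fun z => Num.min s0 z)).
    exact: cst_continuous.
  by apply: (@continuous_min R R (cst s0) id); [exact: cst_continuous|exact: cvg_id].
pose psi (t : R) : R := L * asin (clamp (2 * t - 1)).
have cpsi : continuous psi.
  move=> t; apply: cvgMr; apply: continuous_comp; last first.
    exact/continuous_asin/clamp1.
  apply: continuous_comp; last exact: cclamp.
  by apply: cvgB; [apply: cvgMr; exact: cvg_id|exact: cvg_cst].
pose sg (x : R) : R := (1 + sin (L^-1 * x)) / 2.
have sg01 x : 0 <= sg x <= 1.
  have := sin_geN1 (L^-1 * x); have := sin_le1 (L^-1 * x); rewrite /sg.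
  by move=> h1 h2; apply/andP; split; lra.
have psiK x : `|x| <= L -> psi (sg x) = x.
  move=> xL; have x1 : `|L^-1 * x| <= 1.
    have L1 : 0 <= L^-1 by rewrite invr_ge0 ltW.
    by rewrite normrM (ger0_norm L1) ler_pdivrMl// mulr1.
  have -> : psi (sg x) = L * asin (clamp (sin (L^-1 * x))).
    by rewrite /psi /sg; congr (L * asin (clamp _)); field.
  rewrite clampE; first by rewrite sinK ?itv1// mulVKf// lt0r_neq0.
  have [x2 x3] : -1 <= L^-1 * x /\ L^-1 * x <= 1 by apply/andP; rewrite -ler_norml.
  rewrite ler_norml /s0 -sinN; apply/andP; split.
    rewrite le_eqVlt; move: x2; rewrite le_eqVlt => /predU1P[->|x2]; first by rewrite eqxx.
    by rewrite ltr_sin ?x2 ?orbT// ?itv1// normrN normr1.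
  rewrite le_eqVlt; move: x3; rewrite le_eqVlt => /predU1P[->|x3]; first by rewrite eqxx.
  by rewrite ltr_sin ?x3 ?orbT// ?itv1// normr1.
pose G (z : R * R) : R := g (psi z.1) (psi z.2).
have cG : continuous G.
  move=> z; apply: (@continuous_comp _ _ _ (fun z : R * R => (psi z.1, psi z.2))
    (fun z : R * R => g z.1 z.2)); last exact: cg.
  have c1 : psi x.1 @[x --> z] --> psi z.1.
    by apply: (@continuous_comp _ _ _ fst psi); [exact: cvg_fst|exact: cpsi].
  have c2 : psi x.2 @[x --> z] --> psi z.2.
    by apply: (@continuous_comp _ _ _ snd psi); [exact: cvg_snd|exact: cpsi].
  exact: (cvg_pair c1 c2).
have e2 : 0 < e / 2 by rewrite divr_gt0.
have [dl dl0 Hdl] := heine_square cG e2.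
(* At distance at least [dl] from the base point, the trivial bound [2 * M] is absorbed by [K0]
   times the squared distance. *)
pose K0 : R := 2 * M / dl ^+ 2.
have K00 : 0 <= K0 by rewrite divr_ge0 ?sqr_ge0// mulr_ge0.
(* The variance term of the Bernstein estimate becomes [2 * K0 / n1], which this degree makes at
   most [e / 2]. *)
have [m Hm] : exists m : nat, 4 * K0 / e < m.+1%:R.
  by exists (Num.truncn (4 * K0 / e)); exact: truncnS_gt.
pose n1 : R := m.+1%:R; have n10 : 0 < n1 by rewrite /n1.
pose H (i j : nat) : R := G (i%:R / n1, j%:R / n1).
pose f x y : R := bernstein2 H m.+1 (sg x) (sg y).
have tsg1 : trigpoly (fun x _ : R => sg x).
  apply: trigpoly_ext (trigpolyZ (1 / 2) (trigpolyD (trigpoly_cst 1) (trigpoly_sin1 L^-1))).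
  by move=> x y; rewrite /sg; field.
have tsg2 : trigpoly (fun _ y : R => sg y).
  apply: trigpoly_ext (trigpolyZ (1 / 2) (trigpolyD (trigpoly_cst 1) (trigpoly_sin2 L^-1))).
  by move=> x y; rewrite /sg; field.
exists f; split.
- apply: (@trigpoly_bernstein _ (fun i _ y => bernstein (H i) m.+1 (sg y) 0) (fun x _ => sg x)) => //.
  move=> i; apply: (@trigpoly_bernstein _ (fun j _ _ => H i j) (fun _ y => sg y)) => //.
  by move=> j; exact: trigpoly_cst.
- by move=> x y; apply: norm_bernstein2_le => // i j; exact: gM.
move=> x y xL yL.
have gE : g x y = G (sg x, sg y) by rewrite /G /= !psiK.
have bnd : `|f x y - G (sg x, sg y)| <= e / 2 + 2 * (K0 / n1 ^+ 2 * m.+1%:R).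
  apply: bernstein2_approx => //; first by rewrite divr_ge0 ?sqr_ge0.
  move=> i j.
  have sqE (t u : R) : (t - n1 * u) ^+ 2 = n1 ^+ 2 * (t / n1 - u) ^+ 2.
    by rewrite -exprMn; congr (_ ^+ 2); field; rewrite lt0r_neq0.
  rewrite !sqE -mulrDr mulrA divfK ?expf_neq0 ?lt0r_neq0//.
  have key t : dl <= `|t| -> 2 * M <= K0 * t ^+ 2.
    move=> dt; have h : dl ^+ 2 <= t ^+ 2.
      by rewrite -[leRHS]real_normK ?num_real// lerXn2r ?nnegrE// ltW.
    rewrite -[leLHS](divfK (lt0r_neq0 (exprn_gt0 2 dl0))) -/K0.
    by rewrite ler_wpM2l.
  have GM : `|H i j - G (sg x, sg y)| <= 2 * M.
    by rewrite mulr_natl mulr2n (le_trans (ler_normB _ _))// lerD//; exact: gM.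
  have [di|/key di] := ltP `|i%:R / n1 - sg x| dl; last first.
    rewrite (le_trans GM)// -[leLHS]add0r lerD ?(ltW e2)//.
    by rewrite (le_trans di)// ler_wpM2l// lerDl sqr_ge0.
  have [dj|/key dj] := ltP `|j%:R / n1 - sg y| dl; last first.
    rewrite (le_trans GM)// -[leLHS]add0r lerD ?(ltW e2)//.
    by rewrite (le_trans dj)// ler_wpM2l// lerDr sqr_ge0.
  apply: (le_trans (Hdl _ _ _ _ (sg01 x) (sg01 y) di dj)).
  by rewrite lerDl mulr_ge0// addr_ge0// sqr_ge0.
rewrite gE (le_trans bnd)// [leRHS](splitr e) lerD2l.
have -> : 2 * (K0 / n1 ^+ 2 * m.+1%:R) = 2 * K0 / n1.
  by rewrite -/n1; field; rewrite lt0r_neq0.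
rewrite ler_pdivrMr//; move: Hm; rewrite ltr_pdivrMr// -/n1 => Hm.
by rewrite mulrAC ler_pdivlMr//; lra.
Qed.

End trigonometric_approximation.

(** * Convergence in law *)

Section continuity_theorem.
Context (R : realType).

(** [g (Y1 w) (Y2 w)] is a pointwise limit of trigonometric polynomials in [Y1 w] and [Y2 w], with
    error $1/(n+1)$ on the square of half-side $n+1$. No comparison of the Borel sets of the plane
    with the product sigma-algebra is involved. *)
Lemma measurable_bounded_continuous d (T : measurableType d)
    (g : R -> R -> R) (M : R) (Y1 Y2 : T -> R) :
  continuous (fun z : R * R => g z.1 z.2) -> (forall x y, `|g x y| <= M) ->
  measurable_fun setT Y1 -> measurable_fun setT Y2 ->
  measurable_fun setT (fun w => g (Y1 w) (Y2 w)).
Proof.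
move=> cg gM m1 m2.
have /choice[f Hf] (n : nat) : exists f, [/\ trigpoly f, forall x y, `|f x y| <= M &
    forall x y, `|x| <= n.+1%:R -> `|y| <= n.+1%:R ->
      `|f x y - g x y| <= n.+1%:R^-1].
  by apply: trig_approx.
apply: (@measurable_fun_cvg _ _ _ _ (fun n w => f n (Y1 w) (Y2 w))).
  by move=> n; apply: trigpoly_measurable => //; have [] := Hf n.
move=> w _; apply/cvgrPdist_le => e e0.
have /cvgr0Pnorm_le /(_ _ e0) h := @cvg_harmonic R; near=> n.
have [_ _ Hn] := Hf n.
have n1 (y : R) : `|y| <= n%:R -> `|y| <= n.+1%:R.
  by move=> yn; rewrite (le_trans yn)// ler_nat.
rewrite distrC (le_trans (Hn _ _ _ _))//.
- by apply: n1; near: n; exact: nbhs_infty_ger.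
- by apply: n1; near: n; exact: nbhs_infty_ger.
- by rewrite (le_trans (ler_norm _))//; near: n; exact: h.
Unshelve. all: end_near. Qed.

Section tails.
Context d (T : measurableType d) (P : probability T R).

Lemma tight_random_variable (Z : T -> R) (e : R) : measurable_fun setT Z -> 0 < e ->
  exists2 L, 0 < L & forall L', L <= L' -> Pr P [set w | L' < `|Z w|] <= e.
Proof.
move=> mZ e0; pose A (n : nat) := [set w | n%:R < `|Z w|].
have mA n : measurable (A n) by exact: measurable_gt_norm.
have cv : Er P (\1_(A n)) @[n --> \oo] --> Er P (fun=> 0).
  apply: (@cvg_Er _ _ _ _ _ _ (fun=> 1)).
  - by move=> n; exact: measurable_indic.
  - exact: L1_cst.
  - by move=> n w; exact: norm_indic_le1.
  - move=> w; apply: cvg_near_cst; near=> n.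
    rewrite indicE memNset// /A /=; apply/negP; rewrite -leNgt.
    by near: n; exact: nbhs_infty_ger.
rewrite Er_cst in cv; move/cvgr0Pnorm_le : cv => /(_ _ e0) [N _ HN].
exists N.+1%:R => // L' NL; have := HN N.+1 (leqnSn N).
rewrite -Pr_indic// => h; rewrite (le_trans _ (le_trans (ler_norm _) h))//.
apply: le_Pr => //; first exact: measurable_gt_norm.
by move=> w /=; exact: le_lt_trans.
Unshelve. all: end_near. Qed.

(** Inside the square the functions differ by at most [e]; outside it the common bound [M] gives
    [2 * M], paid only on the two tail events. *)
Lemma Er_approx_tail (f g : R -> R -> R) (Y1 Y2 : T -> R) (M L e : R) :
  measurable_fun setT (fun w => f (Y1 w) (Y2 w)) ->
  measurable_fun setT (fun w => g (Y1 w) (Y2 w)) ->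
  measurable_fun setT Y1 -> measurable_fun setT Y2 -> 0 <= e ->
  (forall x y, `|f x y| <= M) -> (forall x y, `|g x y| <= M) ->
  (forall x y, `|x| <= L -> `|y| <= L -> `|f x y - g x y| <= e) ->
  `|Er P (fun w => f (Y1 w) (Y2 w)) - Er P (fun w => g (Y1 w) (Y2 w))| <=
  e + 2 * M * (Pr P [set w | L < `|Y1 w|] + Pr P [set w | L < `|Y2 w|]).
Proof.
move=> mf mg m1 m2 e0 fM gM fg.
set A1 := [set w | L < `|Y1 w|]; set A2 := [set w | L < `|Y2 w|].
have mA1 : measurable A1 by exact: measurable_gt_norm.
have mA2 : measurable A2 by exact: measurable_gt_norm.
have M0 : 0 <= M by rewrite (le_trans _ (fM 0 0)).
have Lf : L1 P (fun w => f (Y1 w) (Y2 w)) by exact: (@L1_bounded _ _ _ _ _ M).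
have Lg : L1 P (fun w => g (Y1 w) (Y2 w)) by exact: (@L1_bounded _ _ _ _ _ M).
have L12 : L1 P (fun w => \1_A1 w + \1_A2 w) by apply: L1D; exact: L1_indic.
rewrite -ErB// (le_trans (le_norm_Er (L1B Lf Lg)))//.
rewrite !Pr_indic// -ErD; [|exact: L1_indic|exact: L1_indic].
rewrite -ErZ// -[X in _ <= X + _](Er_cst P) -ErD; [|exact: L1_cst|exact: L1Z].
apply: le_Er; first exact/L1_norm/L1B.
  by apply: L1D; [exact: L1_cst|exact: L1Z].
move=> w; rewrite !indicE.
have fgM : `|f (Y1 w) (Y2 w) - g (Y1 w) (Y2 w)| <= 2 * M.
  by rewrite mulr_natl mulr2n (le_trans (ler_normB _ _))// lerD.
have [/set_mem w1|w1] := boolP (w \in A1).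
  rewrite (le_trans fgM)// -[leLHS]add0r lerD// -[leLHS]mulr1.
  by rewrite ler_wpM2l ?mulr_ge0// lerDl.
have [/set_mem w2|w2] := boolP (w \in A2).
  by rewrite (le_trans fgM)// -[leLHS]add0r lerD// add0r mulr1.
rewrite addr0 mulr0 addr0; apply: fg.
  by rewrite leNgt; apply: contraNN w1 => ?; apply/mem_set.
by rewrite leNgt; apply: contraNN w2 => ?; apply/mem_set.
Qed.

End tails.

Context d (T : measurableType d) (P : probability T R)
  d' (T' : measurableType d') (P' : probability T' R).

(** Linearity extends convergence from cosines to trigonometric polynomials. One such polynomial
    replaces [g] on a large square, for the sequence and for the limit alike. *)
Theorem levy_continuity2 (Y1 Y2 : nat -> T -> R) (Z1 Z2 : T' -> R) :
  OP P Y1 -> OP P Y2 -> measurable_fun setT Z1 -> measurable_fun setT Z2 ->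
  (forall th s t, Er P (fun w => cos (th + (s * Y1 n w + t * Y2 n w)))
     @[n --> \oo] --> Er P' (fun w => cos (th + (s * Z1 w + t * Z2 w)))) ->
  forall (g : R -> R -> R) (M : R),
    continuous (fun z : R * R => g z.1 z.2) -> (forall x y, `|g x y| <= M) ->
  Er P (fun w => g (Y1 n w) (Y2 n w)) @[n --> \oo] -->
    Er P' (fun w => g (Z1 w) (Z2 w)).
Proof.
move=> [mY1 O1] [mY2 O2] mZ1 mZ2 cf g M cg gM.
have M0 : 0 <= M by rewrite (le_trans _ (gM 0 0)).
have tp f : trigpoly f ->
   (exists C, forall x y, `|f x y| <= C) /\
   Er P (fun w => f (Y1 n w) (Y2 n w)) @[n --> \oo] -->
   Er P' (fun w => f (Z1 w) (Z2 w)).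
  elim=> [th s t|c f1 f2 t1 [[C1 fC1] h1] t2 [[C2 fC2] h2]].
    by split; [exists 1 => x y; exact: cos_max|exact: cf].
  split.
    exists (`|c| * C1 + C2) => x y.
    by rewrite (le_trans (ler_normD _ _))// lerD// normrM ler_wpM2l.
  have LY d0 (T0 : measurableType d0) (P0 : probability T0 R) U1 U2 f0 (C0 : R) :
      trigpoly f0 -> (forall x y, `|f0 x y| <= C0) ->
      measurable_fun setT U1 -> measurable_fun setT U2 ->
      L1 P0 (fun w => f0 (U1 w) (U2 w)).
    by move=> *; apply: (@L1_bounded _ _ _ _ _ C0) => //; exact: trigpoly_measurable.
  have e1 n : Er P (fun w => c * f1 (Y1 n w) (Y2 n w) + f2 (Y1 n w) (Y2 n w)) =
      c * Er P (fun w => f1 (Y1 n w) (Y2 n w)) + Er P (fun w => f2 (Y1 n w) (Y2 n w)).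
    by rewrite ErD ?ErZ//; [exact: LY fC1 _ _|apply: L1Z; exact: LY fC1 _ _|exact: LY fC2 _ _].
  have e2 : Er P' (fun w => c * f1 (Z1 w) (Z2 w) + f2 (Z1 w) (Z2 w)) =
      c * Er P' (fun w => f1 (Z1 w) (Z2 w)) + Er P' (fun w => f2 (Z1 w) (Z2 w)).
    by rewrite ErD ?ErZ//; [exact: LY fC1 _ _|apply: L1Z; exact: LY fC1 _ _|exact: LY fC2 _ _].
  rewrite e2; under eq_fun do rewrite e1.
  by apply: cvgD => //; exact: cvgMr.
apply/cvgrPdist_le => e e0.
(* Two tails of probability [e / D], weighted by [2 * M], cost at most [e / 4]. The three errors are
   then $3/8 + 3/8 + 1/8 < 1$ times [e]. *)
pose D : R := 8 * (2 * M + 1).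
have D0 : 0 < D by rewrite mulr_gt0// ltr_wpDl// mulr_ge0.
have eD : 0 < e / D by rewrite divr_gt0.
have e8 : 0 < e / 8 by rewrite divr_gt0.
have [L1' L10 {}O1] := O1 _ eD; have [L2' L20 {}O2] := O2 _ eD.
have [L3 L30 t3] := tight_random_variable P' mZ1 eD; have [L4 L40 t4] := tight_random_variable P' mZ2 eD.
pose L := L1' + L2' + L3 + L4.
have L0 : 0 < L by rewrite !addr_gt0.
have [f [tf fM fg]] := trig_approx cg gM L0 e8.
have mY n := trigpoly_measurable tf (mY1 n) (mY2 n).
have mgY n := measurable_bounded_continuous cg gM (mY1 n) (mY2 n).
have mZ := trigpoly_measurable tf mZ1 mZ2.
have mgZ := measurable_bounded_continuous cg gM mZ1 mZ2.
have bZ := Er_approx_tail P' mZ mgZ mZ1 mZ2 (ltW e8) fM gM fg.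
have p3 : Pr P' [set w | L < `|Z1 w|] <= e / D by apply: t3; rewrite /L; lra.
have p4 : Pr P' [set w | L < `|Z2 w|] <= e / D by apply: t4; rewrite /L; lra.
have DE : e / 8 + 2 * M * (e / D + e / D) <= 3 / 8 * e.
  have -> : e / D + e / D = (e / 4) / (2 * M + 1).
    by rewrite /D; field; rewrite lt0r_neq0// ltr_wpDl// mulr_ge0.
  have h : 2 * M * (e / 4 / (2 * M + 1)) <= e / 4.
    rewrite mulrA ler_pdivrMr; last by rewrite ltr_wpDl// mulr_ge0.
    nra.
  lra.
have M20 : 0 <= 2 * M by rewrite mulr_ge0.
have {}bZ : `|Er P' (fun w => f (Z1 w) (Z2 w)) - Er P' (fun w => g (Z1 w) (Z2 w))| <= 3 / 8 * e.
  by rewrite (le_trans bZ)// (le_trans _ DE)// lerD2l ler_wpM2l// lerD.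
have [_ /cvgrPdist_le /(_ _ e8) cvf] := tp _ tf.
near=> n.
have p1 : Pr P [set w | L < `|Y1 n w|] <= e / D.
  apply: (@le_trans _ _ (Pr P [set w | L1' < `|Y1 n w|])); last by near: n.
  apply: le_Pr; [exact: measurable_gt_norm|exact: measurable_gt_norm|].
  by move=> w /=; apply: le_lt_trans; rewrite /L; lra.
have p2 : Pr P [set w | L < `|Y2 n w|] <= e / D.
  apply: (@le_trans _ _ (Pr P [set w | L2' < `|Y2 n w|])); last by near: n.
  apply: le_Pr; [exact: measurable_gt_norm|exact: measurable_gt_norm|].
  by move=> w /=; apply: le_lt_trans; rewrite /L; lra.
have bY := Er_approx_tail P (mY n) (mgY n) (mY1 n) (mY2 n) (ltW e8) fM gM fg.
have {}bY : `|Er P (fun w => f (Y1 n w) (Y2 n w)) - Er P (fun w => g (Y1 n w) (Y2 n w))| <= 3 / 8 * e.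
  by rewrite (le_trans bY)// (le_trans _ DE)// lerD2l ler_wpM2l// lerD.
have cn : `|Er P' (fun w => f (Z1 w) (Z2 w)) - Er P (fun w => f (Y1 n w) (Y2 n w))| <= e / 8.
  by near: n.
move: bY bZ cn; rewrite !ler_norml.
move=> /andP[? ?] /andP[? ?] /andP[? ?]; apply/andP; split; lra.
Unshelve. all: end_near. Qed.

End continuity_theorem.

(** * The Gaussian vector on a product probability space *)

Section gaussian_vector.
Context (R : realType).
Notation mu := (@lebesgue_measure R).
Let phi (x : R) : R := normal_pdf 0 1 x.
Let N : probability _ R := @normal_prob R 0 1.

(** The Radon-Nikodym derivative of the normal law agrees almost everywhere with the density,
    because both have the same integral over every measurable set. *)
Lemma integral_std_normal_prob (f : R -> R) (M : R) :
  measurable_fun setT f -> (forall x, `|f x| <= M) ->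
  (\int[N]_x (f x)%:E = \int[mu]_x (f x * phi x)%:E)%E.
Proof.
move=> mf fM.
have mfE : measurable_fun setT (EFin \o f) by exact/measurable_EFinP.
have dom := @normal_prob_dominates R 0 1.
have iN : N.-integrable setT (EFin \o f).
  exact: (@L1_bounded _ _ _ N f M).
rewrite -(Radon_Nikodym_change_of_variables dom _ iN)//.
under [RHS]eq_integral do rewrite EFinM.
apply: ae_eq_integral => //.
  exact: emeasurable_funM.
  apply: emeasurable_funM => //; apply/measurable_EFinP; exact: measurable_normal_pdf.
- apply: ae_eqe_mul2l => /=.
  rewrite Radon_NikodymE//=.
  case: cid => /= h [h1 h2 h3].
  apply: integral_ae_eq => //=.
  + by apply/measurable_EFinP; exact: measurable_normal_pdf.
  + by move=> E E01 mE; rewrite -h3.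
Qed.

Definition std_gauss2 : probability _ R := (N \x N)%E.

Lemma Er_std_gauss2 (f : R -> R -> R) (M : R) :
  measurable_fun setT (fun z : measurableTypeR R * measurableTypeR R => f z.1 z.2) ->
  (forall x y, `|f x y| <= M) ->
  Er std_gauss2 (fun z => f z.1 z.2) =
  fine (\int[mu]_x \int[mu]_y (f x y * phi x * phi y)%:E)%E.
Proof.
move=> mf fM.
have if2 : (N \x N)%E.-integrable setT (EFin \o (fun z => f z.1 z.2)).
  by apply: (@L1_bounded _ _ _ std_gauss2 _ M) => // z; exact: fM.
rewrite ErE /Rintegral -(integral12_prod_meas1 if2) /=; congr fine.
have mfx x : measurable_fun setT (fun y => f x y).
  exact: (measurable_fun_pair2 x mf).
pose h x : R := \int[mu]_y (f x y * phi y).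
have hE x : (\int[N]_y (f x y)%:E = (h x)%:E)%E.
  rewrite (integral_std_normal_prob (mfx x) (fM x)) /h fineK//.
  apply: integrable_fin_num => //.
  exact: integrable_bounded_std_normal (mfx x) (fM x).
have hEr x : h x = Er N (f x) by rewrite ErE /Rintegral hE.
have LNf x : L1 N (f x) by exact: (L1_bounded N (mfx x) (fM x)).
have hM x : `|h x| <= M by rewrite hEr; apply: norm_Er_le.
have mh : measurable_fun setT h.
  apply/measurable_EFinP.
  have := measurable_fubini_F if2.
  by congr (measurable_fun _ _); apply/funext => x; rewrite /fubini_F /= hE.
rewrite [LHS](_ : _ = \int[N]_x (h x)%:E)%E; last first.
  by apply: eq_integral => x _; rewrite /fubini_F /= hE.
rewrite (integral_std_normal_prob mh hM); apply: eq_integral => x _.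
rewrite EFinM /h fineK; last first.
  apply: integrable_fin_num => //.
  exact: integrable_bounded_std_normal (mfx x) (fM x).
rewrite -integralZr//; last exact: integrable_bounded_std_normal (mfx x) (fM x).
by apply: eq_integral => y _; rewrite -EFinM mulrAC.
Qed.

Lemma measurable_std_gauss2_linear (a b : R) : measurable_fun setT
  (fun z : measurableTypeR R * measurableTypeR R => a * z.1 + b * z.2).
Proof.
apply: measurable_funD; apply: measurable_funM => //.
Qed.

(** Presents the iterated Lebesgue integral as an expectation of two random variables, the form in
    which the continuity theorem expects the limit. *)
Lemma gauss2_expectE (a11 a12 a21 a22 : R) (g : R -> R -> R) (M : R) :
  continuous (fun z : R * R => g z.1 z.2) -> (forall x y, `|g x y| <= M) ->
  gauss2_expect a11 a12 a21 a22 g =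
  Er std_gauss2 (fun z => g (a11 * z.1 + a12 * z.2) (a21 * z.1 + a22 * z.2)).
Proof.
move=> cg gM.
have mg := measurable_bounded_continuous cg gM
  (measurable_std_gauss2_linear a11 a12) (measurable_std_gauss2_linear a21 a22).
by rewrite (@Er_std_gauss2 (fun x y => g (a11 * x + a12 * y) (a21 * x + a22 * y)) M mg).
Qed.

(** Two uses of the one-dimensional formula: the inner integral has phase [th + a * x], so its value
    is again a cosine to be integrated in [x]. *)
Lemma Er_std_gauss2_cos (th a b : R) :
  Er std_gauss2 (fun z => cos (th + (a * z.1 + b * z.2))) =
  cos th * expR (- ((a ^+ 2 + b ^+ 2) / 2)).
Proof.
have mc : measurable_fun setT (fun z : measurableTypeR R * measurableTypeR R =>
    cos (th + (a * z.1 + b * z.2))).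
  apply: measurableT_comp; first exact: measurable_cos_fun.
  by apply: measurable_funD => //; exact: measurable_std_gauss2_linear.
rewrite (@Er_std_gauss2 (fun x y => cos (th + (a * x + b * y))) 1 mc)//; last first.
  by move=> x y; exact: cos_max.
have icos t s : mu.-integrable setT (fun z => (cos (t + s * z) * phi z)%:E).
  exact: integrable_cos.
rewrite (_ : (\int[mu]_x _)%E =
  \int[mu]_x ((expR (- (b ^+ 2 / 2)))%:E * (cos (th + a * x) * phi x)%:E)%E)%E.
  rewrite integralZl//.
  rewrite fineM//; last by apply: integrable_fin_num => //; exact: icos.
  have := gauss_cosE th a; rewrite /Rintegral => ->.
  by rewrite /= mulrCA -expRD; congr (_ * expR _); field.
apply: eq_integral => x _.
have e1 y : (cos (th + (a * x + b * y)) * phi x * phi y)%:E =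
    ((phi x)%:E * (cos ((th + a * x) + b * y) * phi y)%:E)%E.
  by rewrite -EFinM addrA; congr (_%:E); ring.
under eq_integral do rewrite e1.
rewrite integralZl//.
rewrite -[X in (_ * X)%E]fineK; last by apply: integrable_fin_num => //; exact: icos.
have := gauss_cosE (th + a * x) b; rewrite /Rintegral => ->.
by rewrite -!EFinM; congr (_%:E); ring.
Qed.

End gaussian_vector.

(** * Quantiles *)

Section order_statistics.
Context (R : realType) (T : Type).
Implicit Types (X : nat -> T -> R).

Definition le_ind (x y : R) : R := ((y <= x)%R)%:R.

Lemma count_le_sum X n x w :
  (count (fun y => y <= x)%R [seq X i w | i <- iota 0 n])%:R =
  \sum_(i < n) le_ind x (X i w) :> R.
Proof.
rewrite count_map -sum1_count natr_sum big_mkcond /= -(big_mkord xpredT (fun i => le_ind x (X i w))).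
rewrite /index_iota subn0; apply: eq_bigr => i _.
by rewrite /le_ind; case: (_ <= _).
Qed.

Lemma order_stat_le X n k x w : (0 < k <= n)%N ->
  (order_stat X n k w <= x) = (k%:R <= \sum_(i < n) le_ind x (X i w)).
Proof.
move=> /andP[k0 kn]; rewrite -count_le_sum ler_nat /order_stat.
set s := [seq X i w | i <- iota 0 n].
have ss : sorted <=%R (sort <=%R s) by exact: sort_le_sorted.
have cs : count (fun y => y <= x) (sort <=%R s) = count (fun y => y <= x) s.
  by apply/permP; exact/permEl/perm_sort.
have sz : size (sort <=%R s) = n by rewrite size_sort size_map size_iota.
have [kc|kc] := leqP k (count (fun y => y <= x) s).
  by apply: (@nth_count_le _ _ x) => //; rewrite prednK// cs.
apply/negbTE; rewrite -ltNge; apply: (@nth_count_gt _ _ x) => //.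
by rewrite sz cs prednK// kn andbT -ltnS prednK.
Qed.

(** The index is a genuine rank between 1 and [n], so [nth] never returns its default, and rounding
    costs less than 1. *)
Lemma sample_quantile_index (p : R) n : 0 < p < 1 -> (0 < n)%N ->
  (0 < `|Num.ceil (n%:R * p)|%N <= n)%N /\
  n%:R * p <= (`|Num.ceil (n%:R * p)|%N)%:R < n%:R * p + 1.
Proof.
move=> /andP[p0 p1] n0; set c := Num.ceil _.
have n1 : 0 < n%:R :> R by rewrite ltr0n.
have c0 : 0 <= c by rewrite ceil_ge0 (@lt_trans _ _ 0) ?ltrN10// mulr_gt0.
have cE : (`|c|%N)%:R = c%:~R :> R by rewrite pmulrn gez0_abs.
have /andP[h1 h2] := ceil_itv (n%:R * p).
rewrite cE h2; split; last first.
  by move: h1; rewrite rmorphB /= ltrBlDr -/c => ->.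
rewrite absz_gt0; apply/andP; split.
  by rewrite gt_eqF// -(@ltr0z R) (lt_le_trans _ h2)// mulr_gt0.
rewrite -lez_nat gez0_abs// /c ceil_le_int.
by rewrite -pmulrn ler_piMr// ltW.
Qed.

End order_statistics.

Section quantile.
Context d (T : measurableType d) (R : realType) (P : probability T R).

Lemma measurable_le_ind (x : R) : measurable_fun setT (le_ind x).
Proof.
rewrite (_ : le_ind x = \1_[set y | y <= x]).
  by apply: measurable_indic; exact: measurable_le_fun.
by apply/funext => y; rewrite indicE mem_setE.
Qed.

Lemma le_ind_le1 (x y : R) : `|le_ind x y| <= 1.
Proof. by rewrite /le_ind; have [_|_] := boolP (y <= x); rewrite ?normr1 ?normr0. Qed.

Lemma measurable_sample_quantile (X : nat -> T -> R) (n : nat) (p : R) :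
  (forall i, measurable_fun setT (X i)) -> 0 < p < 1 ->
  measurable_fun setT (sample_quantile X n p).
Proof.
move=> mX p01; case: n => [|n].
  (* The empty sample has sorted list [[::]], and [nth] returns its default 0. *)
  rewrite (_ : sample_quantile X 0 p = fun=> 0); first exact: measurable_cst.
  by apply/funext => w; rewrite /sample_quantile /order_stat /= nth_nil.
have [kn _] := sample_quantile_index p01 (ltn0Sn n).
apply: (measurability _ (RGenOInfty.measurableE R)) => // _ [_ [x ->]] <-.
rewrite setTI (_ : _ @^-1` _ = ~` [set w | sample_quantile X n.+1 p w <= x]).
  apply: measurableC; rewrite /sample_quantile.
  under eq_set => w do rewrite order_stat_le//.
  rewrite (_ : mkset _ = [set w | - (\sum_(i < n.+1) le_ind x (X i w)) <=
    - (`|Num.ceil (n.+1%:R * p)|%N)%:R]).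
    apply: measurable_le_fun; apply: measurableT_comp => //.
    apply: measurable_sum => i.
    by apply: measurableT_comp => //; exact: measurable_le_ind.
  by apply/seteqP; split => w /=; rewrite lerN2.
apply/seteqP; split => w /=; rewrite in_itv /= andbT ltNge; first by move/negP.
by move=> h; apply/negP.
Qed.

Context (X0 : {RV P >-> R}).
Let F : R -> R := cdfR X0.

Lemma cdfRE x : F x = Er P (fun w => le_ind x (X0 w)).
Proof.
have mA : measurable [set w | X0 w <= x] by exact: measurable_le_fun.
rewrite (@eq_Er _ _ _ _ _ (\1_[set w | X0 w <= x])); last first.
  by move=> w; rewrite indicE mem_setE.
rewrite -Pr_indic// /F /cdfR /cdf /Pr /distribution /pushforward.
Qed.

Lemma L1_le_ind x : L1 P (fun w => le_ind x (X0 w)).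
Proof.
apply: (@L1_bounded _ _ _ _ _ 1); last by move=> w; exact: le_ind_le1.
by apply: measurableT_comp => //; exact: measurable_le_ind.
Qed.

Lemma le_ind_homo (x x' y : R) : x <= x' -> le_ind x y <= le_ind x' y.
Proof.
move=> xx; rewrite /le_ind; have [yx|] := boolP (y <= x).
  by rewrite (le_trans yx xx).
by rewrite ler0n.
Qed.

Lemma cdfR_homo x x' : x <= x' -> F x <= F x'.
Proof.
move=> xx; rewrite !cdfRE; apply: le_Er => [||w].
- exact: L1_le_ind.
- exact: L1_le_ind.
- exact: le_ind_homo.
Qed.

(** With [cdfR_lt], it makes the set defining the quantile nonempty and bounded below, so that [inf]
    is a true infimum. *)
Lemma cdfR_gt (p : R) : p < 1 -> exists x, p < F x.
Proof.
move=> p1; have e0 : 0 < 1 - p by rewrite subr_gt0.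
have cv : Er P (fun w => le_ind n%:R (X0 w)) @[n --> \oo] --> Er P (fun=> 1).
  apply: (@cvg_Er _ _ _ _ _ _ (fun=> 1)).
  - by move=> n; apply: L1_mfun; exact: L1_le_ind.
  - exact: L1_cst.
  - by move=> n w; exact: le_ind_le1.
  - move=> w; apply: cvg_near_cst; near=> n.
    rewrite /le_ind (_ : (_ <= _) = true)//.
    by near: n; exact: nbhs_infty_ger.
rewrite Er_cst in cv; move/cvgrPdist_lt : cv => /(_ _ e0) [N _ /(_ N (leqnn N))] /=.
rewrite -cdfRE => h; exists N%:R.
by move: (le_lt_trans (ler_norm _) h); lra.
Unshelve. all: end_near. Qed.

Lemma cdfR_lt (p : R) : 0 < p -> exists x, F x < p.
Proof.
move=> p0.
have cv : Er P (fun w => le_ind (- n%:R) (X0 w)) @[n --> \oo] --> Er P (fun=> 0).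
  apply: (@cvg_Er _ _ _ _ _ _ (fun=> 1)).
  - by move=> n; apply: L1_mfun; exact: L1_le_ind.
  - exact: L1_cst.
  - by move=> n w; exact: le_ind_le1.
  - move=> w; apply: cvg_near_cst; near=> n.
    rewrite /le_ind (_ : (_ <= _) = false)//.
    apply/negbTE; rewrite -ltNge ltrNl.
    by near: n; exact: nbhs_infty_gtr.
rewrite Er_cst in cv; move/cvgr0Pnorm_lt : cv => /(_ _ p0) [N _ /(_ N (leqnn N))] /=.
by rewrite -cdfRE => h; exists (- N%:R); rewrite (le_lt_trans (ler_norm _) h).
Unshelve. all: end_near. Qed.

(** Differentiability gives continuity at the quantile. Points to its left have [F] below [p], and
    points arbitrarily close on its right have [F] at least [p]. *)
Lemma cdfR_quantile (p : R) : 0 < p < 1 -> derivable F (quantile X0 p) 1 ->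
  F (quantile X0 p) = p.
Proof.
move=> /andP[p0 p1] dF; set q := quantile X0 p in dF *.
have cF : {for q, continuous F}.
  by apply/differentiable_continuous/derivable1_diffP.
have [x1 Fx1] := cdfR_gt p1; have [x2 Fx2] := cdfR_lt p0.
have hi : has_inf [set x | p <= F x].
  split; first by exists x1; exact: ltW.
  exists x2 => y /= py; rewrite leNgt; apply/negP => /ltW /cdfR_homo.
  by rewrite leNgt (lt_le_trans Fx2 py).
apply/eqP; rewrite eq_le; apply/andP; split.
  apply/ler_addgt0Pr => e e0.
  have /cvgrPdist_lt /(_ _ e0) := cF.
  move=> /nbhs_ballP[r /= r0 Hr].
  have r2 : 0 < r / 2 by rewrite divr_gt0.
  have := Hr (q - r / 2); rewrite /ball /= opprB addrC subrK (gtr0_norm r2).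
  rewrite ltr_pdivrMr// ltr_pMr// ltr1n => /(_ isT) h.
  have Fq : F (q - r / 2) < p.
    rewrite ltNge; apply/negP => /(ge_inf hi.2).
    by rewrite -/(quantile X0 p) -/q lerBrDr gerDl leNgt divr_gt0.
  by move: (le_lt_trans (ler_norm _) h); lra.
apply/ler_addgt0Pr => e e0.
have /cvgrPdist_lt /(_ _ e0) := cF.
move=> /nbhs_ballP[r /= r0 Hr].
have [y /= py yq] := inf_adherent r0 hi.
have qy : q <= y by exact: (ge_inf hi.2).
have := Hr y; rewrite /ball /= distrC ger0_norm ?subr_ge0// ltrBlDl => /(_ yq) h.
rewrite distrC in h.
by move: (le_lt_trans (ler_norm _) h); lra.
Qed.

End quantile.

(** * Comparison of two sequences through separating levels *)

Section ghosh.
Context d (T : measurableType d) (R : realType) (P : probability T R).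
Implicit Types V W : nat -> T -> R.

(** [V] enters only through the comparison of [V w] with [y]. For a sample quantile this is a
    statement about a count of observations, which makes such events accessible. *)
Definition straddle (V W : T -> R) (y e : R) : set T :=
  [set w | V w <= y] `&` [set w | y + e <= W w] `|`
  [set w | y < V w] `&` [set w | W w <= y - e].

Lemma measurable_straddle (V W : T -> R) y e : measurable_fun setT V ->
  measurable_fun setT W -> measurable (straddle V W y e).
Proof.
move=> mV mW; apply: measurableU; apply: measurableI.
- exact: measurable_le_fun.
- rewrite (_ : [set w | y + e <= W w] = [set w | - W w <= - (y + e)]).
    by apply: measurable_le_fun; exact: measurableT_comp.
  by apply/seteqP; split=> w /=; rewrite lerN2.
- rewrite (_ : [set w | y < V w] = [set w | - V w < - y]).
    by apply: measurable_lt_fun; exact: measurableT_comp.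
  by apply/seteqP; split=> w /=; rewrite ltrN2.
- exact: measurable_le_fun.
Qed.

(* If [|W| <= L] and [V] and [W] differ by more than [e], then some point of the
   grid of mesh [e / 2] separates them. *)
Lemma ghosh_criterion V W : (forall n, measurable_fun setT (V n)) -> OP P W ->
  (forall (y e dl : R), 0 < e -> 0 < dl ->
     \forall n \near \oo, Pr P (straddle (V n) (W n) y e) <= dl) ->
  oP P (fun n w => V n w - W n w).
Proof.
move=> mV [mW OW] VW; split=> [n|e dl e0 dl0]; first exact: measurable_funB.
have dl2 : 0 < dl / 2 by rewrite divr_gt0.
have e2 : 0 < e / 2 by rewrite divr_gt0.
have [L L0 {}OW] := OW _ dl2.
have union (s : seq R) dl' : 0 < dl' -> \forall n \near \oo,
    Pr P (\big[setU/set0]_(y <- s) straddle (V n) (W n) y (e / 2)) <= dl'.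
  elim: s dl' => [|y s IH] dl' dl'0.
    by apply: nearW => n; rewrite big_nil /Pr measure0 /= ltW.
  have d2 : 0 < dl' / 2 by rewrite divr_gt0.
  have h1 := IH _ d2; have h2 := VW y _ _ e2 d2.
  near=> n; rewrite big_cons (le_trans (Pr_setU _ _ _))//.
  - exact: measurable_straddle.
  - by apply: bigsetU_measurable => z _; exact: measurable_straddle.
  - by rewrite [leRHS](splitr dl') lerD//; near: n.
(* Enough points of mesh [e / 2] to cover an interval of length [2 * L + 2 * e], plus one beyond its
   right end. *)
pose J := (Num.truncn ((2 * L + 2 * e) / (e / 2))).+2.
pose grid := [seq - L - e + i%:R * (e / 2) | i <- iota 0 J].
have gridP (t : R) : - L - e <= t -> t <= L + e -> exists2 y : R, y \in grid & t < y <= t + e / 2.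
  move=> t1 t2; pose i := (Num.truncn ((t + L + e) / (e / 2))).+1.
  have t0 : 0 <= (t + L + e) / (e / 2) by rewrite divr_ge0 ?(ltW e2)//; lra.
  have /andP[] := truncn_itv t0; rewrite -/i ler_pdivlMr// ltr_pdivrMr// => h1 h2.
  exists (- L - e + i%:R * (e / 2)).
    apply/mapP; exists i => //; rewrite mem_iota /= add0n /i /J ltnS ltnS.
    apply: le_truncn; rewrite ler_pM2r ?invr_gt0//; lra.
  rewrite /i -natr1 mulrDl mul1r; rewrite /i -natr1 mulrDl mul1r in h2.
  by apply/andP; split; lra.
have {}union := union grid _ dl2.
near=> n; rewrite [leRHS](splitr dl).
pose U := \big[setU/set0]_(y <- grid) straddle (V n) (W n) y (e / 2).
have mU : measurable U.
  by apply: bigsetU_measurable => z _; exact: measurable_straddle.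
have mL : measurable [set w | L < `|W n w|] by exact: measurable_gt_norm.
apply: (@le_trans _ _ (Pr P ([set w | L < `|W n w|] `|` U))); last first.
  apply: le_trans (Pr_setU P mL mU) _; apply: lerD; first by near: n.
  by rewrite /U; near: n; exact: union.
apply: le_Pr; [by apply: measurable_gt_norm; exact: measurable_funB|exact: measurableU|].
move=> w /= VWe; have [WL|] := leP `|W n w| L; last by left.
right; move: WL; rewrite ler_norml => /andP[W1 W2].
have inU (y : R) : y \in grid -> straddle (V n) (W n) y (e / 2) w -> U w.
  by move=> yg sy; rewrite /U -bigcup_seq; exists y.
(* If [V] exceeds [W] by more than [e], a grid point in $(W + e/2, W + e]$ separates them. In the
   opposite case one in $(W - e, W - e/2]$ does. *)
move: VWe; rewrite lter_normr => /orP[VWe|VWe].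
  have [||y yg /andP[y1 y2]] := gridP (W n w + e / 2); [lra|lra|].
  by apply: (inU y yg); right; split => /=; lra.
have [||y yg /andP[y1 y2]] := gridP (W n w - e); [lra|lra|].
by apply: (inU y yg); left; split => /=; lra.
Unshelve. all: end_near. Qed.

End ghosh.

(** * The Bahadur representation of the sample quantile *)

Section bahadur.
Context d (T : measurableType d) (R : realType) (P : probability T R)
  (X : nat -> {RV P >-> R}) (X0 : {RV P >-> R}) (p : R).
Hypothesis iidX : iid_with_parent X X0.
Hypothesis p01 : 0 < p < 1.
Let F : R -> R := cdfR X0.
Let q : R := quantile X0 p.
Let f : R := derive1 F q.
Hypothesis dF : derivable F q 1.
Hypothesis f0 : 0 < f.

Let rt (n : nat) : R := Num.sqrt n%:R.
Let a (x y : R) : R := F x - le_ind x y.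

Lemma Er_centered_le_ind x : [/\ measurable_fun setT (a x),
  L2 P (fun w => a x (X0 w)) & Er P (fun w => a x (X0 w)) = 0].
Proof.
have ma : measurable_fun setT (a x).
  by apply: measurable_funB; [exact: measurable_cst|exact: measurable_le_ind].
split=> //.
  apply: (@L2_bounded _ _ _ _ _ (`|F x| + 1)); first exact: mfun_RV.
  by move=> w; rewrite (le_trans (ler_normB _ _))// lerD// le_ind_le1.
rewrite ErB; [|exact: L1_cst|exact: L1_le_ind].
by rewrite Er_cst -cdfRE subrr.
Qed.

(** A difference of two nested indicators has constant sign, so its square is plus or minus itself
    and has mean $|F(x) - F(q)|$. Centring only lowers the second moment. *)
Lemma Er_sqr_increment x : Er P (fun w => (a x (X0 w) - a q (X0 w)) ^+ 2) <=
  `|F x - F q|.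
Proof.
pose I w : R := le_ind x (X0 w) - le_ind q (X0 w).
have LI : L1 P I by apply: L1B; exact: L1_le_ind.
have EI : Er P I = F x - F q.
  by rewrite ErB; [rewrite -!cdfRE|exact: L1_le_ind|exact: L1_le_ind].
have [sg sg1 I2] : exists2 sg : R, `|sg| <= 1 & forall w, I w ^+ 2 = sg * I w.
  have le_indM (u v y : R) : u <= v -> le_ind u y * le_ind v y = le_ind u y.
    move=> uv; rewrite /le_ind; have [yu|_] := boolP (y <= u); last by rewrite mul0r.
    by rewrite (le_trans yu uv) mulr1.
  have sqrE w : I w ^+ 2 = le_ind x (X0 w) * le_ind x (X0 w) -
      2 * (le_ind x (X0 w) * le_ind q (X0 w)) + le_ind q (X0 w) * le_ind q (X0 w).
    by rewrite /I; ring.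
  have [xq|/ltW xq] := leP q x; [exists 1|exists (-1)]; rewrite ?normrN ?normr1// => w.
    by rewrite sqrE (le_indM x x)// (le_indM q q)// [le_ind x _ * _]mulrC (le_indM q x)// /I; ring.
  by rewrite sqrE (le_indM x x)// (le_indM q q)// (le_indM x q)// /I; ring.
have L2I : L1 P (fun w => I w ^+ 2).
  by under eq_fun do rewrite I2; exact: L1Z.
rewrite (@eq_Er _ _ _ _ _ (fun w => I w ^+ 2 + ((- (2 * (F x - F q))) * I w + (F x - F q) ^+ 2))); last first.
  by move=> w; rewrite /a /I; ring.
rewrite ErD//; last by apply: L1D; [exact: L1Z|exact: L1_cst].
rewrite ErD; [|exact: L1Z|exact: L1_cst].
rewrite ErZ// Er_cst EI (@eq_Er _ _ _ _ _ _ I2) ErZ// EI.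
have h : sg * (F x - F q) <= `|F x - F q|.
  by rewrite (le_trans (ler_norm _))// normrM ler_piMl.
have := sqr_ge0 (F x - F q); lra.
Qed.

Let W (n : nat) (w : T) : R := (rt n)^-1 * \sum_(i < n) (f^-1 * a q (X i w)).
Let V (n : nat) (w : T) : R := rt n * (sample_quantile (fun i => X i) n p w - q).

Lemma cvg_scaled_cdf (y : R) :
  rt n * (F (q + y / rt n) - F q) @[n --> \oo] --> f * y.
Proof.
apply/cvgrPdist_le => e e0.
have y1 : 0 < `|y| + 1 by rewrite ltr_wpDl.
have ey : 0 < e / (`|y| + 1) by rewrite divr_gt0.
have [dl dl0 H] := derivable_approx dF ey.
near=> n.
have n0 : 0 < rt n.
  by apply: (@lt_le_trans _ _ 1) => //; near: n; exact: near_sqrt_ge.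
have ny : `|y| / dl <= rt n by near: n; exact: near_sqrt_ge.
have := H (q + y / rt n); rewrite -/f addrAC subrr add0r normrM normfV (gtr0_norm n0).
rewrite ler_pdivrMr// mulrC -ler_pdivrMr// => /(_ ny) h.
have -> : f * y - rt n * (F (q + y / rt n) - F q) =
  - (rt n * (F (q + y / rt n) - F q - f * (y / rt n))).
  by field; rewrite lt0r_neq0.
rewrite normrN normrM (gtr0_norm n0) (le_trans (ler_wpM2l (ltW n0) h))//.
rewrite mulrCA [rt n * _]mulrCA mulfV ?lt0r_neq0// mulr1.
by rewrite mulrAC ler_pdivrMr// ler_wpM2l ?(ltW e0)// lerDl.
Unshelve. all: end_near. Qed.

Lemma OP_quantile_score : OP P W.
Proof.
have [ma a2 a0] := Er_centered_le_ind q.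
have mfa : measurable_fun setT (fun y => f^-1 * a q y) by exact: measurable_funM.
have fa2 : L2 P (fun w => f^-1 * a q (X0 w)) by exact: L2Z.
have fa0 : Er P (fun w => f^-1 * a q (X0 w)) = 0.
  by rewrite ErZ ?a0 ?mulr0//; exact: L2_L1.
exact: (OP_iid_sum iidX mfa fa2 fa0).
Qed.

Let Dn (y : R) (n : nat) (w : T) : R :=
  (rt n)^-1 * \sum_(i < n) (f^-1 * (a (q + y / rt n) (X i w) - a q (X i w))).

(** The sum is normalized by $\sqrt n$, so its second moment is that of one summand, at most $f^{-2}
    |F(q + y/\sqrt n) - F(q)|$. This tends to 0 by continuity of $F$ at $q$. *)
Lemma oP_increment y : oP P (Dn y).
Proof.
have [maq a2q a0q] := Er_centered_le_ind q.
pose b (n : nat) (x : R) : R := f^-1 * (a (q + y / rt n) x - a q x).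
have mb n : measurable_fun setT (b n).
  have [mx _ _] := Er_centered_le_ind (q + y / rt n).
  by apply: measurable_funM => //; exact: measurable_funB.
have b2 n : L2 P (fun w => b n (X0 w)).
  have [_ x2 _] := Er_centered_le_ind (q + y / rt n).
  by apply: L2Z; exact: L2B.
have b0 n : Er P (fun w => b n (X0 w)) = 0.
  have [_ x2 x0] := Er_centered_le_ind (q + y / rt n).
  rewrite ErZ; last by apply: L1B; exact: L2_L1.
  by rewrite ErB ?x0 ?a0q ?subrr ?mulr0//; exact: L2_L1.
have S2 n : L2 P (fun w => \sum_(i < n) b n (X i w)).
  by apply: L2_sum => i; exact: (L2_iid iidX).
apply: oP_Er_sqr => [n|]; first exact: L2Z.
have cF : {for q, continuous F}.
  by apply/differentiable_continuous/derivable1_diffP.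
have bound n : `|Er P (fun w => Dn y n w ^+ 2)| <=
    f^-1 ^+ 2 * `|F (q + y / rt n) - F q|.
  rewrite ger0_norm; last by apply: Er_ge0 => w; exact: sqr_ge0.
  rewrite (@eq_Er _ _ _ _ _ (fun w => (rt n)^-1 ^+ 2 * (\sum_(i < n) b n (X i w)) ^+ 2)); last first.
    by move=> w; rewrite -exprMn.
  rewrite ErZ; last exact: (S2 n).2.
  rewrite (Er_iid_sum_sqr iidX n (mb n) (b2 n) (b0 n)).
  have [x2 _] := b2 n.
  rewrite (@eq_Er _ _ _ _ _ (fun w => f^-1 ^+ 2 * (a (q + y / rt n) (X0 w) - a q (X0 w)) ^+ 2)); last first.
    by move=> w; rewrite -exprMn.
  have L1b : L1 P (fun w => (a (q + y / rt n) (X0 w) - a q (X0 w)) ^+ 2).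
    have [_ z2 _] := Er_centered_le_ind (q + y / rt n).
    exact: (L2B z2 a2q).2.
  rewrite ErZ// mulrA exprVn sqr_sqrtr// mulrCA ler_wpM2l ?sqr_ge0//.
  have [->|n0] := eqVneq (n%:R : R) 0; first by rewrite mulr0 mul0r.
  by rewrite mulVf// mul1r; exact: Er_sqr_increment.
have f2 : 0 < f^-1 ^+ 2 by rewrite exprn_gt0// invr_gt0.
apply/cvgr0Pnorm_le => e e0.
have ef : 0 < e / f^-1 ^+ 2 by rewrite divr_gt0.
have /cvgrPdist_le /(_ _ ef) := cF.
move=> /nbhs_ballP[r /= r0 Hr]; near=> n.
rewrite (le_trans (bound n))// mulrC -ler_pdivlMr// distrC; apply: Hr.
have n0 : 0 < rt n.
  by apply: (@lt_le_trans _ _ 1) => //; near: n; exact: near_sqrt_ge.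
have ny : (`|y| + 1) / r <= rt n by near: n; exact: near_sqrt_ge.
rewrite /ball /= opprD addrA subrr add0r normrN normrM normfV (gtr0_norm n0).
rewrite ltr_pdivrMr// mulrC -ltr_pdivrMr// (lt_le_trans _ ny)//.
by rewrite ltr_pM2r ?invr_gt0// ltrDl.
Unshelve. all: end_near. Qed.

Lemma sample_quantile_le n y w : (0 < n)%N ->
  (V n w <= y) =
  ((`|Num.ceil (n%:R * p)|%N)%:R <= \sum_(i < n) le_ind (q + y / rt n) (X i w)).
Proof.
move=> n0; have [kn _] := sample_quantile_index p01 n0.
have r0 : 0 < rt n by rewrite sqrtr_gt0 ltr0n.
by rewrite -(order_stat_le (fun i => X i) (q + y / rt n) w kn) /V -ler_pdivlMl// lerBlDl [_^-1 * _]mulrC.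
Qed.

(** Counting turns [V n w <= y] into a comparison of [W n w + Dn y n w] with a deterministic level
    tending to [y]. A straddling event therefore forces the negligible [Dn y n w] to be large. *)
Lemma bahadur_representation : oP P (fun n w => V n w - W n w).
Proof.
have Fq : F q = p by exact: cdfR_quantile.
have mV n : measurable_fun setT (V n).
  apply: measurable_funM => //; apply: measurable_funB => //.
  exact: measurable_sample_quantile.
have mW n : measurable_fun setT (W n) by case: OP_quantile_score.
(* [t y n] is the threshold with [V n <= y <-> W n + Dn y n <= t y n]. *)
pose t (y : R) (n : nat) : R := rt n * (F (q + y / rt n) -
   (`|Num.ceil (n%:R * p)|%N)%:R / n%:R) / f.
have tV y n w : (0 < n)%N -> (V n w <= y) = (W n w + Dn y n w <= t y n).
  move=> n0; rewrite sample_quantile_le//.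
  have r0 : 0 < rt n by rewrite sqrtr_gt0 ltr0n.
  have nn : (rt n) ^+ 2 = n%:R by rewrite sqr_sqrtr.
  have -> : W n w + Dn y n w = (rt n)^-1 * f^-1 *
      (n%:R * F (q + y / rt n) - \sum_(i < n) le_ind (q + y / rt n) (X i w)).
    rewrite /W /Dn -mulrDr -big_split /= -mulrA; congr (_ * _).
    rewrite mulrBr mulr_natl -[n in _ *+ n](card_ord n) -sumr_const.
    rewrite !mulr_sumr -sumrB; apply: eq_bigr => i _; rewrite /a; ring.
  have -> : t y n = (rt n)^-1 * f^-1 *
      (n%:R * F (q + y / rt n) - (`|Num.ceil (n%:R * p)|%N)%:R).
    by rewrite /t -nn; field; rewrite !lt0r_neq0.
  by rewrite ler_pM2l ?mulr_gt0 ?invr_gt0// lerD2l lerN2.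
have cvt y : t y n @[n --> \oo] --> y.
  have h1 := @cvg_scaled_cdf y.
  (* Rounding moves the level by less than $1/n$, which $\sqrt n$ does not compensate. *)
  have h2 : rt n * ((`|Num.ceil (n%:R * p)|%N)%:R / n%:R - p) @[n --> \oo] --> (0 : R).
    apply/cvgr0Pnorm_le => e e0; near=> n.
    have n0 : (0 < n)%N by near: n; exact: nbhs_infty_gt.
    have [_ /andP[k1 k2]] := sample_quantile_index p01 n0.
    have r0 : 0 < rt n by rewrite sqrtr_gt0 ltr0n.
    have nn : (rt n) ^+ 2 = n%:R by rewrite sqr_sqrtr.
    have re : e^-1 <= rt n by near: n; exact: near_sqrt_ge.
    have -> : rt n * ((`|Num.ceil (n%:R * p)|%N)%:R / n%:R - p) =
       ((`|Num.ceil (n%:R * p)|%N)%:R - n%:R * p) / rt n.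
      by rewrite -[in LHS]nn -[in RHS]nn; field; rewrite lt0r_neq0.
    rewrite ger0_norm; last by rewrite divr_ge0 ?(ltW r0)// subr_ge0.
    rewrite ler_pdivrMr// (@le_trans _ _ 1)//; first by rewrite lerBlDl ltW.
    by rewrite mulrC -ler_pdivrMr// div1r.
  have -> : (fun n => t y n) = (fun n => f^-1 * (rt n * (F (q + y / rt n) - F q)) -
      f^-1 * (rt n * ((`|Num.ceil (n%:R * p)|%N)%:R / n%:R - p))).
    by apply/funext => n; rewrite /t Fq; ring.
  have e3 : f^-1 * (f * y) - f^-1 * 0 = y by rewrite mulr0 subr0 mulKf// lt0r_neq0.
  by rewrite -[X in _ --> X]e3; apply: cvgB; apply: cvgMr; [exact: h1|exact: h2].
apply: ghosh_criterion => //; first exact: OP_quantile_score.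
move=> y e dl e0 dl0.
have e4 : 0 < e / 4 by rewrite divr_gt0.
have [mD1 D1] := oP_increment y.
have /cvgrPdist_lt /(_ _ e4) t1 := cvt y.
have {}D1 := D1 _ _ e4 dl0.
near=> n.
have n0 : (0 < n)%N by near: n; exact: nbhs_infty_gt.
apply: (@le_trans _ _ (Pr P [set w | e / 4 < `|Dn y n w|])); last by near: n.
apply: le_Pr; [exact: measurable_straddle|exact: measurable_gt_norm|].
have ty : `|y - t y n| < e / 4 by near: n.
move: ty; rewrite ltr_norml => /andP[ty1 ty2].
(* [W] lies at distance at least [e] from [y] and the level within [e / 4], so [Dn] exceeds
   [3 * e / 4] in absolute value. *)
move=> w; rewrite /straddle /= ltNge !tV// -ltNge lter_normr => -[[h1 h2]|[h1 h2]].
  by apply/orP; right; lra.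
by apply/orP; left; lra.
Unshelve. all: end_near. Qed.

End bahadur.

(** * Central moments *)

Section power_expansion.
Context (R : realType).
Implicit Types (b h y dl eta : R).

(** Induction on [r]: the remainder is multiplied by $b + h$ and gains $r b^{r-1} h^2$. The
    coefficient $r^2$ works because $r^2 + r \le (r+1)^2$. *)
Lemma exprD_taylor1 b h r : 0 <= b -> `|h| <= 1 ->
  `|(b + h) ^+ r - b ^+ r - r%:R * b ^+ r.-1 * h| <=
  r%:R ^+ 2 * (1 + b) ^+ r * h ^+ 2.
Proof.
move=> b0 h1; elim: r => [|r IH].
  by rewrite !expr0 mul0r mul0r subrr subr0 normr0 expr0n !mul0r.
set t := _ - _ - _ in IH.
have -> : (b + h) ^+ r.+1 - b ^+ r.+1 - r.+1%:R * b ^+ r.+1.-1 * h =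
    (b + h) * t + r%:R * b ^+ r.-1 * h ^+ 2.
  rewrite /t -natr1 /=; case: r {IH t} => [|r] /=; first by rewrite !expr0 !expr1; ring.
  by rewrite !exprS; ring.
have b1 : 1 <= 1 + b by rewrite lerDl.
have bh : `|b + h| <= 1 + b.
  by rewrite (le_trans (ler_normD _ _))// ger0_norm// addrC lerD2r.
have h2 : 0 <= h ^+ 2 by rewrite sqr_ge0.
have br : b ^+ r.-1 <= (1 + b) ^+ r.+1.
  apply: (@le_trans _ _ ((1 + b) ^+ r.-1)); first by rewrite lerXn2r ?nnegrE ?lerDr ?addr_ge0.
  by apply: ler_weXn2l => //; case: r {IH t} => //= r; rewrite ltnW.
apply: (@le_trans _ _ ((1 + b) * (r%:R ^+ 2 * (1 + b) ^+ r * h ^+ 2) +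
    r%:R * (1 + b) ^+ r.+1 * h ^+ 2)).
  rewrite (le_trans (ler_normD _ _))// lerD//.
    by rewrite normrM ler_pM.
  have pos : 0 <= r%:R * b ^+ r.-1 by rewrite mulr_ge0// exprn_ge0.
  rewrite ger0_norm; last exact: mulr_ge0.
  by rewrite ler_wpM2r// ler_wpM2l.
have -> : (1 + b) * (r%:R ^+ 2 * (1 + b) ^+ r * h ^+ 2) +
    r%:R * (1 + b) ^+ r.+1 * h ^+ 2 = (r%:R ^+ 2 + r%:R) * ((1 + b) ^+ r.+1 * h ^+ 2).
  by rewrite (exprS (1 + b) r); ring.
rewrite -mulrA; apply: ler_wpM2r; first by rewrite mulr_ge0// exprn_ge0// addr_ge0.
rewrite -natr1; have : 0 <= r%:R :> R by []; nra.
Qed.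

(** If $|y| > |dl|$ the shift does not cross 0 and the expansion is exact; otherwise both parts are
    at most $|dl|$. *)
Lemma norm_shift y dl : `| `|y - dl| - `|y| + dl * Num.sg y| <=
  2 * `|dl| * ((`|y| <= `|dl|)%R)%:R.
Proof.
have [yd|yd] := leP `|y| `|dl|; last first.
  rewrite mulr0 normr_le0.
  have [y0|y0|y0] := ltgtP y 0; last by rewrite y0 normr0 ltNge normr_ge0 in yd.
    rewrite ltr0_sg// (ltr0_norm y0) ltr0_norm; first by apply/eqP; ring.
    by move: yd; rewrite (ltr0_norm y0) ltr_norml => /andP[]; lra.
  rewrite gtr0_sg// (gtr0_norm y0) gtr0_norm; first by apply/eqP; ring.
  by move: yd; rewrite (gtr0_norm y0) ltr_norml => /andP[]; lra.
rewrite mulr1 mulr_natl mulr2n (le_trans (ler_normD _ _))// lerD//.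
  rewrite (le_trans (ler_dist_dist _ _))//.
  by rewrite addrAC subrr add0r normrN.
by rewrite normrM ler_piMr// normr_sg; case: (_ != 0).
Qed.

(* Multiplied by [`|dl|], bounds the remainder of the expansion of
   [`|y - dl| ^+ r] for [`|dl| <= eta]; the indicator term is the kink at [0]. *)
Definition moment_gap (r : nat) eta y : R :=
  eta * (r%:R ^+ 2 * (1 + `|y|) ^+ r) +
  2 * r%:R * eta ^+ r.-1 * ((`|y| <= eta)%R)%:R.

Lemma moment_gap_ge0 r eta y : 0 <= eta -> 0 <= moment_gap r eta y.
Proof.
move=> e0; rewrite addr_ge0// ?mulr_ge0 ?exprn_ge0// ?mulr_ge0 ?exprn_ge0//.
Qed.

(** Taylor expansion of the power at $|y|$ with increment $h = |y - dl| - |y|$, followed by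
    replacing $h$ with $-dl\,\mathrm{sgn}(y)$, an error present only where $|y| \le |dl|$. *)
Lemma central_power_expansion r eta y dl : (0 < r)%N -> `|dl| <= eta -> eta <= 1 ->
  `| `|y - dl| ^+ r - `|y| ^+ r + r%:R * dl * (y ^+ r.-1 * Num.sg y ^+ r)| <=
  `|dl| * moment_gap r eta y.
Proof.
move=> r0 de e1.
have eta0 : 0 <= eta by rewrite (le_trans _ de).
set b := `|y|; set h := `|y - dl| - b.
have b0 : 0 <= b by exact: normr_ge0.
have hd : `|h| <= `|dl|.
  by rewrite /h (le_trans (ler_dist_dist _ _))// addrAC subrr add0r normrN.
(* This identifies the summand of [c_coef] as the derivative of $|y|^r$ divided by $r$, away from
   the kink. *)
have dE : y ^+ r.-1 * Num.sg y ^+ r = b ^+ r.-1 * Num.sg y.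
  by rewrite -(prednK r0) /= exprSr mulrA -exprMn /b normrEsg [Num.sg y * y]mulrC.
have -> : `|y - dl| = b + h by rewrite /h addrCA subrr addr0.
have -> : (b + h) ^+ r - b ^+ r + r%:R * dl * (y ^+ r.-1 * Num.sg y ^+ r) =
  ((b + h) ^+ r - b ^+ r - r%:R * b ^+ r.-1 * h) +
  r%:R * b ^+ r.-1 * (h + dl * Num.sg y) by rewrite dE; ring.
rewrite (le_trans (ler_normD _ _))// /moment_gap [leRHS]mulrDr lerD//.
  rewrite (le_trans (exprD_taylor1 r b0 (le_trans hd (le_trans de e1))))//.
  rewrite [leRHS]mulrA [leLHS]mulrC; apply: ler_wpM2r.
    by rewrite mulr_ge0 ?sqr_ge0// exprn_ge0// addr_ge0.
  rewrite -real_normK ?num_real// expr2; apply: ler_pM => //.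
  exact: le_trans hd de.
have ns := norm_shift y dl; rewrite -/b -/h in ns.
rewrite normrM ger0_norm ?mulr_ge0 ?exprn_ge0//.
apply: (le_trans (ler_wpM2l _ ns)); first by rewrite mulr_ge0 ?exprn_ge0.
have [bd|bd] := boolP (b <= `|dl|); last first.
  by rewrite !mulr0 mulr_ge0// mulr_ge0// mulr_ge0 ?exprn_ge0.
rewrite (le_trans bd de) !mulr1.
have -> : r%:R * b ^+ r.-1 * (2 * `|dl|) = `|dl| * (2 * r%:R * b ^+ r.-1) by ring.
rewrite ler_wpM2l// ler_wpM2l ?mulr_ge0//.
by rewrite lerXn2r ?nnegrE// (le_trans bd de).
Qed.

End power_expansion.

Section central_moments.
Context d (T : measurableType d) (R : realType) (P : probability T R)
  (X : nat -> {RV P >-> R}) (X0 : {RV P >-> R}) (r : nat).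
Hypothesis iidX : iid_with_parent X X0.
Hypothesis r0 : (0 < r)%N.
Hypothesis X1 : L1 P X0.
Hypothesis X2r : ('E_P[(fun w => X0 w ^+ (2 * r))%R] < +oo)%E.
Let mu : R := mean X0.
Hypothesis atom : r = 1%N -> {for mu, continuous (cdfR X0)}.
Let m : R := cmoment X0 r.
Let c : R := c_coef X0 r.
Let rt (n : nat) : R := Num.sqrt n%:R.
Let dpow (x : R) : R := (x - mu) ^+ r.-1 * Num.sg (x - mu) ^+ r.

Lemma measurable_centered : measurable_fun setT (fun x : R => x - mu).
Proof. exact: measurable_funB. Qed.

Lemma measurable_norm_centered : measurable_fun setT (fun x : R => `|x - mu|).
Proof. by apply: measurableT_comp => //; exact: measurable_centered. Qed.

(** From $(A + |X|)^{2r} \le 2^{2r}(A^{2r} + X^{2r})$ with $A = 1 + |\mu|$, the larger of the two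
    terms being doubled. *)
Lemma L2_envelope : L2 P (fun w => (1 + `|X0 w - mu|) ^+ r).
Proof.
have me : measurable_fun setT (fun x : R => (1 + `|x - mu|) ^+ r).
  by apply: measurable_funX; apply: measurable_funD => //; exact: measurable_norm_centered.
split; first exact: (mfun_RV _ me).
have L2r : L1 P (fun w => X0 w ^+ (2 * r)).
  apply/integrableP; split.
    by apply/measurable_EFinP; apply: measurable_funX.
  move: X2r; rewrite unlock; congr (_ < _)%E; apply: eq_integral => w _ /=.
  by rewrite ger0_norm// exprM exprn_ge0// sqr_ge0.
pose A : R := 1 + `|mu|.
have A1 : 1 <= A by rewrite lerDl.
apply: (L1_le _ (L1Z (2 ^+ (2 * r)) (L1D (L1_cst P (A ^+ (2 * r))) L2r))).
  exact/measurable_funX/(mfun_RV _ me).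
move=> w; rewrite -exprM mulnC.
have B0 : 0 <= 1 + `|X0 w - mu| by rewrite addr_ge0.
rewrite ger0_norm ?exprn_ge0//.
have AX : 1 + `|X0 w - mu| <= A + `|X0 w|.
  by rewrite /A -addrA lerD2l addrC ler_normB.
have e1 : X0 w ^+ (2 * r) = `|X0 w| ^+ (2 * r).
  by rewrite -normrX ger0_norm// exprM exprn_ge0// sqr_ge0.
have A0 : 0 <= A by rewrite (le_trans _ A1).
apply: (@le_trans _ _ ((A + `|X0 w|) ^+ (2 * r))).
  by rewrite lerXn2r ?nnegrE// addr_ge0.
rewrite e1 mulrDr -!exprMn.
have [XA|/ltW XA] := leP `|X0 w| A.
  rewrite (@le_trans _ _ ((2 * A) ^+ (2 * r)))//; last by rewrite lerDl exprn_ge0// mulr_ge0.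
  by rewrite lerXn2r ?nnegrE ?addr_ge0 ?mulr_ge0// mulr_natl mulr2n lerD2l.
rewrite (@le_trans _ _ ((2 * `|X0 w|) ^+ (2 * r)))//; last by rewrite lerDr exprn_ge0// mulr_ge0.
by rewrite lerXn2r ?nnegrE ?addr_ge0 ?mulr_ge0// mulr_natl mulr2n lerD2r.
Qed.

Lemma le_envelope (y : R) k : (k <= r)%N -> `|y| ^+ k <= (1 + `|y|) ^+ r.
Proof.
move=> kr; have y1 : 1 <= 1 + `|y| by rewrite lerDl.
apply: (@le_trans _ _ ((1 + `|y|) ^+ k)); last exact: ler_weXn2l.
by rewrite lerXn2r ?nnegrE ?lerDr ?addr_ge0.
Qed.

Lemma L2_dominated (f : R -> R) : measurable_fun setT f ->
  (forall x, `|f x| <= (1 + `|x - mu|) ^+ r) -> L2 P (fun w => f (X0 w)).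
Proof.
move=> mf fe; apply: (L2_le (mfun_RV _ mf) L2_envelope) => w.
by rewrite (le_trans (fe _))// ler_norm.
Qed.

Lemma measurable_abs_power : measurable_fun setT (fun x : R => `|x - mu| ^+ r).
Proof. by apply: measurable_funX; exact: measurable_norm_centered. Qed.

Lemma L2_abs_power : L2 P (fun w => `|X0 w - mu| ^+ r).
Proof.
apply: (L2_dominated measurable_abs_power) => x.
by rewrite normrX normr_id le_envelope.
Qed.

Lemma L2_centered : L2 P (fun w => X0 w - mu).
Proof.
apply: (L2_dominated measurable_centered) => x.
by rewrite -[X in X <= _]expr1 le_envelope.
Qed.

Lemma Er_centered : Er P (fun w => X0 w - mu) = 0.
Proof. by rewrite ErB// ?Er_cst ?subrr//; exact: L1_cst. Qed.

Lemma measurable_sg : measurable_fun setT (@Num.sg R).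
Proof.
rewrite (_ : (@Num.sg R) = (fun x => \1_[set y | 0 < y] x - \1_[set y | y < 0] x)).
  apply: measurable_funB; apply: measurable_indic.
    by rewrite -set_itvoy; exact: measurable_itv.
  by rewrite -set_itvNyo; exact: measurable_itv.
apply/funext => x; have indicb (b : pred R) : \1_[set y | b y] x = (b x)%:R :> R.
  by rewrite indicE; congr (nat_of_bool _)%:R; apply/idP/idP => [/set_mem|bx] //; exact/mem_set.
rewrite (indicb (fun y => 0 < y)) (indicb (fun y => y < 0)).
have [x0|x0|->] := ltgtP x 0.
- by rewrite ltr0_sg// sub0r.
- by rewrite gtr0_sg// subr0.
- by rewrite sgr0 subrr.
Qed.

Lemma measurable_dpow : measurable_fun setT dpow.
Proof.
apply: measurable_funM; apply: measurable_funX; first exact: measurable_centered.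
by apply: measurableT_comp; [exact: measurable_sg|exact: measurable_centered].
Qed.

Lemma norm_dpow x : `|dpow x| <= (1 + `|x - mu|) ^+ r.
Proof.
rewrite normrM !normrX normr_sg.
apply: (@le_trans _ _ (`|x - mu| ^+ r.-1)); last by rewrite le_envelope// leq_pred.
by rewrite ler_piMr// exprn_ile1//; case: (_ != 0).
Qed.

(** For $r \ge 2$ both terms are $O(\eta)$. For $r = 1$ the indicator has no small factor, and its
    mean $P(|X - \mu| \le \eta)$ is small by continuity of the distribution function at $\mu$. *)
Lemma moment_gap_small (e : R) : 0 < e -> exists eta, [/\ 0 < eta, eta <= 1 &
  Er P (fun w => moment_gap r eta (X0 w - mu)) <= e].
Proof.
move=> e0.
pose K : R := r%:R ^+ 2 * Er P (fun w => (1 + `|X0 w - mu|) ^+ r).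
have LE : L1 P (fun w => (1 + `|X0 w - mu|) ^+ r) by apply: L2_L1; exact: L2_envelope.
have mI (eta : R) : measurable_fun setT (fun x : R => ((`|x - mu| <= eta)%R)%:R : R).
  rewrite (_ : (fun x => _) = \1_[set x | `|x - mu| <= eta]).
    by apply: measurable_indic; apply: measurable_le_fun; exact: measurable_norm_centered.
  by apply/funext => x; rewrite indicE mem_setE.
have LI (eta : R) : L1 P (fun w => ((`|X0 w - mu| <= eta)%R)%:R).
  apply: (@L1_bounded _ _ _ _ _ 1); first exact: (mfun_RV _ (mI eta)).
  by move=> w; have [_|_] := boolP (`|X0 w - mu| <= eta); rewrite ?normr1 ?normr0.
pose p (eta : R) : R := Er P (fun w => ((`|X0 w - mu| <= eta)%R)%:R).
have K0 : 0 <= K.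
  by rewrite mulr_ge0 ?sqr_ge0//; apply: Er_ge0 => w; rewrite exprn_ge0// addr_ge0.
have EG (eta : R) : Er P (fun w => moment_gap r eta (X0 w - mu)) =
    eta * K + 2 * r%:R * eta ^+ r.-1 * p eta.
  rewrite /moment_gap ErD; [|exact/L1Z/L1Z|exact: L1Z].
  by rewrite !ErZ//; exact: L1Z.
have p1 eta : p eta <= 1.
  rewrite -(Er_cst P 1); apply: le_Er => //; first exact: L1_cst.
  by move=> w; case: (`|X0 w - mu| <= eta).
have p0 eta : 0 <= p eta by apply: Er_ge0.
have [r1|r1] := eqVneq r 1%N.
  have /cvgrPdist_lt /(_ (e / 8)) := atom r1.
  rewrite divr_gt0// => /(_ isT) /nbhs_ballP[a /= a0 Ha].
  (* [a / 4] keeps [mu + eta] and [mu - 2 * eta] in the ball of continuity; the last entry makes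
     [eta * K] at most [e / 2]. *)
  pose eta := Num.min 1 (Num.min (a / 4) (e / (2 * (K + 1)))).
  have K1 : 0 < 2 * (K + 1) by rewrite mulr_gt0// ltr_wpDl.
  have eta0 : 0 < eta by rewrite !lt_min ltr01 !divr_gt0.
  have eta1 : eta <= 1 by rewrite ge_min lexx.
  have etaa : eta <= a / 4 by rewrite !ge_min lexx /= !orbT.
  have etaK : eta * K <= e / 2.
    have : eta <= e / (2 * (K + 1)) by rewrite !ge_min lexx !orbT.
    rewrite ler_pdivlMr//; lra.
  exists eta; split=> //; rewrite EG r1 expr0 !mulr1.
  have pe : p eta <= e / 4.
    (* A difference of distribution functions measures a half-open interval; starting at
       [mu - 2 * eta] includes the endpoint [mu - eta]. *)
    have h1 : p eta <= cdfR X0 (mu + eta) - cdfR X0 (mu - 2 * eta).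
      rewrite !cdfRE -ErB; [|exact: L1_le_ind|exact: L1_le_ind].
      apply: le_Er => //; first by apply: L1B; exact: L1_le_ind.
      move=> w; have := le_ind_homo (X0 w) (_ : mu - 2 * eta <= mu + eta).
      rewrite /le_ind; have [h|h] := boolP (`|X0 w - mu| <= eta).
        move: h; rewrite ler_norml => /andP[h1 h2] _.
        rewrite (_ : (X0 w <= mu + eta) = true); last by lra.
        by rewrite (_ : (X0 w <= mu - 2 * eta) = false) ?subr0//; apply/negbTE; rewrite -ltNge; lra.
      by rewrite subr_ge0; apply; lra.
    have h2 := Ha (mu + eta); have h3 := Ha (mu - 2 * eta).
    rewrite /ball /= opprD addrA subrr add0r normrN (gtr0_norm eta0) in h2.
    rewrite /ball /= opprB addrC subrK gtr0_norm ?mulr_gt0// in h3.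
    have {}h2 : `|cdfR X0 mu - cdfR X0 (mu + eta)| < e / 8 by apply: h2; lra.
    have {}h3 : `|cdfR X0 mu - cdfR X0 (mu - 2 * eta)| < e / 8 by apply: h3; lra.
    move: h2 h3; rewrite !ltr_norml => /andP[? ?] /andP[? ?]; lra.
  lra.
pose K1 : R := 2 * (K + 2 * r%:R + 1).
have K10 : 0 < K1.
  by rewrite mulr_gt0// ltr_wpDl// addr_ge0// mulr_ge0.
pose eta := Num.min 1 (e / K1).
have eta0 : 0 < eta by rewrite !lt_min ltr01 !divr_gt0.
have eta1 : eta <= 1 by rewrite ge_min lexx.
have etaK : eta * K1 <= e by rewrite -ler_pdivlMr// !ge_min lexx orbT.
exists eta; split=> //; rewrite EG.
have er : eta ^+ r.-1 <= eta.
  case: r r0 r1 => [//|[//|k]] _ _ /=; rewrite exprS ler_piMr ?(ltW eta0)//.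
  by rewrite exprn_ile1// ltW.
have h : 2 * r%:R * eta ^+ r.-1 * p eta <= 2 * r%:R * eta.
  apply: (@le_trans _ _ (2 * r%:R * eta ^+ r.-1)).
    by rewrite ler_piMr// mulr_ge0 ?mulr_ge0// exprn_ge0// ltW.
  by rewrite ler_wpM2l// mulr_ge0.
rewrite (le_trans (lerD (lexx _) h))// (le_trans _ etaK)//.
rewrite /K1; have : 0 <= r%:R :> R by []; nra.
Qed.

Let dmean (n : nat) (w : T) : R := sample_mean (fun i => X i) n w - mu.
Let rem (n : nat) (w : T) : R := rt n * (n%:R^-1 * \sum_(i < n)
  (`|X i w - mu - dmean n w| ^+ r - `|X i w - mu| ^+ r +
   r%:R * dmean n w * dpow (X i w))).

Lemma measurable_sample_mean n : measurable_fun setT (sample_mean (fun i => X i) n).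
Proof. by apply: measurable_funM => //; apply: measurable_sum. Qed.

Lemma measurable_sample_cmoment n :
  measurable_fun setT (sample_cmoment (fun i => X i) n r).
Proof.
apply: measurable_funM => //; apply: measurable_sum => i.
apply: measurable_funX; apply: measurableT_comp => //.
by apply: measurable_funB => //; exact: measurable_sample_mean.
Qed.

Lemma sample_mean_centered n w : (0 < n)%N ->
  dmean n w = n%:R^-1 * \sum_(i < n) (X i w - mu).
Proof.
move=> n0; have n1 : n%:R != 0 :> R by rewrite pnatr_eq0 -lt0n.
rewrite /dmean /sample_mean sumrB sumr_const card_ord -[mu *+ n]mulr_natl mulrBr.
by rewrite mulKf.
Qed.

(** True also for [n = 0], where both sides are 0. *)
Lemma sample_mean_scaled n w :
  rt n * dmean n w = (rt n)^-1 * \sum_(i < n) (X i w - mu).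
Proof.
case: n => [|n]; first by rewrite /rt sqrtr0 mul0r invr0 mul0r.
rewrite sample_mean_centered// mulrA; congr (_ * _).
have r1 : 0 < rt n.+1 by rewrite sqrtr_gt0.
have <- : rt n.+1 ^+ 2 = n.+1%:R by rewrite sqr_sqrtr.
by field; rewrite lt0r_neq0.
Qed.

Lemma OP_sample_mean : OP P (fun n w => rt n * dmean n w).
Proof.
apply: OP_ext (OP_iid_sum iidX measurable_centered L2_centered Er_centered) => n w.
by rewrite sample_mean_scaled.
Qed.

Lemma measurable_rem n : measurable_fun setT (rem n).
Proof.
have md : measurable_fun setT (dmean n).
  by apply: measurable_funB => //; exact: measurable_sample_mean.
have mc i : measurable_fun setT (fun w => X i w - mu) by exact: measurable_funB.
apply: measurable_funM => //; apply: measurable_funM => //.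
apply: measurable_sum => i; apply: measurable_funD; first apply: measurable_funB.
- apply: measurable_funX; apply: measurableT_comp => //.
  exact: measurable_funB.
- by apply: measurable_funX; exact: measurableT_comp.
- apply: measurable_funM; first exact: measurable_funM.
  exact: (mfun_RV _ measurable_dpow).
Qed.

Lemma measurable_moment_gap eta :
  measurable_fun setT (fun x : R => moment_gap r eta (x - mu)).
Proof.
apply: measurable_funD; apply: measurable_funM => //.
  apply: measurable_funM => //; apply: measurable_funX; apply: measurable_funD => //.
  exact: measurable_norm_centered.
rewrite (_ : (fun x => _) = \1_[set x : R | `|x - mu| <= eta]).
  by apply: measurable_indic; apply: measurable_le_fun; exact: measurable_norm_centered.
by apply/funext => x; rewrite indicE mem_setE.
Qed.

Lemma L1_moment_gap eta : L1 P (fun w => moment_gap r eta (X0 w - mu)).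
Proof.
have LE := L2_L1 L2_envelope.
apply: (L1_le (mfun_RV _ (measurable_moment_gap eta))
  (L1D (L1Z (`|eta| * r%:R ^+ 2) LE) (L1_cst P (2 * r%:R * `|eta| ^+ r.-1)))) => w.
rewrite /moment_gap (le_trans (ler_normD _ _))// lerD//.
  by rewrite normrM -[leRHS]mulrA ler_wpM2l// ger0_norm//.
rewrite normrM normrM normrX (@ger0_norm _ (2 * r%:R)) ?mulr_ge0//.
by have [_|_] := boolP (`|X0 w - mu| <= eta);
  rewrite ?normr1 ?normr0 ?mulr1 ?mulr0// mulr_ge0// exprn_ge0.
Qed.

(** Summing the pointwise expansion bounds the remainder by $\sqrt n |d|$ times the average of
    [moment_gap]. The first factor is tight, the second is small by Markov's inequality. *)
Lemma oP_rem : oP P rem.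
Proof.
split=> [n|e dl e0 dl0]; first exact: measurable_rem.
have [mO O] := OP_sample_mean.
have d2 : 0 < dl / 2 by rewrite divr_gt0.
have [L L0 {}O] := O _ d2.
have eL : 0 < e / L by rewrite divr_gt0.
(* The mean allowed to the gap, so that Markov's inequality at level [e / L] gives probability
   [dl / 2]. *)
have edl : 0 < e / L * (dl / 2) by rewrite mulr_gt0.
have [eta [eta0 eta1 Ge]] := moment_gap_small edl.
pose A (n : nat) (w : T) : R := n%:R^-1 * \sum_(i < n) moment_gap r eta (X i w - mu).
have mgap := measurable_moment_gap eta.
have LG := L1_moment_gap eta.
have LGi i := L1_iid iidX i mgap LG.
have A0 n w : 0 <= A n w.
  by rewrite mulr_ge0 ?invr_ge0//; apply: sumr_ge0 => i _; apply: moment_gap_ge0; exact: ltW.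
have LA n : L1 P (A n) by apply: L1Z; exact: L1_sum.
have pA n : Pr P [set w | e / L < `|A n w|] <= dl / 2.
  rewrite (le_trans (markov_Er eL (LA n)))// ler_pdivrMr// mulrC (le_trans _ Ge)//.
  rewrite (eq_Er P (fun w => ger0_norm (A0 n w))).
  rewrite /A ErZ; last exact: L1_sum.
  rewrite Er_sum//; under eq_bigr do rewrite (Er_iid iidX _ mgap LG).
  rewrite sumr_const card_ord -[X in _ * X](mulr_natl _ n) mulrA.
  have [->|n0] := eqVneq (n%:R : R) 0; last by rewrite mulVf// mul1r.
  rewrite mulr0 mul0r; apply: Er_ge0 => w; apply: moment_gap_ge0; exact: ltW.
near=> n.
have n0 : (0 < n)%N by near: n; exact: nbhs_infty_gt.
have n1 : 0 < n%:R :> R by rewrite ltr0n.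
have r1 : 0 < rt n by rewrite sqrtr_gt0.
have Ln : L / eta <= rt n by near: n; exact: near_sqrt_ge.
rewrite [leRHS](splitr dl).
apply: (@le_trans _ _ (Pr P [set w | L < `|rt n * dmean n w|] +
                       Pr P [set w | e / L < `|A n w|])); last first.
  by apply: lerD; [near: n|exact: pA].
apply: Pr_norm_setU => //; [exact: L1_mfun|exact: measurable_rem|].
move=> w dL AL.
have de : `|dmean n w| <= eta.
  move: dL; rewrite normrM (gtr0_norm r1) => dL.
  rewrite -(ler_pM2l r1) (le_trans dL)//.
  by rewrite -ler_pdivrMr.
rewrite /rem normrM (gtr0_norm r1) normrM gtr0_norm ?invr_gt0//.
have sb : `|\sum_(i < n) (`|X i w - mu - dmean n w| ^+ r - `|X i w - mu| ^+ r +
   r%:R * dmean n w * dpow (X i w))| <= `|dmean n w| * \sum_(i < n) moment_gap r eta (X i w - mu).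
  rewrite mulr_sumr (le_trans (ler_norm_sum _ _ _))//; apply: ler_sum => i _.
  exact: central_power_expansion.
apply: (@le_trans _ _ (rt n * (n%:R^-1 * (`|dmean n w| *
    \sum_(i < n) moment_gap r eta (X i w - mu))))).
  by rewrite ler_pM2l// ler_pM2l ?invr_gt0.
have -> : rt n * (n%:R^-1 * (`|dmean n w| *
    \sum_(i < n) moment_gap r eta (X i w - mu))) = `|rt n * dmean n w| * A n w.
  by rewrite normrM (gtr0_norm r1) /A; ring.
rewrite -(ger0_norm (A0 n w)) -[leRHS](divfK (lt0r_neq0 L0)) mulrC.
exact: ler_pM.
Unshelve. all: end_near. Qed.

(** After the expansion, $\sqrt n\,d$ is multiplied by the empirical mean of [dpow]. Replacing that
    mean by its limit [c] costs $o_P(1)$ times a tight factor. *)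
Lemma sample_cmoment_linearization :
  oP P (fun n w => rt n * (sample_cmoment (fun i => X i) n r w - m) -
    (rt n)^-1 * \sum_(i < n) (`|X i w - mu| ^+ r - m - r%:R * c * (X i w - mu))).
Proof.
have md : measurable_fun setT (fun x => dpow x - c).
  by apply: measurable_funB => //; exact: measurable_dpow.
have Ld : L2 P (fun w => dpow (X0 w)).
  exact: (L2_dominated measurable_dpow norm_dpow).
have d2 : L2 P (fun w => dpow (X0 w) - c) by apply: L2B => //; exact: L2_cst.
have d0 : Er P (fun w => dpow (X0 w) - c) = 0.
  by rewrite ErB ?Er_cst ?subrr//; [exact: L2_L1|exact: L1_cst].
have o1 := oPZ r%:R (oPM (oP_iid_mean iidX md d2 d0) OP_sample_mean).
apply: oP_ext (oPB oP_rem o1) => n w.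
case: n => [|n]; first by rewrite /rem /rt sqrtr0 !mul0r invr0 !mul0r !mulr0 subrr.
have r1 : 0 < rt n.+1 by rewrite sqrtr_gt0.
have nn : rt n.+1 ^+ 2 = n.+1%:R by rewrite sqr_sqrtr.
have n1 : (n.+1%:R : R) * m = \sum_(i < n.+1) m.
  by rewrite sumr_const card_ord -[RHS]mulr_natl.
have n2 : (n.+1%:R : R) * c = \sum_(i < n.+1) c.
  by rewrite sumr_const card_ord -[RHS]mulr_natl.
have n0 : n.+1%:R != 0 :> R by [].
rewrite /rem /sample_cmoment.
have -> : \sum_(i < n.+1) (dpow (X i w) - c) = \sum_(i < n.+1) dpow (X i w) - n.+1%:R * c.
  by rewrite sumrB n2.
have -> : \sum_(i < n.+1) (`|X i w - mu - dmean n.+1 w| ^+ r - `|X i w - mu| ^+ r +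
   r%:R * dmean n.+1 w * dpow (X i w)) =
   \sum_(i < n.+1) `|X i w - sample_mean (fun i => X i) n.+1 w| ^+ r -
   \sum_(i < n.+1) `|X i w - mu| ^+ r + r%:R * dmean n.+1 w * \sum_(i < n.+1) dpow (X i w).
  rewrite mulr_sumr -sumrB -big_split /=; apply: eq_bigr => i _.
  have -> : X i w - mu - dmean n.+1 w = X i w - sample_mean (fun i => X i) n.+1 w.
    by rewrite /dmean; ring.
  by [].
have -> : \sum_(i < n.+1) (`|X i w - mu| ^+ r - m - r%:R * c * (X i w - mu)) =
   \sum_(i < n.+1) `|X i w - mu| ^+ r - n.+1%:R * m - r%:R * c * (n.+1%:R * dmean n.+1 w).
  rewrite n1 sample_mean_centered// mulVKf// mulr_sumr -!sumrB.
  by apply: eq_bigr.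
move: (\sum_(i < n.+1) `|X i w - mu| ^+ r) (\sum_(i < n.+1) dpow _) => s1 s2.
move: (\sum_(i < n.+1) _) (dmean n.+1 w) => s3 s4.
by rewrite -nn; field; rewrite lt0r_neq0.
Qed.

End central_moments.

(** * The joint limit *)

Lemma cos_lipschitz (R : realType) (x y : R) : `|cos x - cos y| <= `|x - y|.
Proof.
have key (u v : R) : `|cos (u + v) - cos (u - v)| <= `|u + v - (u - v)|.
  have -> : cos (u + v) - cos (u - v) = - (2 * (sin u * sin v)).
    by rewrite cosB cosD; ring.
  have -> : u + v - (u - v) = 2 * v by ring.
  rewrite normrN !normrM ler_wpM2l// (le_trans _ (norm_sin_le v))//.
  by rewrite ler_piMl// sin_max.
have := key ((x + y) / 2) ((x - y) / 2).
have -> : (x + y) / 2 + (x - y) / 2 = x by field.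
by have -> : (x + y) / 2 - (x - y) / 2 = y by field.
Qed.

Section slutsky.
Context d (T : measurableType d) (R : realType) (P : probability T R).

(** Slutsky's lemma for cosines: the Lipschitz bound on the event of small difference and the bound
    2 elsewhere, adding up to $e/3 + 2 e/6 + e/3$. *)
Lemma cvg_Er_cos_oP (U U' : nat -> T -> R) (l : R) :
  (forall n, measurable_fun setT (U n)) -> (forall n, measurable_fun setT (U' n)) ->
  oP P (fun n w => U n w - U' n w) ->
  Er P (fun w => cos (U' n w)) @[n --> \oo] --> l ->
  Er P (fun w => cos (U n w)) @[n --> \oo] --> l.
Proof.
move=> mU mU' [mD o] cv; apply/cvgrPdist_le => e e0.
have e3 : 0 < e / 3 by rewrite divr_gt0.
have e6 : 0 < e / 6 by rewrite divr_gt0.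
have {}o := o _ _ e3 e6; move/cvgrPdist_le : cv => /(_ _ e3) cv.
near=> n.
have Lc (Z : T -> R) : measurable_fun setT Z -> L1 P (fun w => cos (Z w)).
  move=> mZ; apply: (@L1_bounded _ _ _ _ _ 1); last by move=> w; exact: cos_max.
  by apply: measurableT_comp => //; exact: measurable_cos_fun.
pose A := [set w | e / 3 < `|U n w - U' n w|].
have mA : measurable A by exact: measurable_gt_norm.
have h1 : `|Er P (fun w => cos (U n w)) - Er P (fun w => cos (U' n w))| <= e / 3 + 2 * Pr P A.
  rewrite -ErB; [|exact: Lc|exact: Lc].
  apply: le_trans (le_norm_Er _) _; first by apply: L1B; exact: Lc.
  rewrite Pr_indic// -ErZ; last exact: L1_indic.
  rewrite -[X in _ <= X + _](Er_cst P) -ErD; [|exact: L1_cst|exact/L1Z/L1_indic].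
  apply: le_Er; [by apply/L1_norm/L1B; exact: Lc| |].
    by apply: L1D; [exact: L1_cst|exact/L1Z/L1_indic].
  move=> w; rewrite indicE; have [wA|wA] := boolP (w \in A).
    rewrite mulr1 -[leLHS]add0r lerD ?(ltW e3)//.
    by rewrite mulr2n (le_trans (ler_normB _ _))// lerD// cos_max.
  rewrite mulr0 addr0 (le_trans (cos_lipschitz _ _))// leNgt.
  by apply: contraNN wA => ?; apply/mem_set.
have h2 : Pr P A <= e / 6 by rewrite /A; near: n; exact: o.
have h3 : `|l - Er P (fun w => cos (U' n w))| <= e / 3 by near: n.
move: h1 h3; rewrite !ler_norml => /andP[? ?] /andP[? ?]; apply/andP; split; lra.
Unshelve. all: end_near. Qed.

End slutsky.

Section bivariate_clt.
Context d (T : measurableType d) (R : realType) (P : probability T R)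
  (X : nat -> {RV P >-> R}) (X0 : {RV P >-> R}).
Hypothesis iidX : iid_with_parent X X0.

(** Cholesky factorisation, lower triangular. When [s11 = 0] the determinant condition forces
    [s12 = 0]. *)
Lemma psd_factor (s11 s12 s22 : R) : 0 <= s11 -> 0 <= s22 -> s12 ^+ 2 <= s11 * s22 ->
  exists a11 a12 a21 a22 : R, [/\ a11 ^+ 2 + a12 ^+ 2 = s11,
    a11 * a21 + a12 * a22 = s12 & a21 ^+ 2 + a22 ^+ 2 = s22].
Proof.
move=> h1 h2 h12; have [s0|s0] := eqVneq s11 0.
  have e12 : s12 = 0.
    by apply/eqP; rewrite -sqrf_eq0 eq_le sqr_ge0 andbT (le_trans h12)// s0 mul0r.
  exists 0, 0, (Num.sqrt s22), 0.
  by rewrite s0 e12 sqr_sqrtr// expr0n /= !mul0r !addr0.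
have s1 : 0 < s11 by rewrite lt_def s0.
have h3 : 0 <= s22 - s12 ^+ 2 / s11 by rewrite subr_ge0 ler_pdivrMr// mulrC.
exists (Num.sqrt s11), 0, (s12 / Num.sqrt s11), (Num.sqrt (s22 - s12 ^+ 2 / s11)).
rewrite expr0n /= addr0 mul0r addr0 expr_div_n !sqr_sqrtr//; split=> //.
  by rewrite mulrC divfK// sqrtr_eq0 -ltNge.
by rewrite addrC subrK.
Qed.

(** Cauchy-Schwarz and the Cholesky factor supply the matrix [A]. What remains for the continuity
    theorem are the cosines of linear combinations of [Y1] and [Y2]. *)
Theorem clt_linearized2 (a b : R -> R) (Y1 Y2 : nat -> T -> R) (s11 s12 s22 : R) :
  measurable_fun setT a -> measurable_fun setT b ->
  L2 P (fun w => a (X0 w)) -> L2 P (fun w => b (X0 w)) ->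
  Er P (fun w => a (X0 w)) = 0 -> Er P (fun w => b (X0 w)) = 0 ->
  Er P (fun w => a (X0 w) ^+ 2) = s11 ->
  Er P (fun w => a (X0 w) * b (X0 w)) = s12 ->
  Er P (fun w => b (X0 w) ^+ 2) = s22 ->
  (forall n, measurable_fun setT (Y1 n)) -> (forall n, measurable_fun setT (Y2 n)) ->
  oP P (fun n w => Y1 n w - (Num.sqrt n%:R)^-1 * \sum_(i < n) a (X i w)) ->
  oP P (fun n w => Y2 n w - (Num.sqrt n%:R)^-1 * \sum_(i < n) b (X i w)) ->
  cvg_in_law_normal2 P Y1 Y2 s11 s12 s22.
Proof.
move=> ma mb a2 b2 a0 b0 e11 e12 e22 mY1 mY2 o1 o2.
have p11 : 0 <= s11 by rewrite -e11; apply: Er_ge0 => w; exact: sqr_ge0.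
have p22 : 0 <= s22 by rewrite -e22; apply: Er_ge0 => w; exact: sqr_ge0.
have p12 : s12 ^+ 2 <= s11 * s22 by rewrite -e11 -e12 -e22; exact: Er_CauchySchwarz.
have [a11 [a12 [a21 [a22 [f11 f12 f22]]]]] := psd_factor p11 p22 p12.
exists a11, a12, a21, a22; split=> // g cg [M gM].
rewrite (gauss2_expectE _ _ _ _ cg gM).
have OA := OP_iid_sum iidX ma a2 a0; have OB := OP_iid_sum iidX mb b2 b0.
have O1 : OP P Y1.
  by apply: OP_ext (OPD (oP_OP o1) OA) => n w; rewrite subrK.
have O2 : OP P Y2.
  by apply: OP_ext (OPD (oP_OP o2) OB) => n w; rewrite subrK.
apply: (levy_continuity2 O1 O2 _ _ _ cg gM).
- exact: measurable_std_gauss2_linear.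
- exact: measurable_std_gauss2_linear.
move=> th s t.
(* The Cramer-Wold reduction: up to $o_P(1)$, [s * Y1 + t * Y2] is the normalized sum of this single
   score, with variance the quadratic form of the covariance matrix. *)
pose k x : R := s * a x + t * b x.
have mk : measurable_fun setT k by apply: measurable_funD; exact: measurable_funM.
have k2 : L2 P (fun w => k (X0 w)) by apply: L2D; exact: L2Z.
have k0 : Er P (fun w => k (X0 w)) = 0.
  by rewrite ErD ?ErZ ?a0 ?b0 ?mulr0 ?addr0//; try apply: L1Z; exact: L2_L1.
have kE : Er P (fun w => k (X0 w) ^+ 2) =
    s ^+ 2 * s11 + (2 * s * t) * s12 + t ^+ 2 * s22.
  rewrite (@eq_Er _ _ _ _ _ (fun w => (s ^+ 2 * a (X0 w) ^+ 2 +
     (2 * s * t) * (a (X0 w) * b (X0 w))) + t ^+ 2 * b (X0 w) ^+ 2)); last first.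
    by move=> w; rewrite /k; ring.
  have La := L1Z (s ^+ 2) a2.2; have Lb := L1Z (t ^+ 2) b2.2.
  have Lab := L1Z (2 * s * t) (L2M a2 b2).
  rewrite ErD//; last exact: L1D.
  by rewrite ErD// !ErZ ?e11 ?e12 ?e22//; [exact: b2.2|exact: L2M|exact: a2.2].
have gE : Er (std_gauss2 R) (fun z => cos (th + (s * (a11 * z.1 + a12 * z.2) +
    t * (a21 * z.1 + a22 * z.2)))) =
    cos th * expR (- (Er P (fun w => k (X0 w) ^+ 2) / 2)).
  transitivity (Er (std_gauss2 R) (fun z => cos (th + ((s * a11 + t * a21) * z.1 +
     (s * a12 + t * a22) * z.2)))).
    by apply: eq_Er => z; congr cos; ring.
  rewrite (Er_std_gauss2_cos th (s * a11 + t * a21) (s * a12 + t * a22)).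
  suff -> : (s * a11 + t * a21) ^+ 2 + (s * a12 + t * a22) ^+ 2 =
      Er P (fun w => k (X0 w) ^+ 2) by [].
  by rewrite kE -f11 -f12 -f22; ring.
rewrite [X in _ --> X]gE.
have cv := @cvg_Er_cos_iid_sum _ _ _ _ _ _ iidX k mk k2 k0 th.
apply: (@cvg_Er_cos_oP _ _ _ P (fun n w => th + (s * Y1 n w + t * Y2 n w)) _ _ _ _ _ cv).
- move=> n; apply: measurable_funD => //.
  by apply: measurable_funD; exact: measurable_funM.
- move=> n; apply: measurable_funD => //; apply: measurable_funM => //.
  by apply: measurable_sum => i; exact: (mfun_RV _ mk).
apply: oP_ext (oPD (oPZ s o1) (oPZ t o2)) => n w.
rewrite /k big_split /= -!mulr_sumr; ring.
Qed.

End bivariate_clt.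

(** * Identification of the asymptotic covariance *)

Section asymptotic_covariance.
Context d (T : measurableType d) (R : realType) (P : probability T R)
  (X0 : {RV P >-> R}) (p : R) (r : nat).
Let F : R -> R := cdfR X0.
Let q : R := quantile X0 p.
Let mu : R := mean X0.
Let m : R := cmoment X0 r.
Let c : R := c_coef X0 r.
Hypothesis Fq : F q = p.
Hypothesis X1 : L1 P X0.
Hypothesis Xr : L2 P (fun w => `|X0 w - mu| ^+ r).
Hypothesis Xc : L2 P (fun w => X0 w - mu).

Let a (x : R) : R := F q - le_ind q x.
Let b (x : R) : R := `|x - mu| ^+ r - m - r%:R * c * (x - mu).

Lemma Er_quantile_score_sqr : Er P (fun w => a (X0 w) ^+ 2) = p * (1 - p).
Proof.
have LI := L1_le_ind X0 q.
rewrite (@eq_Er _ _ _ _ _ (fun w => p ^+ 2 + (1 - 2 * p) * le_ind q (X0 w))).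
  rewrite ErD; [|exact: L1_cst|exact: L1Z].
  by rewrite Er_cst ErZ// -cdfRE -/F Fq; ring.
move=> w; rewrite /a Fq /le_ind.
by have [_|_] := boolP (X0 w <= q); rewrite /= ?mulr1n ?mulr0n; ring.
Qed.

Lemma L2_moment_score : L2 P (fun w => b (X0 w)).
Proof. by apply: L2B; [apply: L2B => //; exact: L2_cst|exact: L2Z]. Qed.

Lemma Er_moment_score : Er P (fun w => b (X0 w)) = 0.
Proof.
have L1r := L2_L1 Xr; have L1c := L2_L1 Xc.
rewrite ErB; [|by apply: L1B => //; exact: L1_cst|exact: L1Z].
rewrite ErB//; last exact: L1_cst.
rewrite Er_cst ErZ// (_ : Er P (fun w => X0 w - mu) = 0) ?mulr0 ?subr0 ?subrr//.
by rewrite ErB// ?Er_cst ?subrr//; exact: L1_cst.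
Qed.

Lemma Er_moment_score_sqr : Er P (fun w => b (X0 w) ^+ 2) = var_term X0 r.
Proof.
pose U w : R := `|X0 w - mu| ^+ r - r%:R * c * (X0 w - mu).
have L1r := L2_L1 Xr; have L1c := L2_L1 Xc.
have EU : Er P U = m.
  rewrite ErB//; last exact: L1Z.
  rewrite ErZ// (_ : Er P (fun w => X0 w - mu) = 0) ?mulr0 ?subr0//.
  by rewrite ErB// ?Er_cst ?subrr//; exact: L1_cst.
rewrite /var_term /variance covariance.unlock -[RHS]/(Er P _).
apply: eq_Er => w /=; rewrite -[fine _]/(Er P U) EU /b /U expr2.
rewrite !fctE /=. by rewrite -/mu -/c; ring.
Qed.

(** The factor $1 - p$ is the probability of $X > q$ and cancels the conditioning. What is left is
    $E[(1_{X>q} - (1-p))\,\eta^k(X)]$, and $1_{X>q} - (1-p) = p - 1_{X \le q}$. *)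
Lemma tau_covariance (eta : R -> R) k : p < 1 ->
  measurable_fun setT (fun w => eta (X0 w)) ->
  L2 P (fun w => eta (X0 w) ^+ k) ->
  tau X0 eta k p = Er P (fun w => a (X0 w) * eta (X0 w) ^+ k).
Proof.
move=> p1 meta [me e2]; have Le := L2_L1 (conj me e2).
rewrite /tau /condE -/q; set A := [set w | q < X0 w].
have mA : measurable A.
  rewrite (_ : A = ~` [set w | X0 w <= q]); first exact/measurableC/measurable_le_fun.
  by apply/seteqP; split => w; rewrite /A /= ltNge => /negP.
have Aind w : \1_A w = 1 - le_ind q (X0 w) :> R.
  rewrite indicE /le_ind; have [h|h] := boolP (X0 w <= q).
    by rewrite memNset /= ?subrr// /A /= ltNge h.
  by rewrite mem_set /= ?subr0// /A /= ltNge.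
have PA : fine (P A) = 1 - p.
  rewrite -[LHS]/(Pr P A) Pr_indic// (eq_Er _ Aind) ErB; [|exact: L1_cst|exact: L1_le_ind].
  by rewrite Er_cst -cdfRE -/F Fq.
have p10 : 1 - p != 0 by rewrite subr_eq0 eq_sym lt_eqF.
have LeA : L1 P (fun w => eta (X0 w) ^+ k * \1_A w).
  apply: (L1_le _ (L1_norm Le)).
    by apply: measurable_funM => //; exact: measurable_indic.
  by move=> w; rewrite normrM ler_piMr// norm_indic_le1.
rewrite PA mulrBr mulrCA divff// mulr1 -ErZ// -ErB//; last exact: L1Z.
by apply: eq_Er => w; rewrite Aind /a Fq; ring.
Qed.

Lemma Er_score_product : p < 1 ->
  Er P (fun w => a (X0 w) * b (X0 w)) =
  tau X0 (fun x => `|x - mu|) r p - r%:R * c * tau X0 id 1 p.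
Proof.
move=> p1; have mX0 : measurable_fun setT (X0 : T -> R) by [].
have mY : measurable_fun setT (fun w => `|X0 w - mu|).
  by apply: measurableT_comp => //; exact: measurable_funB.
have X2 : L2 P X0.
  have -> : (X0 : T -> R) = (fun w => (X0 w - mu) + mu) by apply/funext => w; rewrite subrK.
  by apply: L2D => //; exact: L2_cst.
have ma : measurable_fun setT (fun w => a (X0 w)).
  by apply: measurable_funB => //; apply: measurableT_comp => //; exact: measurable_le_ind.
have a2 : L2 P (fun w => a (X0 w)).
  apply: (@L2_bounded _ _ _ _ _ (`|F q| + 1)) => // w.
  by rewrite (le_trans (ler_normB _ _))// lerD// le_ind_le1.
have a0 : Er P (fun w => a (X0 w)) = 0.
  by rewrite ErB ?Er_cst -?cdfRE ?subrr//; [exact: L1_cst|exact: L1_le_ind].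
rewrite (@tau_covariance (fun x => `|x - mu|) r p1 mY Xr) (@tau_covariance id 1 p1 mX0 X2).
have L1a := L2M a2 Xr; have L1b := L2M a2 X2; have L1c := L2_L1 a2.
rewrite -ErZ// -ErB//; last exact: L1Z.
(* The constant part $r c \mu - m$ of the moment score is removed at no cost, the quantile score
   having mean 0. *)
rewrite -[LHS]subr0 -(mulr0 (r%:R * c * mu - m)) -a0 -ErZ//.
rewrite -ErB//; [|exact: L2M a2 L2_moment_score|exact: L1Z].
by apply: eq_Er => w; rewrite /b expr1; ring.
Qed.

End asymptotic_covariance.

Lemma sgr_div_norm (R : realFieldType) (x : R) : x != 0 -> x / `|x| = Num.sg x.
Proof. by move=> x0; rewrite {1}[x]numEsg mulfK// normr_eq0. Qed.

Theorem theorem4 (d : measure_display) (T : measurableType d) (R : realType)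
  (P : probability T R) (X : nat -> {RV P >-> R}) (X0 : {RV P >-> R})
  (p : R) (r : nat) (h1 h2 : R -> R) :
  let F := cdfR X0 in
  let q := quantile X0 p in
  let mu := mean X0 in
  let m := cmoment X0 r in
  let f_q := derive1 F q in
  let c := c_coef X0 r in
  let V := var_term X0 r in
  let S11 := p * (1 - p) / f_q ^+ 2 * (derive1 h1 q) ^+ 2 in
  let S22 := (derive1 h2 m) ^+ 2 * V in
  let S12 := derive1 h1 q * derive1 h2 m
             * (tau X0 (fun x => `|x - mu|) r p - r%:R * c * tau X0 id 1 p) / f_q in
  iid_with_parent X X0 ->
  P.-integrable setT (EFin \o X0) ->
  P.-integrable setT (EFin \o (fun w => X0 w ^+ 2)) ->
  0 < p < 1 -> (1 <= r)%N ->
  derivable F q 1 -> 0 < f_q ->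
  ('E_P[(fun w => X0 w ^+ (2 * r))%R] < +oo)%E ->
  (r = 1%N -> derivable F mu 1 /\ 0 < derive1 F mu) ->
  continuous h1 -> continuous h2 ->
  derivable h1 q 1 -> derivable h2 m 1 ->
  cvg_in_law_normal2 P
    (fun n w => Num.sqrt n%:R * (h1 (sample_quantile (fun i => X i) n p w) - h1 q))
    (fun n w => Num.sqrt n%:R * (h2 (sample_cmoment (fun i => X i) n r w) - h2 m))
    S11 S12 S22
  /\ (derive1 h1 q * derive1 h2 m != 0 -> 0 < V ->
      S12 / Num.sqrt (S11 * S22)
      = Num.sg (derive1 h1 q * derive1 h2 m)
        * (tau X0 (fun x => `|x - mu|) r p - r%:R * c * tau X0 id 1 p)
        / Num.sqrt (p * (1 - p) * V)).
Proof.
move=> F q mu m f_q c V S11 S22 S12 iidX X1 _ p01 r0 dF f0 X2r atom ch1 ch2 dh1 dh2.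
have /andP[p0 p1] := p01.
split; last first.
  move=> h0 V0; set K := tau _ _ _ _ - _; set D := _ * derive1 h2 m in h0 *.
  have pV : 0 < p * (1 - p) * V by rewrite !mulr_gt0// subr_gt0.
  (* The root of this product contains $|D|/f_q$, and dividing $D/f_q$ by it leaves the sign of
     $D$. *)
  have -> : S11 * S22 = (D / f_q) ^+ 2 * (p * (1 - p) * V).
    by rewrite /S11 /S22 /D; field; rewrite lt0r_neq0.
  rewrite sqrtrM ?sqr_ge0// sqrtr_sqr normrM normfV (gtr0_norm f0).
  rewrite -(sgr_div_norm h0) /S12 -/K -/D; field.
  by rewrite lt0r_neq0 ?sqrtr_gt0// normr_eq0 h0 lt0r_neq0.
have Fq : F q = p by exact: cdfR_quantile.
have atom' : r = 1%N -> {for mu, continuous F}.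
  by move=> /atom[dmu _]; apply/differentiable_continuous/derivable1_diffP.
have Xr := L2_abs_power X2r; have Xc := L2_centered r0 X2r.
have [ma a2 a0] := Er_centered_le_ind X0 q.
pose a x : R := F q - le_ind q x.
pose b x : R := `|x - mu| ^+ r - m - r%:R * c * (x - mu).
have mb : measurable_fun setT b.
  apply: measurable_funB; last by apply: measurable_funM => //; exact: measurable_centered.
  by apply: measurable_funB => //; exact: measurable_abs_power.
have b2 : L2 P (fun w => b (X0 w)) by exact: L2_moment_score.
have b0 : Er P (fun w => b (X0 w)) = 0 by exact: Er_moment_score.
(* The scores after the delta method; [f_q] in the denominator comes from the Bahadur
   representation. *)
pose al x : R := derive1 h1 q / f_q * a x.
pose be x : R := derive1 h2 m * b x.
have mq n := measurable_sample_quantile n (@mX _ _ _ _ X) p01.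
have mm n := measurable_sample_cmoment X r n.
have OV : OP P (fun n w => Num.sqrt n%:R * (sample_quantile (fun i => X i) n p w - q)).
  have O := OPD (oP_OP (bahadur_representation iidX p01 dF f0)) (OP_quantile_score p iidX).
  by apply: (OP_ext _ O) => n w; rewrite /= subrK.
have lin := sample_cmoment_linearization iidX r0 X1 X2r atom'.
have OM : OP P (fun n w => Num.sqrt n%:R * (sample_cmoment (fun i => X i) n r w - m)).
  by apply: OP_ext (OPD (oP_OP lin) (OP_iid_sum iidX mb b2 b0)) => n w; rewrite /= subrK.
apply: (@clt_linearized2 _ _ _ _ _ _ iidX al be) => //.
- exact: measurable_funM.
- exact: measurable_funM.
- exact: L2Z.
- exact: L2Z.
- by rewrite ErZ ?a0 ?mulr0//; exact: L2_L1.
- by rewrite ErZ ?b0 ?mulr0//; exact: L2_L1.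
- under eq_Er do rewrite exprMn.
  rewrite ErZ ?Er_quantile_score_sqr//; last exact: a2.2.
  by rewrite /S11; field; rewrite lt0r_neq0.
- rewrite (@eq_Er _ _ _ _ _ (fun w => (derive1 h1 q / f_q * derive1 h2 m) * (a (X0 w) * b (X0 w)))).
    rewrite ErZ; last exact: L2M.
    rewrite [X in _ * X](Er_score_product Fq Xr Xc p1) /S12.
    by move: (tau _ _ _ _ - _) => K; field; rewrite lt0r_neq0.
  by move=> w; rewrite /al /be; ring.
- under eq_Er do rewrite exprMn.
  by rewrite ErZ ?Er_moment_score_sqr//; exact: b2.2.
- move=> n; apply: measurable_funM => //; apply: measurable_funB => //.
  by apply: measurableT_comp => //; exact: continuous_measurable_fun.
- move=> n; apply: measurable_funM => //; apply: measurable_funB => //.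
  by apply: measurableT_comp => //; exact: continuous_measurable_fun.
(* The total error is the delta-method remainder plus the derivative times the Bahadur remainder. *)
- have o1 := delta_method ch1 dh1 mq OV.
  apply: oP_ext (oPD o1 (oPZ (derive1 h1 q) (bahadur_representation iidX p01 dF f0))) => n w.
  rewrite /al -!mulr_sumr -/F -/q -/f_q /a; ring.
- have o2 := delta_method ch2 dh2 mm OM.
  apply: oP_ext (oPD o2 (oPZ (derive1 h2 m) lin)) => n w.
  rewrite /be -!mulr_sumr -/mu -/m -/c /b; ring.
Qed.
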